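(* Let $G$ be a second countable locally compact group. The assignment $((\mathcal{A},A),(\mathfrak{I},I))\mapsto \mathcal{E}xt_G(\mathcal{A},\mathfrak{I})$ on objects, together with $\psi\mapsto\psi_*$, $\psi_*[\beta]:=[q_\psi\circ\beta]$, for morphisms $\psi:\mathfrak{I}\to\mathfrak{I}'$ in $C^*SI_G$, and $\phi\mapsto\phi^*$, $\phi^*[\beta]:=[\beta\circ\phi]$, for morphisms $\phi:\mathcal{A}\to\mathcal{A}'$ in $C^*A_G$, is a well defined functor $\mathcal{E}xt_G:C^*A_G\times C^*SI_G\to Mo^{ab}$, covariant in $\mathfrak{I}$ and contravariant in $\mathcal{A}$.
   Context: Categories. $G$ is a second countable locally compact group; a $G$-action $\alpha$ on a $C^*$-algebra $A$ is continuous if $g\mapsto\alpha_g(a)$ is norm continuous for every $a\in A$. $C^*A_G$ is the category whose objects are pairs $(\mathcal{A},A)$ (often written just $\mathcal{A}$) with $A$ a separable $C^*$-algebra with continuous $G$-action and $\mathcal{A}\subseteq A$ a $G$-invariant dense $*$-subalgebra; morphisms $(\mathcal{A},A)\to(\mathcal{A}',A')$ are $G$-equivariant $*$-homomorphisms $\mathcal{A}\to\mathcal{A}'$ bounded in $C^*$-norm. A linear map on $\mathcal{A}$ (not necessarily equivariant) is called $C^*$-bounded if it is induced by a bounded linear map on $A$. $\mathcal{M}(I)$ is the multiplier algebra of $I$ with the induced $G$-action. A $C^*$-stable $G$-ideal is an object $(\mathfrak{I},I)$ of $C^*A_G$ such that $I\otimes\mathcal{K}\cong I$ equivariantly ($\mathcal{K}$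 = compact operators on a separable infinite-dimensional Hilbert space, with trivial $G$-action) and $\mathfrak{I}$ is an ideal in $\mathcal{M}(I)$. $C^*SI_G$ is the full subcategory of $C^*A_G$ of $C^*$-stable $G$-ideals. Put $\mathcal{C}_{\mathfrak{I}}:=\mathcal{M}(I)/\mathfrak{I}$ (a $*$-algebra with $G$-action) and let $q_{\mathfrak{I}}:\mathcal{M}(I)\to\mathcal{C}_{\mathfrak{I}}$ be the quotient map. It is taken as part of the setup that a morphism $\psi:\mathfrak{I}\to\mathfrak{I}'$ in $C^*SI_G$ extends to an equivariant $*$-homomorphism $\mathcal{M}(I)\to\mathcal{M}(I')$, and $q_\psi:\mathcal{C}_{\mathfrak{I}}\to\mathcal{C}_{\mathfrak{I}'}$ denotes the induced equivariant map. $Mo^{ab}$ is the category of abelian monoids with additive maps $k$ satisfying $k(0)=0$. Busby mappings. A Busby mapping is an equivariant $*$-homomorphism $\beta:\mathcal{A}\to\mathcal{C}_{\mathfrak{I}}$. It is bounded if its composition with $\mathcal{C}_{\mathfrak{I}}\to\mathcal{M}(I)/I$ is $C^*$-bounded; it is trivial if $\beta=q_{\mathfrak{I}}\pi$ for a $C^*$-bounded $G$-equivariant $*$-homomorphism $\pi:\mathcal{A}\to\mathcal{M}(I)$. $B_G(\mathcal{A},\mathfrak{I})$ is the set of bounded $G$-equivariant Busby mappings. The monoid. $U^a(\mathfrak{I})$ is the set of unitaries $u\in\mathcal{M}(I)$ such that $q_{\mathfrak{I}}(u)$ is $G$-invariant. Strong equivalence on $B_G(\mathcal{A},\mathfrak{I})$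 is equivalence under the adjoint action of $U^a(\mathfrak{I})$ on $\mathcal{C}_{\mathfrak{I}}$; $E_G(\mathcal{A},\mathfrak{I})$ is the set of strong equivalence classes and $D_G(\mathcal{A},\mathfrak{I})$ the set of strong equivalence classes of trivial Busby mappings. There are $G$-invariant isometries $V_1,V_2\in\mathcal{M}(I)$ with $V_1V_1^*+V_2V_2^*=1$; the sum of $\beta_1,\beta_2$ is $\beta_1+\beta_2:=\lambda\circ(\beta_1\oplus\beta_2)$, where $\lambda:M_2\otimes\mathcal{C}_{\mathfrak{I}}\to\mathcal{C}_{\mathfrak{I}}$ is the isomorphism induced by conjugation with $V=V_1\oplus V_2:I\oplus I\to I$. This makes $E_G(\mathcal{A},\mathfrak{I})$ an abelian semigroup (independent of $V$) with subsemigroup $D_G(\mathcal{A},\mathfrak{I})$. Two classes are stably equivalent if they become equal in $E_G$ after adding trivial Busby mappings to each; $\mathcal{E}xt_G(\mathcal{A},\mathfrak{I}):=E_G(\mathcal{A},\mathfrak{I})/D_G(\mathcal{A},\mathfrak{I})$ is the abelian monoid of stable equivalence classes, whose zero is the class of trivial Busby mappings; $[\beta]$ denotes the class of $\beta$.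
   Formalization: Not every morphism ψ of the full subcategory C*SI_G extends to M(I)→M(I') (e.g. C_0((0,1))⊗K→C_0(R)⊗K), so a morphism here is ψ together with a chosen equivariant *-homomorphic extension, which induces q_ψ. *)

(* Defs.v *)
From HB Require Import structures.
From mathcomp Require Import all_boot all_order all_algebra complex.
From mathcomp Require Import all_classical all_reals all_analysis.

Set Implicit Arguments.
Unset Strict Implicit.
Unset Printing Implicit Defensive.

Import Order.TTheory GRing.Theory Num.Theory.
Import numFieldNormedType.Exports.

Local Open Scope classical_set_scope.
Local Open Scope ring_scope.

HB.mixin Record isTopGroup G of Topological G & Group G := {
  mulg_continuous : continuous (fun x : G * G => (x.1 * x.2)%g);
  invg_continuous : continuous (fun x : G => (x^-1)%g)
}.

#[short(type="topGroupType")]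
HB.structure Definition TopGroup :=
  {G of isTopGroup G & Topological G & Group G}.

HB.mixin Record Lmodule_isStarAlgebra (C : numClosedFieldType) V
    of GRing.Lmodule C V := {
  smul : V -> V -> V;
  adj : V -> V;
  smulA : associative smul;
  smulDl : left_distributive smul +%R;
  smulDr : right_distributive smul +%R;
  smulZl : forall (c : C) x y, smul (c *: x) y = c *: smul x y;
  smulZr : forall (c : C) x y, smul x (c *: y) = c *: smul x y;
  adjK : involutive adj;
  adjD : {morph adj : x y / x + y};
  adjZ : forall (c : C) x, adj (c *: x) = c^* *: adj x;
  adjM : forall x y, adj (smul x y) = smul (adj y) (adj x)
}.

#[short(type="starAlgType")]
HB.structure Definition StarAlgebra (C : numClosedFieldType) :=
  {V of Lmodule_isStarAlgebra C V & GRing.Lmodule C V}.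

Notation "x ** y" := (smul x y) (at level 40, left associativity) : ring_scope.

HB.mixin Record StarAlgebra_isCStar (C : numClosedFieldType) V
    of StarAlgebra C V & NormedModule C V := {
  norm_smul : forall x y : V, `|x ** y| <= `|x| * `|y|;
  norm_adjM : forall x : V, `|adj x ** x| = `|x| ^+ 2
}.

#[short(type="cstarAlgType")]
HB.structure Definition CStarAlgebra (C : numClosedFieldType) :=
  {V of StarAlgebra_isCStar C V & StarAlgebra C V & CompleteNormedModule C V}.

Section StarAlgebraTheory.
Variables (C : numClosedFieldType) (B : starAlgType C).
Implicit Types x y : B.

Lemma smul0r x : 0 ** x = 0.
Proof. by apply: (addIr (0 ** x)); rewrite -smulDl !add0r. Qed.

Lemma smulr0 x : x ** 0 = 0.
Proof. by apply: (addIr (x ** 0)); rewrite -smulDr !add0r. Qed.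

Lemma smulNr x y : (- x) ** y = - (x ** y).
Proof. by rewrite -(scaleN1r x) smulZl scaleN1r. Qed.

Lemma smulrN x y : x ** (- y) = - (x ** y).
Proof. by rewrite -(scaleN1r y) smulZr scaleN1r. Qed.

Lemma smulBl x y z : (x - y) ** z = x ** z - y ** z.
Proof. by rewrite smulDl smulNr. Qed.

Lemma smulBr x y z : z ** (x - y) = z ** x - z ** y.
Proof. by rewrite smulDr smulrN. Qed.

Lemma adj0 : adj (0 : B) = 0.
Proof. by apply: (addIr (adj (0 : B))); rewrite -adjD !add0r. Qed.

Lemma adjN x : adj (- x) = - adj x.
Proof. by apply: (addIr (adj x)); rewrite -adjD !addNr adj0. Qed.

Lemma adjB x y : adj (x - y) = adj x - adj y.
Proof. by rewrite adjD adjN. Qed.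

End StarAlgebraTheory.

Definition star_hom (C : numClosedFieldType) (B D : starAlgType C)
    (f : B -> D) : Prop :=
  [/\ linear f, {morph f : x y / x ** y} & {morph f : x / adj x}].

Record star_subalg (C : numClosedFieldType) (B : starAlgType C) := StarSubalg {
  subalg_set :> B -> Prop;
  subalg0 : subalg_set 0;
  subalgD : forall x y, subalg_set x -> subalg_set y -> subalg_set (x + y);
  subalgZ : forall (c : C) x, subalg_set x -> subalg_set (c *: x);
  subalgM : forall x y, subalg_set x -> subalg_set y -> subalg_set (x ** y);
  subalg_adj : forall x, subalg_set x -> subalg_set (adj x)
}.

Section SubalgType.
Variables (C : numClosedFieldType) (B : starAlgType C) (S : star_subalg B).

Definition subalg : Type := {x : B | S x}.
Definition subalg_val (x : subalg) : B := sval x.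

Lemma subalg_val_inj : injective subalg_val.
Proof. by move=> [x px] [y py] /= xy; exact: eq_exist. Qed.

Lemma subalgN x : S x -> S (- x).
Proof. by rewrite -scaleN1r; exact: subalgZ. Qed.

HB.instance Definition _ := gen_eqMixin subalg.
HB.instance Definition _ := gen_choiceMixin subalg.

Definition sub_zero : subalg := exist _ 0 (subalg0 S).
Definition sub_add (x y : subalg) : subalg :=
  exist _ (sval x + sval y) (subalgD (svalP x) (svalP y)).
Definition sub_opp (x : subalg) : subalg :=
  exist _ (- sval x) (subalgN (svalP x)).
Definition sub_scale (c : C) (x : subalg) : subalg :=
  exist _ (c *: sval x) (subalgZ c (svalP x)).
Definition sub_mul (x y : subalg) : subalg :=
  exist _ (sval x ** sval y) (subalgM (svalP x) (svalP y)).
Definition sub_adj (x : subalg) : subalg :=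
  exist _ (adj (sval x)) (subalg_adj (svalP x)).

Let inj := subalg_val_inj.

Fact sub_addA : associative sub_add.
Proof. by move=> x y z; apply: inj; exact: addrA. Qed.
Fact sub_addC : commutative sub_add.
Proof. by move=> x y; apply: inj; exact: addrC. Qed.
Fact sub_add0 : left_id sub_zero sub_add.
Proof. by move=> x; apply: inj; exact: add0r. Qed.
Fact sub_addN : left_inverse sub_zero sub_opp sub_add.
Proof. by move=> x; apply: inj; exact: addNr. Qed.

HB.instance Definition _ :=
  GRing.isZmodule.Build subalg sub_addA sub_addC sub_add0 sub_addN.

Fact sub_scaleA a b v : sub_scale a (sub_scale b v) = sub_scale (a * b) v.
Proof. by apply: inj; exact: scalerA. Qed.
Fact sub_scale1 : left_id 1 sub_scale.
Proof. by move=> x; apply: inj; exact: scale1r. Qed.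
Fact sub_scaleDr : right_distributive sub_scale +%R.
Proof. by move=> c x y; apply: inj; exact: scalerDr. Qed.
Fact sub_scaleDl v : {morph sub_scale^~ v : a b / a + b}.
Proof. by move=> a b; apply: inj; exact: scalerDl. Qed.

HB.instance Definition _ := GRing.Zmodule_isLmodule.Build C subalg
  sub_scaleA sub_scale1 sub_scaleDr sub_scaleDl.

Fact sub_mulA : associative sub_mul.
Proof. by move=> x y z; apply: inj; exact: smulA. Qed.
Fact sub_mulDl : left_distributive sub_mul +%R.
Proof. by move=> x y z; apply: inj; exact: smulDl. Qed.
Fact sub_mulDr : right_distributive sub_mul +%R.
Proof. by move=> x y z; apply: inj; exact: smulDr. Qed.
Fact sub_mulZl (c : C) x y : sub_mul (c *: x) y = c *: sub_mul x y.
Proof. by apply: inj; exact: smulZl. Qed.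
Fact sub_mulZr (c : C) x y : sub_mul x (c *: y) = c *: sub_mul x y.
Proof. by apply: inj; exact: smulZr. Qed.
Fact sub_adjK : involutive sub_adj.
Proof. by move=> x; apply: inj; exact: adjK. Qed.
Fact sub_adjD : {morph sub_adj : x y / x + y}.
Proof. by move=> x y; apply: inj; exact: adjD. Qed.
Fact sub_adjZ (c : C) x : sub_adj (c *: x) = c^* *: sub_adj x.
Proof. by apply: inj; exact: adjZ. Qed.
Fact sub_adjM x y : sub_adj (sub_mul x y) = sub_mul (sub_adj y) (sub_adj x).
Proof. by apply: inj; exact: adjM. Qed.

HB.instance Definition _ := Lmodule_isStarAlgebra.Build C subalg
  sub_mulA sub_mulDl sub_mulDr sub_mulZl sub_mulZr
  sub_adjK sub_adjD sub_adjZ sub_adjM.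

End SubalgType.

Record star_ideal (C : numClosedFieldType) (B : starAlgType C) := StarIdeal {
  ideal_set :> B -> Prop;
  ideal0 : ideal_set 0;
  idealD : forall x y, ideal_set x -> ideal_set y -> ideal_set (x + y);
  idealZ : forall (c : C) x, ideal_set x -> ideal_set (c *: x);
  idealMl : forall x y, ideal_set y -> ideal_set (x ** y);
  idealMr : forall x y, ideal_set x -> ideal_set (x ** y);
  ideal_adj : forall x, ideal_set x -> ideal_set (adj x)
}.

Section Quotient.
Variables (C : numClosedFieldType) (B : starAlgType C) (S : star_ideal B).

Definition coset (x : B) : set B := [set y | S (y - x)].

Definition quot : Type := {X : set B | exists x, X = coset x}.

Definition piq (x : B) : quot := exist _ (coset x) (ex_intro _ x erefl).

Definition repq (X : quot) : B := sval (cid (svalP X)).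

Lemma idealN x : S x -> S (- x).
Proof. by rewrite -scaleN1r; exact: idealZ. Qed.

Lemma idealB x y : S x -> S y -> S (x - y).
Proof. by move=> Sx /idealN; exact: idealD. Qed.

Lemma piqP x y : piq x = piq y <-> S (x - y).
Proof.
split=> [/(congr1 sval) /= xy|Sxy].
  suff: coset y x by [].
  by rewrite -xy /coset /= subrr; exact: ideal0.
apply: eq_exist; apply/seteqP; split=> z; rewrite /coset /= => h.
  by have := idealD h Sxy; rewrite addrA subrK.
by have := idealB h Sxy; rewrite opprB addrA subrK.
Qed.

Lemma repqK : cancel repq piq.
Proof.
move=> X; rewrite /repq; case: cid => x /= XE.
by case: X XE => X hX /= XE; exact: eq_exist.
Qed.

Lemma repq_piq x : S (repq (piq x) - x).
Proof. by apply/piqP; rewrite repqK. Qed.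

Lemma quotW (P : quot -> Prop) : (forall x, P (piq x)) -> forall X, P X.
Proof. by move=> h X; rewrite -(repqK X). Qed.

HB.instance Definition _ := gen_eqMixin quot.
HB.instance Definition _ := gen_choiceMixin quot.

Definition quot_add (X Y : quot) := piq (repq X + repq Y).
Definition quot_opp (X : quot) := piq (- repq X).
Definition quot_scale (c : C) (X : quot) := piq (c *: repq X).
Definition quot_mul (X Y : quot) := piq (repq X ** repq Y).
Definition quot_adj (X : quot) := piq (adj (repq X)).

Lemma quot_addE x y : quot_add (piq x) (piq y) = piq (x + y).
Proof.
apply/piqP; have := idealD (repq_piq x) (repq_piq y).
by rewrite addrACA opprD.
Qed.

Lemma quot_oppE x : quot_opp (piq x) = piq (- x).
Proof.
by apply/piqP; have := idealN (repq_piq x); rewrite opprB opprK addrC.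
Qed.

Lemma quot_scaleE c x : quot_scale c (piq x) = piq (c *: x).
Proof.
by apply/piqP; have := idealZ c (repq_piq x); rewrite scalerBr.
Qed.

Lemma quot_mulE x y : quot_mul (piq x) (piq y) = piq (x ** y).
Proof.
apply/piqP.
have := idealD (idealMr (repq (piq y)) (repq_piq x))
               (idealMl x (repq_piq y)).
by rewrite smulBl smulBr addrA subrK.
Qed.

Lemma quot_adjE x : quot_adj (piq x) = piq (adj x).
Proof. by apply/piqP; have := ideal_adj (repq_piq x); rewrite adjB. Qed.

Fact quot_addA : associative quot_add.
Proof.
by elim/quotW=> x; elim/quotW=> y; elim/quotW=> z; rewrite !quot_addE addrA.
Qed.
Fact quot_addC : commutative quot_add.
Proof. by elim/quotW=> x; elim/quotW=> y; rewrite !quot_addE addrC. Qed.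
Fact quot_add0 : left_id (piq 0) quot_add.
Proof. by elim/quotW=> x; rewrite quot_addE add0r. Qed.
Fact quot_addN : left_inverse (piq 0) quot_opp quot_add.
Proof. by elim/quotW=> x; rewrite quot_oppE quot_addE addNr. Qed.

HB.instance Definition _ :=
  GRing.isZmodule.Build quot quot_addA quot_addC quot_add0 quot_addN.

Lemma piqD x y : piq x + piq y = piq (x + y). Proof. exact: quot_addE. Qed.

Fact quot_scaleA a b v : quot_scale a (quot_scale b v) = quot_scale (a * b) v.
Proof. by elim/quotW: v => x; rewrite !quot_scaleE scalerA. Qed.
Fact quot_scale1 : left_id 1 quot_scale.
Proof. by elim/quotW=> x; rewrite !quot_scaleE scale1r. Qed.
Fact quot_scaleDr : right_distributive quot_scale +%R.
Proof.
by move=> c; elim/quotW=> x; elim/quotW=> y;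
  rewrite piqD !quot_scaleE piqD scalerDr.
Qed.
Fact quot_scaleDl v : {morph quot_scale^~ v : a b / a + b}.
Proof.
by move=> a b; elim/quotW: v => x; rewrite !quot_scaleE piqD scalerDl.
Qed.

HB.instance Definition _ := GRing.Zmodule_isLmodule.Build C quot
  quot_scaleA quot_scale1 quot_scaleDr quot_scaleDl.

Lemma piqZ (c : C) x : c *: piq x = piq (c *: x). Proof. exact: quot_scaleE. Qed.

Fact quot_mulA : associative quot_mul.
Proof.
by elim/quotW=> x; elim/quotW=> y; elim/quotW=> z; rewrite !quot_mulE smulA.
Qed.
Fact quot_mulDl : left_distributive quot_mul +%R.
Proof.
by elim/quotW=> x; elim/quotW=> y; elim/quotW=> z;
  rewrite !(piqD, quot_mulE) smulDl.
Qed.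
Fact quot_mulDr : right_distributive quot_mul +%R.
Proof.
by elim/quotW=> x; elim/quotW=> y; elim/quotW=> z;
  rewrite !(piqD, quot_mulE) smulDr.
Qed.
Fact quot_mulZl (c : C) x y : quot_mul (c *: x) y = c *: quot_mul x y.
Proof.
by elim/quotW: x => x; elim/quotW: y => y; rewrite !(piqZ, quot_mulE) smulZl.
Qed.
Fact quot_mulZr (c : C) x y : quot_mul x (c *: y) = c *: quot_mul x y.
Proof.
by elim/quotW: x => x; elim/quotW: y => y; rewrite !(piqZ, quot_mulE) smulZr.
Qed.
Fact quot_adjK : involutive quot_adj.
Proof. by elim/quotW=> x; rewrite !quot_adjE adjK. Qed.
Fact quot_adjD : {morph quot_adj : x y / x + y}.
Proof.
by elim/quotW=> x; elim/quotW=> y; rewrite !(piqD, quot_adjE) adjD.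
Qed.
Fact quot_adjZ (c : C) x : quot_adj (c *: x) = c^* *: quot_adj x.
Proof. by elim/quotW: x => x; rewrite !(piqZ, quot_adjE) adjZ. Qed.
Fact quot_adjM x y : quot_adj (quot_mul x y) = quot_mul (quot_adj y) (quot_adj x).
Proof.
by elim/quotW: x => x; elim/quotW: y => y; rewrite !(quot_mulE, quot_adjE) adjM.
Qed.

HB.instance Definition _ := Lmodule_isStarAlgebra.Build C quot
  quot_mulA quot_mulDl quot_mulDr quot_mulZl quot_mulZr
  quot_adjK quot_adjD quot_adjZ quot_adjM.

End Quotient.

(* The map induced on quotients by [f]; it is only meaningful when [f] sends
   [S] into [S'], the value at a coset being read off a chosen representative. *)
Definition qmap (C : numClosedFieldType) (B B' : starAlgType C)
    (S : star_ideal B) (S' : star_ideal B') (f : B -> B') (X : quot S) :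
  quot S' := piq S' (f (repq X)).
Arguments qmap {C B B' S S'} f X.

(* Double centralizers in the sense of Busby; linearity, boundedness and the
   module identities are automatic (see [lmultD], [lmultM] below). *)
Record mult (C : numClosedFieldType) (I : cstarAlgType C) := Mult {
  lmult : I -> I;
  rmult : I -> I;
  multP : forall a b, a ** lmult b = rmult a ** b
}.

Section Multiplier.
Variables (C : numClosedFieldType) (I : cstarAlgType C).
Implicit Types (m n : mult I) (x y a b : I).

Lemma nondeg_l x y : (forall a, a ** x = a ** y) -> x = y.
Proof.
move=> h; apply/eqP; rewrite -subr_eq0 -normr_eq0 -sqrf_eq0 -norm_adjM.
by rewrite smulBr h subrr normr0.
Qed.

Lemma nondeg_r x y : (forall a, x ** a = y ** a) -> x = y.
Proof.
move=> h; apply: (can_inj (@adjK _ I)); apply: nondeg_l => a.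
by rewrite -(adjK a) -!adjM h.
Qed.

Lemma lmultD m : {morph lmult m : x y / x + y}.
Proof.
by move=> x y; apply: nondeg_l => a; rewrite multP !smulDr !multP.
Qed.
Lemma lmultZ m (c : C) x : lmult m (c *: x) = c *: lmult m x.
Proof. by apply: nondeg_l => a; rewrite multP !smulZr multP. Qed.
Lemma lmultM m x y : lmult m (x ** y) = lmult m x ** y.
Proof. by apply: nondeg_l => a; rewrite multP !smulA multP. Qed.
Lemma rmultD m : {morph rmult m : x y / x + y}.
Proof.
by move=> x y; apply: nondeg_r => a; rewrite -multP !smulDl !multP.
Qed.
Lemma rmultZ m (c : C) x : rmult m (c *: x) = c *: rmult m x.
Proof. by apply: nondeg_r => a; rewrite -multP !smulZl multP. Qed.
Lemma rmultM m x y : rmult m (x ** y) = x ** rmult m y.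
Proof. by apply: nondeg_r => a; rewrite -multP -!smulA multP. Qed.

Lemma mult_ext m n : lmult m =1 lmult n -> rmult m =1 rmult n -> m = n.
Proof.
case: m n => [l r h] [l' r' h'] /= /funext ll /funext rr.
by subst l' r'; congr Mult; exact: Prop_irrelevance.
Qed.

HB.instance Definition _ := gen_eqMixin (mult I).
HB.instance Definition _ := gen_choiceMixin (mult I).

Fact mzero_proof a b : a ** (0 : I) = 0 ** b.
Proof. by rewrite smul0r smulr0. Qed.
Definition mzero := Mult mzero_proof.

Fact madd_proof m n a b :
  a ** (lmult m b + lmult n b) = (rmult m a + rmult n a) ** b.
Proof. by rewrite smulDl smulDr !multP. Qed.
Definition madd m n := Mult (madd_proof m n).

Fact mopp_proof m a b : a ** (- lmult m b) = (- rmult m a) ** b.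
Proof. by rewrite smulNr smulrN multP. Qed.
Definition mopp m := Mult (mopp_proof m).

Fact mscale_proof (c : C) m a b : a ** (c *: lmult m b) = (c *: rmult m a) ** b.
Proof. by rewrite smulZl smulZr multP. Qed.
Definition mscale c m := Mult (mscale_proof c m).

Fact mone_proof a b : a ** b = a ** b. Proof. by []. Qed.
Definition mone := Mult mone_proof.

Fact mmul_proof m n a b :
  a ** lmult m (lmult n b) = rmult n (rmult m a) ** b.
Proof. by rewrite !multP. Qed.
Definition mmul m n := Mult (mmul_proof m n).

Fact madj_proof m a b : a ** adj (rmult m (adj b)) = adj (lmult m (adj a)) ** b.
Proof. by rewrite -{1}(adjK a) -{2}(adjK b) -!adjM multP. Qed.
Definition madj m := Mult (madj_proof m).

Fact maddA : associative madd.
Proof. by move=> m n p; apply: mult_ext => x /=; rewrite addrA. Qed.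
Fact maddC : commutative madd.
Proof. by move=> m n; apply: mult_ext => x /=; rewrite addrC. Qed.
Fact madd0 : left_id mzero madd.
Proof. by move=> m; apply: mult_ext => x /=; rewrite add0r. Qed.
Fact maddN : left_inverse mzero mopp madd.
Proof. by move=> m; apply: mult_ext => x /=; rewrite addNr. Qed.

HB.instance Definition _ :=
  GRing.isZmodule.Build (mult I) maddA maddC madd0 maddN.

Fact mscaleA (c d : C) m : mscale c (mscale d m) = mscale (c * d) m.
Proof. by apply: mult_ext => x /=; rewrite scalerA. Qed.
Fact mscale1 : left_id 1 mscale.
Proof. by move=> m; apply: mult_ext => x /=; rewrite scale1r. Qed.
Fact mscaleDr : right_distributive mscale +%R.
Proof. by move=> c m n; apply: mult_ext => x /=; rewrite scalerDr. Qed.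
Fact mscaleDl m : {morph mscale^~ m : c d / c + d}.
Proof. by move=> c d; apply: mult_ext => x /=; rewrite scalerDl. Qed.

HB.instance Definition _ := GRing.Zmodule_isLmodule.Build C (mult I)
  mscaleA mscale1 mscaleDr mscaleDl.

Fact mmulA : associative mmul.
Proof. by move=> m n p; apply: mult_ext. Qed.
Fact mmulDl : left_distributive mmul +%R.
Proof. by move=> m n p; apply: mult_ext => x //=; rewrite rmultD. Qed.
Fact mmulDr : right_distributive mmul +%R.
Proof. by move=> m n p; apply: mult_ext => x //=; rewrite lmultD. Qed.
Fact mmulZl (c : C) m n : mmul (c *: m) n = c *: mmul m n.
Proof. by apply: mult_ext => x //=; rewrite rmultZ. Qed.
Fact mmulZr (c : C) m n : mmul m (c *: n) = c *: mmul m n.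
Proof. by apply: mult_ext => x //=; rewrite lmultZ. Qed.
Fact madjK : involutive madj.
Proof. by move=> m; apply: mult_ext => x /=; rewrite !adjK. Qed.
Fact madjD : {morph madj : m n / m + n}.
Proof. by move=> m n; apply: mult_ext => x /=; rewrite adjD. Qed.
Fact madjZ (c : C) m : madj (c *: m) = c^* *: madj m.
Proof. by apply: mult_ext => x /=; rewrite adjZ. Qed.
Fact madjM m n : madj (mmul m n) = mmul (madj n) (madj m).
Proof. by apply: mult_ext => x /=; rewrite adjK. Qed.

HB.instance Definition _ := Lmodule_isStarAlgebra.Build C (mult I)
  mmulA mmulDl mmulDr mmulZl mmulZr madjK madjD madjZ madjM.

Fact membed_proof i a b : a ** (i ** b) = (a ** i) ** b.
Proof. exact: smulA. Qed.
Definition membed i : mult I := Mult (membed_proof i).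

Lemma membed_hom : star_hom membed.
Proof.
split=> [c x y|x y|x]; apply: mult_ext => z /=.
- by rewrite smulDl smulZl.
- by rewrite smulDr smulZr.
- by rewrite smulA.
- by rewrite smulA.
- by rewrite adjM adjK.
- by rewrite adjM adjK.
Qed.

Lemma mmul_membed m i : m ** membed i = membed (lmult m i).
Proof.
by apply: mult_ext => x /=; [exact: lmultM | rewrite multP].
Qed.
Lemma membed_mmul m i : membed i ** m = membed (rmult m i).
Proof.
by apply: mult_ext => x /=; [rewrite multP | exact: rmultM].
Qed.

(* [J], seen inside the multiplier algebra of [I], is a two-sided ideal. *)
Definition mult_ideal_of (J : star_subalg I) : Prop :=
  forall m j, J j -> J (lmult m j) /\ J (rmult m j).

Section MultIdeal.
Variables (J : star_subalg I) (hJ : mult_ideal_of J).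

Definition mideal_set : set (mult I) := [set membed j | j in J].

Fact mideal0 : mideal_set 0.
Proof.
exists 0; first exact: subalg0.
by apply: mult_ext => x /=; rewrite ?smul0r ?smulr0.
Qed.
Fact midealD m n : mideal_set m -> mideal_set n -> mideal_set (m + n).
Proof.
move=> [i Ji <-] [j Jj <-]; exists (i + j); first exact: subalgD.
by have [l _ _] := membed_hom; have := l 1 i j; rewrite !scale1r.
Qed.
Fact midealZ (c : C) m : mideal_set m -> mideal_set (c *: m).
Proof.
move=> [i Ji <-]; exists (c *: i); first exact: subalgZ.
by apply: mult_ext => x /=; rewrite ?smulZl ?smulZr.
Qed.
Fact midealMl m n : mideal_set n -> mideal_set (m ** n).
Proof.
by move=> [i Ji <-]; exists (lmult m i); [have [] := hJ m Ji|rewrite mmul_membed].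
Qed.
Fact midealMr m n : mideal_set m -> mideal_set (m ** n).
Proof.
by move=> [i Ji <-]; exists (rmult n i); [have [] := hJ n Ji|rewrite membed_mmul].
Qed.
Fact mideal_adj m : mideal_set m -> mideal_set (adj m).
Proof.
move=> [i Ji <-]; exists (adj i); first exact: subalg_adj.
by have [_ _ ->] := membed_hom.
Qed.

Definition mideal : star_ideal (mult I) :=
  StarIdeal mideal0 midealD midealZ midealMl midealMr mideal_adj.
End MultIdeal.

Definition full_subalg : star_subalg I :=
  @StarSubalg C I setT Logic.I (fun _ _ _ _ => Logic.I) (fun _ _ _ => Logic.I)
    (fun _ _ _ _ => Logic.I) (fun _ _ => Logic.I).

Fact full_ideal : mult_ideal_of full_subalg. Proof. by []. Qed.

End Multiplier.

Section Norms.
Variable R : realType.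

Definition rnorm (V : normedModType R[i]) (x : V) : R := complex.Re `|x|.

Variable I : cstarAlgType R[i].

Definition mult_norm (m : mult I) : \bar R :=
  ereal_sup [set (rnorm (lmult m x))%:E | x in [set x | rnorm x <= 1]].

(* M(I)/I, with the quotient norm [corona_norm] *)
Definition corona : Type := quot (mideal (@full_ideal _ I)).
HB.instance Definition _ := StarAlgebra.copy corona
  (quot (mideal (@full_ideal _ I))).

Definition corona_norm (X : corona) : \bar R :=
  ereal_inf [set mult_norm m | m in [set m | piq _ m = X]].

End Norms.

Definition separable (T : topologicalType) : Prop :=
  exists D : set T, countable D /\ dense D.

Record gcstar (R : realType) (G : topGroupType) := GCStar {
  gcalg :> cstarAlgType R[i];
  gact : G -> gcalg -> gcalg;
  gact_hom : forall g, star_hom (gact g);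
  gact1 : forall a, gact 1%g a = a;
  gactM : forall g h a, gact (g * h)%g a = gact g (gact h a);
  gact_continuous : forall a, continuous (fun g => gact g a);
  gc_separable : separable gcalg
}.

Section MultAction.
Variables (R : realType) (G : topGroupType) (I : gcstar R G).

Fact gmult_proof (g : G) (m : mult I) a b :
  a ** gact g (lmult m (gact g^-1%g b)) = gact g (rmult m (gact g^-1%g a)) ** b.
Proof.
have K (x : I) : x = gact g (gact g^-1%g x) by rewrite -gactM mulgV gact1.
have [_ gM _] := gact_hom I g.
by rewrite {1}(K a) {2}(K b) -!gM multP.
Qed.

Definition gmult (g : G) (m : mult I) : mult I := Mult (gmult_proof g m).

End MultAction.

Record category := Category {
  Ob :> Type;
  Mor : Ob -> Ob -> Type;
  idm : forall X, Mor X X;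
  ccomp : forall X Y Z, Mor Y Z -> Mor X Y -> Mor X Z;
  ccomp_idl : forall X Y (f : Mor X Y), ccomp (idm Y) f = f;
  ccomp_idr : forall X Y (f : Mor X Y), ccomp f (idm X) = f;
  ccompA : forall X Y Z W (h : Mor Z W) (g : Mor Y Z) (f : Mor X Y),
    ccomp h (ccomp g f) = ccomp (ccomp h g) f
}.
Arguments idm {c} X.
Arguments ccomp {c X Y Z}.

Definition op_cat (C : category) : category :=
  @Category (Ob C) (fun X Y => Mor Y X) (fun X => idm X)
    (fun X Y Z g f => ccomp f g)
    (fun X Y f => ccomp_idr f) (fun X Y f => ccomp_idl f)
    (fun X Y Z W h g f => esym (ccompA f g h)).

Section ProdCat.
Variables C D : category.
Let H (X Y : C * D) : Type := (Mor X.1 Y.1 * Mor X.2 Y.2)%type.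
Let i X : H X X := (idm X.1, idm X.2).
Let c X Y Z (g : H Y Z) (f : H X Y) : H X Z := (ccomp g.1 f.1, ccomp g.2 f.2).
Fact prod_idl X Y (f : H X Y) : c (i Y) f = f.
Proof. by case: f => f1 f2; rewrite /c /= !ccomp_idl. Qed.
Fact prod_idr X Y (f : H X Y) : c f (i X) = f.
Proof. by case: f => f1 f2; rewrite /c /= !ccomp_idr. Qed.
Fact prod_compA X Y Z W (h : H Z W) (g : H Y Z) (f : H X Y) :
  c h (c g f) = c (c h g) f.
Proof. by rewrite /c /= !ccompA. Qed.
Definition prod_cat : category := Category prod_idl prod_idr prod_compA.
End ProdCat.

Definition is_functor (C D : category) (F0 : C -> D)
    (F1 : forall X Y, Mor X Y -> Mor (F0 X) (F0 Y)) : Prop :=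
  (forall X, F1 X X (idm X) = idm (F0 X)) /\
  (forall X Y Z (g : Mor Y Z) (f : Mor X Y),
    F1 X Z (ccomp g f) = ccomp (F1 Y Z g) (F1 X Y f)).

Lemma additive_ext (U V : nmodType) (f g : {additive U -> V}) : f =1 g -> f = g.
Proof.
case: f g => [f [[hf]]] [g [[hg]]] /= /funext fg; subst g.
by rewrite (Prop_irrelevance hf hg).
Qed.

Section MoAb.
Let H (U V : nmodType) : Type := {additive U -> V}.
Let i (U : nmodType) : H U U := idfun.
Let c (U V W : nmodType) (g : H V W) (f : H U V) : H U W := g \o f.
Fact moab_idl U V (f : H U V) : c (i V) f = f.
Proof. exact: additive_ext. Qed.
Fact moab_idr U V (f : H U V) : c f (i U) = f.
Proof. exact: additive_ext. Qed.
Fact moab_compA U V W X (h : H W X) (g : H V W) (f : H U V) :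
  c h (c g f) = c (c h g) f.
Proof. exact: additive_ext. Qed.
Definition MoAb : category := Category moab_idl moab_idr moab_compA.
End MoAb.

Record cga (R : realType) (G : topGroupType) := CGA {
  cga_alg :> gcstar R G;
  cga_sub : star_subalg cga_alg;
  cga_dense : dense [set a | cga_sub a];
  cga_invariant : forall g a, cga_sub a -> cga_sub (gact g a)
}.

Section CAG.
Variables (R : realType) (G : topGroupType).

Definition carrier (A : cga R G) := subalg (cga_sub A).

Definition gsub (A : cga R G) (g : G) (a : carrier A) : carrier A :=
  exist _ (gact g (subalg_val a)) (cga_invariant g (svalP a)).

Record cga_mor (A B : cga R G) := CGAMor {
  cga_fun :> carrier A -> carrier B;
  cga_fun_hom : star_hom cga_fun;
  cga_fun_equiv : forall g a, cga_fun (gsub g a) = gsub g (cga_fun a);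
  cga_fun_bounded : exists c : R,
    forall a, rnorm (subalg_val (cga_fun a)) <= c * rnorm (subalg_val a)
}.

Lemma cga_mor_ext A B (f g : cga_mor A B) : f =1 g -> f = g.
Proof.
case: f g => [f f1 f2 f3] [g g1 g2 g3] /= /funext fg; subst g.
by congr CGAMor; exact: Prop_irrelevance.
Qed.

Lemma star_hom_id (B : starAlgType R[i]) : star_hom (@id B).
Proof. by []. Qed.

Lemma star_hom_comp (B D E : starAlgType R[i]) (g : D -> E) (f : B -> D) :
  star_hom g -> star_hom f -> star_hom (g \o f).
Proof.
move=> [gl gM gs] [fl fM fs]; split=> [c x y|x y|x] /=.
- by rewrite fl gl.
- by rewrite fM gM.
- by rewrite fs gs.
Qed.

Fact cga_id_bounded (A : cga R G) : exists c : R,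
  forall a : carrier A, rnorm (subalg_val a) <= c * rnorm (subalg_val a).
Proof. by exists 1 => a; rewrite mul1r. Qed.

Definition cga_id (A : cga R G) : cga_mor A A :=
  CGAMor (@star_hom_id _) (fun _ _ => erefl) (cga_id_bounded A).

Lemma rnorm_ge0 (V : normedModType R[i]) (x : V) : 0 <= rnorm x.
Proof. by have := normr_ge0 x; rewrite /rnorm lecE => /andP[]. Qed.

Section Comp.
Variables (A B D : cga R G) (g : cga_mor B D) (f : cga_mor A B).
Fact cga_comp_equiv h a : (g \o f) (gsub h a) = gsub h ((g \o f) a).
Proof. by rewrite /= !cga_fun_equiv. Qed.
Fact cga_comp_bounded : exists c : R, forall a,
  rnorm (subalg_val ((g \o f) a)) <= c * rnorm (subalg_val a).
Proof.
have [c hc] := cga_fun_bounded g; have [d hd] := cga_fun_bounded f.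
exists (`|c| * d) => a /=; apply: le_trans (hc _) _.
apply: (@le_trans _ _ (`|c| * rnorm (subalg_val (f a)))).
  by apply: ler_wpM2r; [exact: rnorm_ge0 | exact: ler_norm].
by rewrite -mulrA; apply: ler_wpM2l.
Qed.
Definition cga_comp : cga_mor A D :=
  CGAMor (star_hom_comp (cga_fun_hom g) (cga_fun_hom f))
    cga_comp_equiv cga_comp_bounded.
End Comp.

Fact cga_idl A B (f : cga_mor A B) : cga_comp (cga_id B) f = f.
Proof. exact: cga_mor_ext. Qed.
Fact cga_idr A B (f : cga_mor A B) : cga_comp f (cga_id A) = f.
Proof. exact: cga_mor_ext. Qed.
Fact cga_compA A B D E (h : cga_mor D E) (g : cga_mor B D) (f : cga_mor A B) :
  cga_comp h (cga_comp g f) = cga_comp (cga_comp h g) f.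
Proof. exact: cga_mor_ext. Qed.

Definition CAG : category := Category cga_idl cga_idr cga_compA.

End CAG.

Record hilbert (R : realType) := Hilbert {
  hspace :> completeNormedModType R[i];
  ip : hspace -> hspace -> R[i];
  ip_linear : forall c x y z, ip (c *: x + y) z = c * ip x z + ip y z;
  ip_conj : forall x y, ip y x = (ip x y)^*;
  ip_norm : forall x, ip x x = `|x| ^+ 2
}.

Definition lin_indep (C : pzRingType) (V : lmodType C) n (v : 'I_n -> V) : Prop :=
  forall c : 'I_n -> C, \sum_(i < n) c i *: v i = 0 -> forall i, c i = 0.

Definition infinite_dim (C : pzRingType) (V : lmodType C) : Prop :=
  forall n, exists v : 'I_n -> V, lin_indep v.

Section Stability.
Variables (R : realType) (G : topGroupType).

Definition compact_op (H : hilbert R) (k : H -> H) : Prop :=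
  linear k /\ precompact [set k x | x in [set x : H | `|x| <= 1]].

Definition adjoint_op (H : hilbert R) (k l : H -> H) : Prop :=
  forall x y, ip (k x) y = ip x (l y).

(* [T], with elementary tensors [t a k], is a completion of the algebraic tensor
   product of [I] with the compact operators on [H] for a C*-norm; this norm is
   unique because the compact operators are nuclear. [ct_inj] says that the
   algebraic tensor product embeds in [T]: the sum of the [a i (x) k i] with
   linearly independent [k i] vanishes only if all the [a i] do. The values of
   [t a] at non-compact operators are irrelevant. *)
Record compact_tensor (I T : gcstar R G) (H : hilbert R)
    (t : I -> (H -> H) -> T) : Prop := CompactTensor {
  ct_linl : forall k, compact_op k -> linear (fun a => t a k);
  ct_linr : forall a (c : R[i]) k l, compact_op k -> compact_op l ->
    t a (c *: k + l) = c *: t a k + t a l;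
  ct_mul : forall a b k l, compact_op k -> compact_op l ->
    t a k ** t b l = t (a ** b) (k \o l);
  ct_adj : forall a k l, compact_op k -> compact_op l -> adjoint_op k l ->
    adj (t a k) = t (adj a) l;
  ct_act : forall g a k, compact_op k -> gact g (t a k) = t (gact g a) k;
  ct_inj : forall n (a : 'I_n -> I) (k : 'I_n -> H -> H),
    (forall i, compact_op (k i)) -> lin_indep k ->
    \sum_(i < n) t (a i) (k i) = 0 -> forall i, a i = 0;
  ct_dense : dense [set x : T | exists n (a : 'I_n -> I) (k : 'I_n -> H -> H),
    (forall i, compact_op (k i)) /\ x = \sum_(i < n) t (a i) (k i)]
}.

Definition gcstar_hom (A B : gcstar R G) (f : A -> B) : Prop :=
  [/\ star_hom f, forall g a, f (gact g a) = gact g (f a)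
    & exists c : R, forall a, rnorm (f a) <= c * rnorm a].

Definition gcstar_iso (A B : gcstar R G) : Prop :=
  exists (f : A -> B) (g : B -> A),
    [/\ gcstar_hom f, gcstar_hom g, cancel f g & cancel g f].

Definition stable (I : gcstar R G) : Prop :=
  exists (H : hilbert R) (T : gcstar R G) (t : I -> (H -> H) -> T),
    [/\ separable H, infinite_dim H, compact_tensor t & gcstar_iso T I].

End Stability.

Record csi (R : realType) (G : topGroupType) := CSI {
  csi_obj :> cga R G;
  csi_stable : stable csi_obj;
  csi_ideal : mult_ideal_of (cga_sub csi_obj)
}.

Section CSIG.
Variables (R : realType) (G : topGroupType).

(* A bounded equivariant star-homomorphism between the ideals need not extend
   to the multiplier algebras (the inclusion of C_0((0,1)) (x) K into
   C_0(R) (x) K does not), so a morphism comes with its extension. *)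
Record csi_mor (J J' : csi R G) := CSIMor {
  csi_fun :> cga_mor J J';
  csi_ext : mult J -> mult J';
  csi_ext_hom : star_hom csi_ext;
  csi_ext_equiv : forall g m, csi_ext (gmult g m) = gmult g (csi_ext m);
  csi_extE : forall j : carrier J,
    csi_ext (membed (subalg_val j)) = membed (subalg_val (csi_fun j))
}.

Lemma csi_mor_ext J J' (f g : csi_mor J J') :
  csi_fun f =1 csi_fun g -> csi_ext f =1 csi_ext g -> f = g.
Proof.
case: f g => [f e e1 e2 e3] [g d d1 d2 d3] /= /cga_mor_ext fg /funext ed.
by subst g d; congr CSIMor; exact: Prop_irrelevance.
Qed.

Definition csi_id (J : csi R G) : csi_mor J J :=
  @CSIMor J J (cga_id J) id (@star_hom_id _ _)
    (fun _ _ => erefl) (fun _ => erefl).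

Section Comp.
Variables (J J' J'' : csi R G) (g : csi_mor J' J'') (f : csi_mor J J').
Let e := csi_ext g \o csi_ext f.
Fact csi_comp_equiv h m : e (gmult h m) = gmult h (e m).
Proof. by rewrite /e /= !csi_ext_equiv. Qed.
Fact csi_compE (j : carrier J) :
  e (membed (subalg_val j)) = membed (subalg_val (cga_comp g f j)).
Proof. by rewrite /e /= !csi_extE. Qed.
Definition csi_comp : csi_mor J J'' :=
  CSIMor (star_hom_comp (csi_ext_hom g) (csi_ext_hom f))
    csi_comp_equiv csi_compE.
End Comp.

Fact csi_idl J J' (f : csi_mor J J') : csi_comp (csi_id J') f = f.
Proof. exact: csi_mor_ext. Qed.
Fact csi_idr J J' (f : csi_mor J J') : csi_comp f (csi_id J) = f.
Proof. exact: csi_mor_ext. Qed.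
Fact csi_compA J1 J2 J3 J4
  (h : csi_mor J3 J4) (g : csi_mor J2 J3) (f : csi_mor J1 J2) :
  csi_comp h (csi_comp g f) = csi_comp (csi_comp h g) f.
Proof. exact: csi_mor_ext. Qed.

Definition CSIG : category := Category csi_idl csi_idr csi_compA.

Section QuotientAlgebra.
Variable J : csi R G.

(* M(I)/J, where I is the C*-algebra of which J is a dense ideal *)
Definition calg : Type := quot (mideal (@csi_ideal _ _ J)).
HB.instance Definition _ := StarAlgebra.copy calg
  (quot (mideal (@csi_ideal _ _ J))).

Definition qJ : mult J -> calg := piq _.
Definition gcalgebra (g : G) : calg -> calg := qmap (gmult g).
Definition to_corona : calg -> corona J := qmap id.

End QuotientAlgebra.

Definition q_mor (J J' : csi R G) (psi : csi_mor J J') : calg J -> calg J' :=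
  qmap (csi_ext psi).

Section Busby.
Variables (A : cga R G) (J : csi R G).

Definition cstar_bounded (V : lmodType R[i]) (N : V -> \bar R)
    (f : carrier A -> V) : Prop :=
  exists T : A -> V,
    [/\ linear T,
        exists c : R, forall a, (N (T a) <= (c * rnorm a)%:E)%E
      & forall a, f a = T (subalg_val a)].

Definition is_busby (b : carrier A -> calg J) : Prop :=
  star_hom b /\ forall g a, b (gsub g a) = gcalgebra g (b a).

Definition bounded_busby (b : carrier A -> calg J) : Prop :=
  is_busby b /\ cstar_bounded (@corona_norm _ J) (@to_corona J \o b).

Definition trivial_busby (b : carrier A -> calg J) : Prop :=
  exists pi : carrier A -> mult J,
    [/\ star_hom pi, forall g a, pi (gsub g a) = gmult g (pi a),
        cstar_bounded (@mult_norm _ J) pi & forall a, b a = qJ (pi a)].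

Definition unitary (u : mult J) : Prop :=
  adj u ** u = mone J /\ u ** adj u = mone J.

Definition almost_inv_unitary (u : mult J) : Prop :=
  unitary u /\ forall g, gcalgebra g (qJ u) = qJ u.

Definition strongly_equiv (b b' : carrier A -> calg J) : Prop :=
  exists2 u, almost_inv_unitary u
    & forall a, b' a = qJ u ** b a ** adj (qJ u).

Record inv_isometries (V1 V2 : mult J) : Prop := InvIsometries {
  isom1 : adj V1 ** V1 = mone J;
  isom2 : adj V2 ** V2 = mone J;
  isom_inv1 : forall g, gmult g V1 = V1;
  isom_inv2 : forall g, gmult g V2 = V2;
  isom_sum : V1 ** adj V1 + V2 ** adj V2 = mone J
}.

(* The image of diag(b1, b2) under conjugation by V = (V1 V2) *)
Definition busby_sum (V1 V2 : mult J) (b1 b2 : carrier A -> calg J) :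
    carrier A -> calg J :=
  fun a => qJ V1 ** b1 a ** adj (qJ V1) + qJ V2 ** b2 a ** adj (qJ V2).

(* Equality, in the set of strong equivalence classes, after adding the classes
   of trivial mappings; the sum does not depend on the choice of isometries. *)
Definition stably_equiv (b b' : carrier A -> calg J) : Prop :=
  exists t t' V1 V2, [/\ trivial_busby t, trivial_busby t', inv_isometries V1 V2
    & strongly_equiv (busby_sum V1 V2 b t) (busby_sum V1 V2 b' t')].

Definition stable_class (b : carrier A -> calg J) : set (carrier A -> calg J) :=
  [set b' | bounded_busby b' /\ stably_equiv b b'].

Definition Ext : Type :=
  {X : set (carrier A -> calg J) | exists2 b, bounded_busby b & X = stable_class b}.

HB.instance Definition _ := gen_eqMixin Ext.
HB.instance Definition _ := gen_choiceMixin Ext.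

Definition ext_class (b : carrier A -> calg J) (hb : bounded_busby b) : Ext :=
  exist _ (stable_class b) (ex_intro2 _ _ b hb erefl).

Definition monoid_on_Ext : Type := GRing.isNmodule Ext.

Definition Ext_nmod (S : monoid_on_Ext) : nmodType :=
  HB.pack Ext (S : GRing.isNmodule Ext).

(* [S] is the structure on [Ext] induced by the sum of Busby mappings, for any
   choice of the isometries, and its zero is the class of all trivial ones. *)
Record Ext_monoid (S : monoid_on_Ext) : Prop := ExtMonoid {
  ext_classP : forall b b' (hb : bounded_busby b) (hb' : bounded_busby b'),
    ext_class hb = ext_class hb' <-> stably_equiv b b';
  ext_isometries : exists V1 V2, inv_isometries V1 V2;
  ext_add : forall V1 V2 b1 b2 (h1 : bounded_busby b1) (h2 : bounded_busby b2),
    inv_isometries V1 V2 ->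
    exists h : bounded_busby (busby_sum V1 V2 b1 b2),
      (ext_class h1 : Ext_nmod S) + ext_class h2 = ext_class h;
  ext_zero : forall t, trivial_busby t ->
    exists h : bounded_busby t, (0 : Ext_nmod S) = ext_class h
}.

End Busby.

End CSIG.

Definition Ext_obj (R : realType) (G : topGroupType)
    (S : forall (A : cga R G) (J : csi R G), monoid_on_Ext A J)
    (X : prod_cat (op_cat (CAG R G)) (CSIG R G)) : MoAb :=
  Ext_nmod (S X.1 X.2).

(* Main.v *)
Require Import Defs.
From HB Require Import structures.
From mathcomp Require Import all_boot all_order all_algebra complex.
From mathcomp Require Import all_classical all_reals all_analysis.
From mathcomp Require Import lra.

Set Implicit Arguments.
Unset Strict Implicit.
Unset Printing Implicit Defensive.

Import Order.TTheory GRing.Theory Num.Theory.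
Import numFieldNormedType.Exports.

(** Strong equivalence only sees conjugation by unitaries, so everything rests
    on producing unitaries. If [X i] and [Y i] are two finite families of
    isometries whose ranges sum to [1], then [sum_i Y i u i (X i)^*] is a unitary
    which carries the sum of the [b i] along [X] to the sum of the
    [u i b i (u i)^*] along [Y] ([fam_sum_equiv]). With families of two and of
    three isometries this shows at once that the sum of Busby mappings does not
    depend on the pair of isometries, respects strong equivalence, and is
    commutative and associative; stable equivalence is then a congruence
    and its classes form an abelian monoid.

    Pulling back along [phi] is harmless once [phi], which lives on a dense
    subalgebra, has been extended to the completion ([bounded_extension]).
    Pushing forward along [psi] is more delicate, because the extension [e] of
    [psi] to the multiplier algebras need not be unital: [e] maps the isometries
    [V1], [V2] and the unitaries of strong equivalence to partial isometries with
    initial projection [e 1]. Conjugation by a partial isometry nevertheless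
    preserves the stable class of a mapping supported on its initial projection
    ([partial_isometry_stably_equiv]): after adding a zero summand, the partial
    isometry becomes a unitary two by two matrix. This gives both the
    compatibility of [psi] with stable equivalence and its additivity.

    Two ingredients are analytic. First, [e] is bounded
    ([star_hom_mult_bnd]), so that [psi] preserves bounded and trivial mappings
    and induces a map of corona algebras ([csi_ext_full]). A self-adjoint [h] of
    small norm is the real part of the unitary [h + i sqrt (1 - h ^ 2)], and the
    image of a unitary is a partial isometry, hence a contraction; the square
    root comes from a fixed point iteration ([sqrt_one_sub_sq]).

    Second, invariant isometries [V1], [V2] exist ([inv_isometries_exist]). The
    Hilbert space [H] of the stabilisation has an orthonormal basis
    ([orthonormal_basis]), whose even and odd halves give isometries [v1], [v2]
    of [H] with complementary ranges ([cuntz_isometries]). They act on the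
    algebraic tensor product by [a (x) k |-> a (x) v k]; this action is
    adjointable for the inner product [adj x ** y], hence well defined and
    isometric, so that it extends to an invariant multiplier
    ([isometry_multiplier]). The argument uses that compact operators have
    compact adjoints ([compact_op_adjoint]). *)

Local Open Scope classical_set_scope.
Local Open Scope ring_scope.

Local Notation "r %:C" := (real_complex_def (Phant _) r) : ring_scope.

(** * Real-valued norms and sequential limits *)

Section LinearMaps.
Variables (K : pzRingType) (U V : lmodType K) (f : U -> V) (fl : linear f).

Lemma lin0 : f 0 = 0.
Proof. by have := fl (-1) 0 0; rewrite scaler0 addr0 scaleN1r addNr. Qed.

Lemma linZ c x : f (c *: x) = c *: f x.
Proof. by have := fl c x 0; rewrite lin0 !addr0. Qed.

Lemma linB : {morph f : x y / x - y}.
Proof. by move=> x y; rewrite -scaleN1r addrC fl addrC scaleN1r. Qed.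

End LinearMaps.

(** Norms over [R[i]] take values in the partially ordered field [R[i]];
    estimates are carried out on their real parts [rnorm] and [cabs]. *)
Definition cabs (R : realType) (c : R[i]) : R := complex.Re `|c|.

Section Scalars.
Variable R : realType.
Implicit Types (c d : R[i]) (r : R).

Lemma cabsE c : `|c| = (cabs c)%:C.
Proof. by rewrite /cabs normc_def. Qed.

Lemma cabs_ge0 c : 0 <= cabs c.
Proof. by rewrite -ler0c -cabsE. Qed.

Lemma cabsM c d : cabs (c * d) = cabs c * cabs d.
Proof. by apply: complexI; rewrite rmorphM /= -!cabsE normrM. Qed.

Lemma cabs_real r : cabs r%:C = `|r|.
Proof.
apply: complexI; rewrite -cabsE normc_def /= expr0n /= addr0 sqrtr_sqr //.
Qed.

Lemma cabs0 : cabs (0 : R[i]) = 0.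
Proof. by apply: complexI; rewrite -cabsE normr0. Qed.

Lemma cabsD c d : cabs (c + d) <= cabs c + cabs d.
Proof. by rewrite -lecR rmorphD /= -!cabsE ler_normD. Qed.

Lemma le_of_sq_le (a b : R) : 0 <= a -> 0 <= b -> a ^+ 2 <= b * a -> a <= b.
Proof.
move=> a0 b0; have [->|an0] := eqVneq a 0; first by [].
by rewrite expr2 ler_pM2r// lt_def an0.
Qed.

End Scalars.

Section RNorm.
Variables (R : realType) (V : normedModType R[i]).
Implicit Types (x y z : V) (c : R[i]).

Lemma rnormE x : `|x| = (rnorm x)%:C.
Proof.
have := normr_ge0 x; rewrite /rnorm lecE => /andP[/eqP/= h _].
by case: `|x| h => a b /= ->.
Qed.

Lemma rnorm0 : rnorm (0 : V) = 0.
Proof. by rewrite /rnorm normr0. Qed.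

Lemma rnorm_eq0 x : rnorm x = 0 -> x = 0.
Proof. by move=> x0; apply/eqP; rewrite -normr_eq0 rnormE x0. Qed.

Lemma rnorm_gt0 x : x != 0 -> 0 < rnorm x.
Proof.
by move=> x0; rewrite lt_def rnorm_ge0 andbT; apply: contra_neq x0 => /rnorm_eq0.
Qed.

Lemma rnormN x : rnorm (- x) = rnorm x.
Proof. by rewrite /rnorm normrN. Qed.

Lemma rnormB x y : rnorm (x - y) = rnorm (y - x).
Proof. by rewrite -rnormN opprB. Qed.

Lemma rnormD x y : rnorm (x + y) <= rnorm x + rnorm y.
Proof. by rewrite -lecR rmorphD /= -!rnormE ler_normD. Qed.

Lemma rnorm_dist x y z : rnorm (x - z) <= rnorm (x - y) + rnorm (y - z).
Proof. by apply: le_trans (rnormD _ _); rewrite addrA subrK. Qed.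

Lemma rnormZ c x : rnorm (c *: x) = cabs c * rnorm x.
Proof. by apply: complexI; rewrite rmorphM /= -!rnormE -cabsE normrZ. Qed.

Lemma rnormZR (r : R) x : rnorm (r%:C *: x) = `|r| * rnorm x.
Proof. by rewrite rnormZ cabs_real. Qed.

Lemma rnorm_small x : (forall e : R, 0 < e -> rnorm x <= e) -> x = 0.
Proof.
move=> h; apply: rnorm_eq0; apply/eqP; rewrite eq_le rnorm_ge0 andbT.
apply/ler_addgt0Pl => e e0; rewrite addr0; exact: h.
Qed.

Definition rcvg (u : nat -> V) (l : V) : Prop :=
  forall e : R, 0 < e ->
    exists N, forall n, (N <= n)%N -> rnorm (u n - l) <= e.

Definition rcauchy (u : nat -> V) : Prop :=
  forall e : R, 0 < e ->
    exists N, forall n, (N <= n)%N -> rnorm (u n - u N) <= e.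

Lemma rcvg_cst x : rcvg (fun=> x) x.
Proof. by move=> e e0; exists 0%N => n _; rewrite subrr rnorm0 ltW. Qed.

Lemma rcvg_near u v l : rcvg (fun n => u n - v n) 0 -> rcvg v l -> rcvg u l.
Proof.
move=> uv vl e e0; have e20 : 0 < e / 2 by rewrite divr_gt0.
have [N hN] := uv _ e20; have [M hM] := vl _ e20.
exists (maxn N M) => n; rewrite geq_max => /andP[Nn Mn].
apply: le_trans (rnorm_dist _ (v n) _) _.
by have := lerD (hN _ Nn) (hM _ Mn); rewrite subr0 -splitr.
Qed.

Lemma rcvg_unique u l l' : rcvg u l -> rcvg u l' -> l = l'.
Proof.
move=> ul ul'; apply/eqP; rewrite -subr_eq0; apply/eqP/rnorm_small => e e0.
have e20 : 0 < e / 2 by rewrite divr_gt0.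
have [N hN] := ul _ e20; have [M hM] := ul' _ e20.
apply: le_trans (rnorm_dist _ (u (maxn N M)) _) _; rewrite (splitr e).
by apply: lerD; [rewrite rnormB; apply: hN|apply: hM];
  rewrite ?leq_maxl ?leq_maxr.
Qed.

Lemma rcvg_bounded u l (k : R) :
  rcvg u l -> (forall n, rnorm (u n) <= k) -> rnorm l <= k.
Proof.
move=> ul uk; apply/ler_addgt0Pl => e e0; have [N hN] := ul _ e0.
rewrite -[l](subrK (u N)); apply: le_trans (rnormD _ _) _.
by rewrite rnormB lerD// hN.
Qed.

Lemma rcvg_subseq u l (f : nat -> nat) :
  (forall n, (n <= f n)%N) -> rcvg u l -> rcvg (u \o f) l.
Proof.
move=> nf ul e /ul [N hN]; exists N => n Nn; apply: hN.
exact: leq_trans Nn (nf n).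
Qed.

Lemma rcvg_rcauchy u l : rcvg u l -> rcauchy u.
Proof.
move=> ul e e0; have [N hN] := ul (e / 2) (divr_gt0 e0 (ltr0Sn R 1)).
exists N => n Nn; apply: le_trans (rnorm_dist _ l _) _.
by rewrite (splitr e) lerD ?hN// rnormB hN.
Qed.

Definition rdense (D : V -> Prop) : Prop :=
  forall x (e : R), 0 < e -> exists2 y, D y & rnorm (x - y) <= e.

Lemma dense_rdense (D : V -> Prop) : dense [set x | D x] -> rdense D.
Proof.
move=> dD x e e0.
have [] := dD [set y | `|x - y| < e%:C].
- by exists x; rewrite /= subrr normr0 ltcR.
- rewrite openE => y /= xy; apply/nbhs_normP.
  exists (e%:C - `|x - y|) => /=; first by rewrite subr_gt0.
  move=> z /=; rewrite ltrBrDl => yz.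
  apply: le_lt_trans yz; rewrite -[x - z](subrKA y) subrKA.
  by apply: ler_distD.
move=> y [/= xy Dy]; exists y => //; move: xy.
by rewrite rnormE ltcR => /ltW.
Qed.

Lemma rdense_seq (D : V -> Prop) x : rdense D ->
  exists2 u : nat -> V, forall n, D (u n) & rcvg u x.
Proof.
move=> dD.
have /choice[u hu] : forall n : nat, exists y, D y /\ rnorm (x - y) <= n.+1%:R^-1.
  by move=> n; have [//|y] := dD x n.+1%:R^-1; exists y.
exists u => [n|e e0]; first by have [] := hu n.
have [N Ne] := ltr_add_invr e0; rewrite add0r in Ne.
exists N => n Nn; rewrite rnormB; have [_ /le_trans] := hu n; apply.
by apply: le_trans (ltW Ne); rewrite lef_pV2 ?posrE ?ltr0Sn// ler_nat ltnS.
Qed.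

End RNorm.

Section Lipschitz.
Variables (R : realType) (V W : normedModType R[i]).

Lemma rcvg_dominated (u : nat -> V) l (v : nat -> W) m (k : R) :
  (forall n, rnorm (v n - m) <= k * rnorm (u n - l)) -> rcvg u l -> rcvg v m.
Proof.
move=> vu ul e e0; have k0 : 0 < `|k| + 1 by rewrite ltr_wpDl.
have [N hN] := ul (e / (`|k| + 1)) (divr_gt0 e0 k0).
exists N => n Nn /=; apply: le_trans (vu _) _.
apply: (@le_trans _ _ ((`|k| + 1) * rnorm (u n - l))).
  by rewrite ler_wpM2r ?rnorm_ge0// (le_trans (ler_norm k))// lerDl.
by rewrite -ler_pdivlMl// mulrC hN.
Qed.

Lemma rcauchy_dominated (u : nat -> V) (v : nat -> W) (k : R) :
  (forall m n, rnorm (v n - v m) <= k * rnorm (u n - u m)) ->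
  rcauchy u -> rcauchy v.
Proof.
move=> vu uc e e0; have k0 : 0 < `|k| + 1 by rewrite ltr_wpDl.
have [N hN] := uc (e / (`|k| + 1)) (divr_gt0 e0 k0).
exists N => n Nn /=; apply: le_trans (vu _ _) _.
apply: (@le_trans _ _ ((`|k| + 1) * rnorm (u n - u N))).
  by rewrite ler_wpM2r ?rnorm_ge0// (le_trans (ler_norm k))// lerDl.
by rewrite -ler_pdivlMl// mulrC hN.
Qed.

Lemma rcvg_lip (f : V -> W) (k : R) u l :
  (forall x y, rnorm (f x - f y) <= k * rnorm (x - y)) ->
  rcvg u l -> rcvg (f \o u) (f l).
Proof. by move=> hf; apply: (@rcvg_dominated _ _ _ _ k) => n; exact: hf. Qed.

Lemma linear_lip (f : V -> W) (k : R) : linear f ->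
  (forall x, rnorm (f x) <= k * rnorm x) ->
  forall x y, rnorm (f x - f y) <= k * rnorm (x - y).
Proof. by move=> lf fk x y; rewrite -(linB lf). Qed.

End Lipschitz.

Section LimitOperations.
Variables (R : realType) (V : normedModType R[i]).
Implicit Types u v : nat -> V.

Lemma rcvgD u v l m :
  rcvg u l -> rcvg v m -> rcvg (fun n => u n + v n) (l + m).
Proof.
move=> ul vm e e0; have e20 : 0 < e / 2 by rewrite divr_gt0.
have [N hN] := ul _ e20; have [M hM] := vm _ e20.
exists (maxn N M) => n; rewrite geq_max => /andP[Nn Mn].
rewrite opprD addrACA; apply: le_trans (rnormD _ _) _.
by rewrite (splitr e) lerD ?hN ?hM.
Qed.

Lemma rcvgZ (c : R[i]) u l : rcvg u l -> rcvg (fun n => c *: u n) (c *: l).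
Proof.
apply: (@rcvg_dominated _ _ _ _ _ _ _ (cabs c)) => n.
by rewrite -scalerBr rnormZ.
Qed.

Lemma rcvgB u v l m :
  rcvg u l -> rcvg v m -> rcvg (fun n => u n - v n) (l - m).
Proof.
move=> ul /(rcvgZ (-1)) vm; rewrite -[X in _ - X]scale1r -scaleNr.
by under eq_fun do rewrite -scaleN1r; exact: rcvgD.
Qed.

End LimitOperations.

Section Complete.
Variables (R : realType) (V : completeNormedModType R[i]).

Lemma rcauchy_cvg (u : nat -> V) : rcauchy u -> exists l, rcvg u l.
Proof.
move=> uc; have : cvg (u @ \oo).
  apply/cauchy_cvgP/cauchy_exP => e e0.
  have [e' e'0 e'E] : exists2 e' : R, 0 < e' & e'%:C = e.
    move: e0; rewrite ltcE /= => /andP[/eqP e0 er]; exists (complex.Re e) => //.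
    by case: e e0 {er} => a b /= ->.
  have [N hN] := uc _ (divr_gt0 e'0 (ltr0Sn R 1)).
  exists (u N); exists N => // n /= Nn; rewrite -ball_normE /=.
  rewrite -e'E rnormE ltcR rnormB; apply: le_lt_trans (hN _ Nn) _.
  by rewrite ltr_pdivrMr// ltr_pMr// ltr1n.
move=> /cvg_ex[l ul]; exists l => e e0.
have e0' : 0 < e%:C :> R[i] by rewrite ltcR.
move/cvgrPdist_le : ul => /(_ _ e0')[N _ hN]; exists N => n Nn.
by have := hN n Nn; rewrite rnormE lecR rnormB.
Qed.

End Complete.

Section BoundedExtension.
Variables (R : realType) (V : normedModType R[i]) (W : completeNormedModType R[i]).
Variables (D : V -> Prop) (f : V -> W) (k : R).
Hypotheses (D_lin : forall c x y, D x -> D y -> D (c *: x + y)) (dD : rdense D).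
Hypothesis f_lin : forall c x y, D x -> D y -> f (c *: x + y) = c *: f x + f y.
Hypothesis f_bnd : forall x, D x -> rnorm (f x) <= k * rnorm x.

(** The extension is defined through its values along all approximating
    sequences at once, so that no choice of sequences enters its linearity. *)
Lemma bounded_extension : 0 <= k -> exists T : V -> W,
  [/\ linear T, forall x, rnorm (T x) <= k * rnorm x & forall x, D x -> T x = f x].
Proof.
move=> k0.
have f_dist x y : D x -> D y -> rnorm (f x - f y) <= k * rnorm (x - y).
  move=> Dx Dy; rewrite (_ : f x - f y = f (x - y)) ?f_bnd//.
    by rewrite -scaleN1r addrC; exact: D_lin.
  by rewrite addrC -scaleN1r -f_lin// addrC scaleN1r.
have /choice[T hT] : forall x, exists w, forall u, (forall n, D (u n)) ->
    rcvg u x -> rcvg (f \o u) w.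
  move=> x; have [u Du ux] := rdense_seq x dD.
  have [w uw] : exists w, rcvg (f \o u) w.
    apply/rcauchy_cvg/(rcauchy_dominated _ (rcvg_rcauchy ux)) => m n.
    exact: f_dist.
  exists w => v Dv vx; apply: rcvg_near uw.
  apply: (@rcvg_dominated _ _ _ (fun n => v n - u n) 0 _ _ k).
    by move=> n; rewrite !subr0; exact: f_dist.
  by rewrite -(subrr x); exact: rcvgB.
exists T; split=> [c x y|x|x Dx].
- have [u Du ux] := rdense_seq x dD; have [v Dv vy] := rdense_seq y dD.
  have cuv : rcvg (fun n => c *: u n + v n) (c *: x + y).
    by apply: rcvgD => //; exact: rcvgZ.
  apply: rcvg_unique (hT _ _ (fun n => D_lin c (Du n) (Dv n)) cuv) _.
  rewrite (_ : _ \o _ = fun n => c *: f (u n) + f (v n)); last first.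
    by apply/funext => n /=; exact: f_lin.
  by apply: rcvgD; [apply: rcvgZ|]; exact: hT.
- have [u Du ux] := rdense_seq x dD; have Tu := hT _ _ Du ux.
  apply/ler_addgt0Pl => e e0.
  have k1 : 0 < k + 1 by rewrite ltr_wpDl.
  have d0 : 0 < e / (k + 1) by rewrite divr_gt0.
  have [N hN] := Tu _ d0; have [M hM] := ux _ d0.
  set n := maxn N M; have {}hN := hN n (leq_maxl N M).
  have {}hM := hM n (leq_maxr N M).
  rewrite -[T x](subrK (f (u n))); apply: le_trans (rnormD _ _) _.
  rewrite rnormB; apply: le_trans (lerD hN (f_bnd (Du n))) _.
  have : rnorm (u n) <= rnorm x + e / (k + 1).
    by rewrite -[u n](subrK x) addrC; apply: le_trans (rnormD _ _) _; rewrite lerD2l.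
  move=> /(ler_wpM2l k0); rewrite mulrDr => h.
  apply: le_trans (lerD (lexx _) h) _.
  rewrite addrCA addrC lerD2r -[X in X + _]mul1r -mulrDl addrC mulrC.
  by rewrite divfK// gt_eqF.
- by have := hT _ (fun=> x) (fun=> Dx) (rcvg_cst x); move/rcvg_unique; apply;
    exact: rcvg_cst.
Qed.
End BoundedExtension.

(** * Bounded multipliers *)

Section StarHomTheory.
Variables (C : numClosedFieldType) (B D : starAlgType C) (f : B -> D).
Hypothesis fh : star_hom f.

Lemma star_homZ c x : f (c *: x) = c *: f x.
Proof.
by have [fl _ _] := fh; exact: (linZ fl).
Qed.

Lemma star_homD : {morph f : x y / x + y}.
Proof. by have [fl _ _] := fh => x y; have := fl 1 x y; rewrite !scale1r. Qed.

Lemma star_hom0 : f 0 = 0.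
Proof. by rewrite -(scale0r (0 : B)) star_homZ scale0r. Qed.

Lemma star_homN x : f (- x) = - f x.
Proof. by rewrite -scaleN1r star_homZ scaleN1r. Qed.

Lemma star_homB : {morph f : x y / x - y}.
Proof. by move=> x y; rewrite star_homD star_homN. Qed.

Lemma star_homM : {morph f : x y / x ** y}.
Proof. by case: fh. Qed.

Lemma star_hom_adj : {morph f : x / adj x}.
Proof. by case: fh. Qed.

End StarHomTheory.

Section CStarNorm.
Variables (R : realType) (I : cstarAlgType R[i]).
Implicit Types x y z : I.

Lemma rnorm_smul x y : rnorm (x ** y) <= rnorm x * rnorm y.
Proof. by rewrite -lecR rmorphM /= -!rnormE norm_smul. Qed.

Lemma rnorm_adjM x : rnorm (adj x ** x) = rnorm x ^+ 2.
Proof. by apply: complexI; rewrite rmorphXn /= -!rnormE norm_adjM. Qed.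

Lemma rnorm_adj x : rnorm (adj x) = rnorm x.
Proof.
suff h y : rnorm y <= rnorm (adj y).
  by apply/eqP; rewrite eq_le h -{2}(adjK x) h.
by apply: le_of_sq_le; rewrite ?rnorm_ge0// -rnorm_adjM rnorm_smul.
Qed.

Lemma rcvg_smulr a (u : nat -> I) l : rcvg u l -> rcvg (fun n => a ** u n) (a ** l).
Proof.
by apply: (@rcvg_dominated _ _ _ _ _ _ _ (rnorm a)) => n;
  rewrite -smulBr rnorm_smul.
Qed.

Lemma rcvg_smull a (u : nat -> I) l : rcvg u l -> rcvg (fun n => u n ** a) (l ** a).
Proof.
by apply: (@rcvg_dominated _ _ _ _ _ _ _ (rnorm a)) => n;
  rewrite -smulBl mulrC rnorm_smul.
Qed.

Lemma rcvg_adj (u : nat -> I) l : rcvg u l -> rcvg (fun n => adj (u n)) (adj l).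
Proof.
by apply: (@rcvg_dominated _ _ _ _ _ _ _ 1) => n; rewrite -adjB rnorm_adj mul1r.
Qed.

End CStarNorm.

Section MultiplierBasics.
Variables (C : numClosedFieldType) (I : cstarAlgType C).
Implicit Types (m n : mult I) (x y : I).

Lemma lmultDE m n x : lmult (m + n) x = lmult m x + lmult n x. Proof. by []. Qed.
Lemma lmultNE m x : lmult (- m) x = - lmult m x. Proof. by []. Qed.
Lemma lmultZE (c : C) m x : lmult (c *: m) x = c *: lmult m x. Proof. by []. Qed.
Lemma lmultME m n x : lmult (m ** n) x = lmult m (lmult n x). Proof. by []. Qed.
Lemma lmult0E x : lmult (0 : mult I) x = 0. Proof. by []. Qed.
Lemma lmult1E x : lmult (mone I) x = x. Proof. by []. Qed.

Definition lmultE := (lmultDE, lmultNE, lmultZE, lmultME, lmult0E, lmult1E).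

Lemma mult_lext m n : lmult m =1 lmult n -> m = n.
Proof.
by move=> mn; apply: mult_ext => // x; apply: nondeg_r => a; rewrite -!multP mn.
Qed.

Lemma mult_rext m n : rmult m =1 rmult n -> m = n.
Proof.
by move=> mn; apply: mult_ext => // x; apply: nondeg_l => a; rewrite !multP mn.
Qed.

Lemma lmult0 m : lmult m 0 = 0.
Proof. by have := lmultZ m 0 0; rewrite !scale0r. Qed.
Lemma lmultN m x : lmult m (- x) = - lmult m x.
Proof. by rewrite -scaleN1r lmultZ scaleN1r. Qed.
Lemma lmultB m x y : lmult m (x - y) = lmult m x - lmult m y.
Proof. by rewrite lmultD lmultN. Qed.

Lemma smone m : m ** mone I = m. Proof. exact: mult_lext. Qed.
Lemma smul1 m : mone I ** m = m. Proof. exact: mult_lext. Qed.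
Lemma adj_mone : adj (mone I) = mone I.
Proof. by apply: mult_lext => x /=; rewrite adjK. Qed.

(** A multiplier and its adjoint act as formal adjoints of each other for the
    [I]-valued inner product [adj x ** y]. *)
Lemma adj_lmult m x y : adj (lmult m x) ** y = adj x ** lmult (adj m) y.
Proof. by apply: (can_inj (@adjK _ I)); rewrite !adjM !adjK multP. Qed.

(** Conversely, a formally adjointable map is a left multiplication, and its
    adjoint provides the right one. *)
Lemma adjointable_mult (f f' : I -> I) :
  (forall x y, adj (f x) ** y = adj x ** f' y) ->
  exists m : mult I, lmult m =1 f /\ lmult (adj m) =1 f'.
Proof.
move=> ff'.
have ax a b : a ** f b = adj (f' (adj a)) ** b.
  by apply: (can_inj (@adjK _ I)); rewrite !adjM adjK ff'.
by exists (Mult ax); split=> x //=; rewrite !adjK.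
Qed.

End MultiplierBasics.

Section BoundedMultipliers.
Variables (R : realType) (I : cstarAlgType R[i]).
Implicit Types (m n u : mult I) (x y : I) (c d : R).

Definition mult_bnd m c : Prop := forall x, rnorm (lmult m x) <= c * rnorm x.

Lemma mult_normP m c : 0 <= c -> (mult_norm m <= c%:E)%E <-> mult_bnd m c.
Proof.
move=> c0; split=> [mc x|mc].
  have [->|x0] := eqVneq x 0; first by rewrite lmult0 rnorm0 mulr0.
  have rx := rnorm_gt0 x0.
  have : ((rnorm (lmult m ((rnorm x)^-1%:C *: x)))%:E <= c%:E)%E.
    apply: le_trans mc; apply: ereal_sup_ubound.
    exists ((rnorm x)^-1%:C *: x) => //=.
    by rewrite rnormZR ger0_norm ?invr_ge0 ?rnorm_ge0// mulVf ?gt_eqF.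
  rewrite lee_fin lmultZ rnormZR ger0_norm ?invr_ge0 ?rnorm_ge0//.
  by rewrite ler_pdivrMl// mulrC.
apply: ge_ereal_sup => _ [x /= x1 <-]; rewrite lee_fin.
by apply: le_trans (mc x) _; rewrite -[leRHS]mulr1 ler_wpM2l.
Qed.

Lemma mult_bndW m c d : c <= d -> mult_bnd m c -> mult_bnd m d.
Proof. by move=> cd mc x; apply: le_trans (mc x) _; rewrite ler_wpM2r ?rnorm_ge0. Qed.

Lemma mult_bnd0 c : 0 <= c -> mult_bnd 0 c.
Proof. by move=> c0 x; rewrite lmultE rnorm0 mulr_ge0 ?rnorm_ge0. Qed.

Lemma mult_bndD m n c d : mult_bnd m c -> mult_bnd n d -> mult_bnd (m + n) (c + d).
Proof.
move=> mc nd x; rewrite lmultE mulrDl; apply: le_trans (rnormD _ _) _.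
exact: lerD.
Qed.

Lemma mult_bndM m n c d :
  0 <= c -> mult_bnd m c -> mult_bnd n d -> mult_bnd (m ** n) (c * d).
Proof.
move=> c0 mc nd x; rewrite lmultE; apply: le_trans (mc _) _.
by rewrite -mulrA ler_wpM2l.
Qed.

Lemma mult_bndZ (a : R[i]) m c : mult_bnd m c -> mult_bnd (a *: m) (cabs a * c).
Proof. by move=> mc x; rewrite lmultE rnormZ -mulrA ler_wpM2l ?cabs_ge0. Qed.

Lemma mult_bndN m c : mult_bnd m c -> mult_bnd (- m) c.
Proof. by move=> mc x; rewrite lmultE rnormN. Qed.

Lemma rnorm_lmult_sq m x :
  rnorm (lmult m x) ^+ 2 = rnorm (adj x ** lmult (adj m ** m) x).
Proof. by rewrite -rnorm_adjM adj_lmult. Qed.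

Lemma mult_bnd_sq m c d : 0 <= d -> c <= d ^+ 2 ->
  mult_bnd (adj m ** m) c -> mult_bnd m d.
Proof.
move=> d0 cd mc x; rewrite -ler_sqr ?nnegrE ?mulr_ge0 ?rnorm_ge0//.
rewrite rnorm_lmult_sq exprMn; apply: le_trans (rnorm_smul _ _) _.
rewrite rnorm_adj; apply: le_trans (ler_wpM2l (rnorm_ge0 _) (mc x)) _.
by rewrite mulrCA -expr2 ler_wpM2r// sqr_ge0.
Qed.

Lemma mult_bnd_adj m c : 0 <= c -> mult_bnd m c -> mult_bnd (adj m) c.
Proof.
move=> c0 mc x; apply: le_of_sq_le; rewrite ?mulr_ge0 ?rnorm_ge0//.
rewrite rnorm_lmult_sq adjK lmultE; apply: le_trans (rnorm_smul _ _) _.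
rewrite rnorm_adj mulrAC mulrC; apply: ler_wpM2r; first exact: rnorm_ge0.
exact: mc.
Qed.

Lemma mult_bnd_proj p : adj p ** p = p -> mult_bnd p 1.
Proof.
move=> pp x; rewrite mul1r; apply: le_of_sq_le; rewrite ?rnorm_ge0//.
by rewrite rnorm_lmult_sq pp; apply: le_trans (rnorm_smul _ _) _; rewrite rnorm_adj.
Qed.

Lemma mult_bnd_pisom u p : adj p ** p = p -> adj u ** u = p -> mult_bnd u 1.
Proof.
move=> pp up; apply: (@mult_bnd_sq _ 1) => //; first by rewrite expr1n.
by rewrite up; exact: mult_bnd_proj.
Qed.

Lemma rcvg_lmult m c (u : nat -> I) l : mult_bnd m c ->
  rcvg u l -> rcvg (fun k => lmult m (u k)) (lmult m l).
Proof.
by move=> mc; apply: (@rcvg_dominated _ _ _ _ _ _ _ c) => k; rewrite -lmultB.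
Qed.

End BoundedMultipliers.

(** * Square roots and the automatic continuity of star-homomorphisms *)

Section SquareRoot.
Variables (R : realType) (I : cstarAlgType R[i]).
Implicit Types (m : mult I) (x y : I) (c d : R) (n k : nat).

(** Self-adjointness of the [w k] turns the pointwise limit into an adjointable
    map, so that its right multiplication comes for free. *)
Lemma mult_limit (w : nat -> mult I) : (forall k, adj (w k) = w k) ->
  (forall x, rcauchy (fun k => lmult (w k) x)) ->
  exists2 m, adj m = m & forall x, rcvg (fun k => lmult (w k) x) (lmult m x).
Proof.
move=> wa wc; have /choice[f fE] x := rcauchy_cvg (wc x).
have [x y|m [mf maf]] := @adjointable_mult _ I f f.
  apply: rcvg_unique (rcvg_smull y (rcvg_adj (fE x))) _.
  by under eq_fun do rewrite adj_lmult wa; exact: rcvg_smulr.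
exists m => [|x]; first by apply: mult_lext => x; rewrite mf maf.
by rewrite mf.
Qed.

Lemma geometric_rcauchy (V : normedModType R[i]) (u : nat -> V) c :
  (forall n, rnorm (u n.+1 - u n) <= c * 2^-1 ^+ n) -> rcauchy u.
Proof.
move=> uc.
have c0 : 0 <= c.
  by have := le_trans (rnorm_ge0 _) (uc 0%N); rewrite expr0 mulr1.
have tail n k : rnorm (u (n + k)%N - u n) <= 2 * c * 2^-1 ^+ n * (1 - 2^-1 ^+ k).
  elim: k => [|k IH]; first by rewrite addn0 subrr rnorm0 expr0 subrr mulr0.
  rewrite addnS; apply: le_trans (rnorm_dist _ (u (n + k)%N) _) _.
  apply: le_trans (lerD (uc _) IH) _.
  by rewrite exprD exprS; lra.
move=> e e0.
have [N hN] : exists N, 2 * c * 2^-1 ^+ N <= e.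
  have : (fun n => 2 * c * 2^-1 ^+ n) @ \oo --> (2 * c * 0 : R).
    apply: cvgMr; apply: cvg_expr.
    by rewrite ger0_norm ?invr_ge0// invf_lt1// ltr1n.
  rewrite mulr0 => /cvgrPdist_le /(_ e e0)[N _ hN]; exists N.
  by have := hN N (leqnn N); rewrite sub0r normrN; apply: le_trans; exact: ler_norm.
exists N => n Nn; rewrite -(subnKC Nn); apply: le_trans (tail _ _) _.
apply: le_trans hN; rewrite -[leRHS]mulr1; apply: ler_wpM2l.
  by rewrite !mulr_ge0// exprn_ge0// invr_ge0.
by rewrite lerBlDr lerDl exprn_ge0// invr_ge0.
Qed.

Variable h : mult I.
Hypotheses (ha : adj h = h) (hb : mult_bnd h 2^-1).

(** Iterates of [w |-> (h ^ 2 + w ^ 2) / 2], whose fixed point is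
    [1 - sqrt (1 - h ^ 2)]. *)
Fixpoint sqrt_iter n : mult I :=
  if n is k.+1 then 2^-1 *: (h ** h + sqrt_iter k ** sqrt_iter k) else 0.
Local Notation w := sqrt_iter.

Lemma sqrt_iterS n : w n.+1 = 2^-1 *: (h ** h + w n ** w n). Proof. by []. Qed.

Lemma sqrt_iter_adj n : adj (w n) = w n.
Proof.
elim: n => [|n IH]; first by rewrite /= adj0.
by rewrite sqrt_iterS Defs.adjZ adjD !adjM IH ha fmorphV /= conjC_nat.
Qed.

Lemma cabsV2 : cabs (2^-1 : R[i]) = 2^-1.
Proof.
by have := @cabs_real R 2^-1; rewrite fmorphV /= rmorph_nat ger0_norm// invr_ge0.
Qed.

(** The ball of radius [1/4] is stable because [(1/4 + 1/16) / 2 <= 1/4]. *)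
Lemma sqrt_iter_bnd n : mult_bnd (w n) 4^-1.
Proof.
elim: n => [|n IH]; first by apply: mult_bnd0; rewrite invr_ge0.
have h2 : mult_bnd (h ** h) (2^-1 * 2^-1) by apply: mult_bndM; rewrite ?invr_ge0.
have w2 : mult_bnd (w n ** w n) (4^-1 * 4^-1) by apply: mult_bndM; rewrite ?invr_ge0.
apply: mult_bndW (mult_bndZ _ (mult_bndD h2 w2)); rewrite cabsV2; lra.
Qed.

(** On the ball of radius [1/4] one step contracts distances, by the factor
    [(1/4 + 1/4) / 2 <= 1/2]. *)
Lemma sqrt_iter_step n : mult_bnd (w n.+1 - w n) (2^-1 ^+ n).
Proof.
elim: n => [|n IH].
  rewrite expr0.
  apply: mult_bndW (mult_bndD (sqrt_iter_bnd 1) (mult_bndN (sqrt_iter_bnd 0))); lra.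
have -> : w n.+2 - w n.+1 =
    2^-1 *: (w n.+1 ** (w n.+1 - w n) + (w n.+1 - w n) ** w n).
  rewrite [w n.+2]sqrt_iterS {2}[w n.+1]sqrt_iterS -scalerBr smulBr smulBl.
  by congr (_ *: _); rewrite addrA subrK opprD addrACA subrr add0r.
have e0 : 0 <= 2^-1 ^+ n :> R by rewrite exprn_ge0// invr_ge0.
have q0 : 0 <= 4^-1 :> R by rewrite invr_ge0.
have b := mult_bndZ 2^-1 (mult_bndD (mult_bndM q0 (sqrt_iter_bnd n.+1) IH)
   (mult_bndM e0 IH (sqrt_iter_bnd n))).
apply: mult_bndW b; rewrite cabsV2 exprS; lra.
Qed.

Lemma sqrt_iter_comm n x : lmult h (lmult (w n) x) = lmult (w n) (lmult h x).
Proof.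
elim: n x => [|n IH] x; first by rewrite /= lmult0.
by rewrite sqrt_iterS !lmultE lmultZ lmultD !IH.
Qed.

(** The fixed point [W] is a pointwise limit of multipliers, which is where
    completeness of the algebra enters, and [1 - W] is the square root. *)
Lemma sqrt_one_sub_sq : exists y : mult I,
  [/\ adj y = y, y ** y = mone I - h ** h & h ** y = y ** h].
Proof.
have [x|W Wa WE] := mult_limit sqrt_iter_adj.
  apply: (@geometric_rcauchy _ _ (rnorm x)) => n.
  by have := sqrt_iter_step n x; rewrite !lmultE mulrC.
have Wh : h ** W = W ** h.
  apply: mult_lext => x; rewrite !lmultE.
  apply: rcvg_unique (rcvg_lmult hb (WE x)) _.
  by under eq_fun do rewrite sqrt_iter_comm; exact: WE.
have W2 : 2 *: W = h ** h + W ** W.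
  apply: mult_lext => x; rewrite !lmultE.
  have WS : rcvg (fun n => lmult (w n.+1) x) (lmult W x).
    by apply: (rcvg_subseq (f := S)) (WE x) => n; exact: leqnSn.
  apply: rcvg_unique (rcvgZ 2 WS) _.
  under eq_fun do rewrite sqrt_iterS !lmultE scalerA divff ?pnatr_eq0// scale1r.
  apply: rcvgD; first exact: rcvg_cst.
  apply: rcvg_near (WE (lmult W x)).
  apply: (@rcvg_dominated _ _ _ (fun n => lmult (w n) x) (lmult W x) _ _ 4^-1) (WE x).
  by move=> n; rewrite subr0 -lmultB; exact: sqrt_iter_bnd.
exists (mone I - W); split.
- by rewrite adjB adj_mone Wa.
- rewrite smulBl !smulBr !smul1 smone.
  rewrite opprB addrA -[W ** W](addKr (h ** h)) -W2 scaler_nat mulr2n.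
  by rewrite -!addrA; congr (_ + _); rewrite !addrA addrAC subrK addrAC addNr add0r.
- by rewrite smulBl smulBr smul1 smone Wh.
Qed.

End SquareRoot.

Section AutomaticContinuity.
Variables (R : realType) (I I' : cstarAlgType R[i]).
Variables (e : mult I -> mult I') (eh : star_hom e).

(** A self-adjoint [h] of norm at most [1/2] is the real part of the unitary
    [u = h + i sqrt (1 - h ^ 2)]. The image of [u] is a partial isometry for
    purely algebraic reasons, hence a contraction. *)
Lemma star_hom_selfadjoint_bnd h :
  adj h = h -> mult_bnd h 2^-1 -> mult_bnd (e h) 1.
Proof.
move=> ha hb; have [y [ya y2 hy]] := sqrt_one_sub_sq ha hb.
have [el eM ea] := eh.
pose u := h + 'i *: y.
have au : adj u = h - 'i *: y.
  by rewrite adjD Defs.adjZ ha ya conjCi scaleNr.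
have i2 : ('i : R[i]) * 'i = -1 by rewrite -expr2 sqrCi.
have uu : adj u ** u = mone I.
  rewrite au smulBl !smulDr smulZl !smulZr hy smulZl scalerA i2 y2 scaleN1r.
  by rewrite opprB addrACA subrr addr0 addrC subrK.
have uu' : u ** adj u = mone I.
  rewrite au smulDl !smulBr smulZl !smulZr hy smulZl scalerA i2 y2 scaleN1r.
  by rewrite opprK addrA subrK [_ + _]addrC subrK.
have p2 : adj (e (mone I)) ** e (mone I) = e (mone I).
  by rewrite -ea -eM adj_mone smone.
have bu : mult_bnd (e u) 1 by apply: mult_bnd_pisom p2 _; rewrite -ea -eM uu.
have bau : mult_bnd (e (adj u)) 1.
  by apply: mult_bnd_pisom p2 _; rewrite -ea -eM adjK uu'.
have -> : e h = 2^-1 *: (e u + e (adj u)).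
  rewrite -star_homD// au addrACA subrr addr0 -star_homZ// -mulr2n -(scaler_nat 2 h).
  by rewrite scalerA mulVf ?pnatr_eq0// scale1r.
by apply: mult_bndW (mult_bndZ _ (mult_bndD bu bau)); rewrite cabsV2; lra.
Qed.

(** The self-adjoint case applies to [h = m^* m / (2 c ^ 2)], whose bound is
    [1/2], and gives the bound [2 c ^ 2] for the image of [m^* m]. *)
Lemma star_hom_mult_bnd m (c : R) : 0 <= c -> mult_bnd m c -> mult_bnd (e m) (2 * c).
Proof.
move=> c0 mc; have [el eM ea] := eh.
have [cE|cn0] := eqVneq c 0.
  have -> : m = 0.
    apply: mult_lext => x; apply: rnorm_eq0; apply/eqP.
    rewrite eq_le rnorm_ge0 andbT.
    by have := mc x; rewrite cE mul0r.
  by rewrite star_hom0//; apply: mult_bnd0; rewrite mulr_ge0.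
have c20 : 0 < 2 * c ^+ 2 by rewrite mulr_gt0// exprn_gt0// lt_def cn0.
pose h := (2 * c ^+ 2)^-1%:C *: (adj m ** m).
have ha : adj h = h.
  rewrite Defs.adjZ adjM adjK; congr (_ *: _); exact: conjc_real.
have hb : mult_bnd h 2^-1.
  have := mult_bndZ (2 * c ^+ 2)^-1%:C (mult_bndM c0 (mult_bnd_adj c0 mc) mc).
  apply: mult_bndW; rewrite cabs_real ger0_norm ?invr_ge0 ?(ltW c20)// -expr2.
  by rewrite invfM -mulrA mulVf ?mulr1// expf_eq0.
have b1 := mult_bndZ (2 * c ^+ 2)%:C (star_hom_selfadjoint_bnd ha hb).
apply: (@mult_bnd_sq _ _ _ (2 * c ^+ 2)).
- by rewrite mulr_ge0.
- by rewrite exprMn ler_wpM2r ?sqr_ge0// -natrX ler_nat.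
rewrite -ea -eM; have -> : adj m ** m = (2 * c ^+ 2)%:C *: h.
  by rewrite /h scalerA -rmorphM /= divff ?gt_eqF// scale1r.
rewrite star_homZ//; apply: mult_bndW b1.
by rewrite mulr1 cabs_real ger0_norm// (ltW c20).
Qed.

End AutomaticContinuity.

(** * The quotient norm of the corona algebra *)

Section CoronaNorm.
Variables (R : realType) (I : cstarAlgType R[i]).
Local Notation pi := (@piq _ _ (mideal (@full_ideal _ I))).

Lemma corona_norm_le m (c : R) : 0 <= c -> mult_bnd m c ->
  (corona_norm (pi m) <= c%:E)%E.
Proof.
move=> c0 /(mult_normP _ c0) mc; apply: le_trans mc.
by apply: ereal_inf_lbound; exists m.
Qed.

Lemma corona_norm_rep (X : corona I) (c d : R) : 0 <= c -> 0 < d ->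
  (corona_norm X <= c%:E)%E -> exists2 m, pi m = X & mult_bnd m (c + d).
Proof.
move=> c0 d0 Xc; have : (corona_norm X < (c + d)%:E)%E.
  by apply: le_lt_trans Xc _; rewrite lte_fin ltrDl.
move/ereal_inf_lt => [_ [m /= mX <-] /ltW md]; exists m => //.
by apply/mult_normP => //; rewrite addr_ge0// ltW.
Qed.

Lemma lee_addgt0P (x : \bar R) (c k : R) : 0 <= k ->
  (forall d : R, 0 < d -> (x <= (c + k * d)%:E)%E) -> (x <= c%:E)%E.
Proof.
move=> k0 h; apply/lee_addgt0Pr => e e0.
have k1 : 0 < k + 1 by rewrite ltr_wpDl.
apply: le_trans (h (e / (k + 1)) (divr_gt0 e0 k1)) _.
rewrite -EFinD lee_fin lerD2l mulrCA -[leRHS]mulr1 ler_wpM2l ?(ltW e0)//.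
by rewrite ler_pdivrMr// mul1r lerDl.
Qed.

Lemma corona_normD (X Y : corona I) (c d : R) : 0 <= c -> 0 <= d ->
  (corona_norm X <= c%:E)%E -> (corona_norm Y <= d%:E)%E ->
  (corona_norm (X + Y)%R <= (c + d)%:E)%E.
Proof.
move=> c0 d0 Xc Yd; apply: (@lee_addgt0P _ _ 2) => // e e0.
have [m mX mb] := corona_norm_rep c0 e0 Xc; have [n nY nb] := corona_norm_rep d0 e0 Yd.
rewrite -mX -nY piqD.
apply: corona_norm_le; first by rewrite !addr_ge0// mulr_ge0// ltW.
by apply: mult_bndW (mult_bndD mb nb); lra.
Qed.

End CoronaNorm.

Section CoronaMap.
Variables (R : realType) (I I' : cstarAlgType R[i]).

Lemma corona_norm_map (f : mult I -> mult I') (F : corona I -> corona I') (k : R) :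
  0 <= k -> (forall m, F (piq _ m) = piq _ (f m)) ->
  (forall m (c : R), 0 <= c -> mult_bnd m c -> mult_bnd (f m) (k * c)) ->
  forall X (c : R), 0 <= c -> (corona_norm X <= c%:E)%E ->
    (corona_norm (F X) <= (k * c)%:E)%E.
Proof.
move=> k0 Ff fk X c c0 Xc; apply: (@lee_addgt0P _ _ _ k) => // e e0.
have [m <- mb] := corona_norm_rep c0 e0 Xc; rewrite Ff -mulrDr.
have ce : 0 <= c + e by rewrite addr_ge0// ltW.
by apply: corona_norm_le; [rewrite mulr_ge0|exact: fk].
Qed.

End CoronaMap.

(** * Hilbert spaces: Fourier series, Riesz representation, adjoints *)

Section InnerProduct.
Variables (R : realType) (H : hilbert R).
Implicit Types (x y z : H) (c : R[i]).

Lemma ipDl x y z : ip (x + y) z = ip x z + ip y z.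
Proof. by have := ip_linear 1 x y z; rewrite scale1r mul1r. Qed.

Lemma ip0l z : ip (0 : H) z = 0.
Proof. by have := ipDl 0 0 z; rewrite addr0 -[LHS]addr0 => /addrI. Qed.

Lemma ipZl c x z : ip (c *: x) z = c * ip x z.
Proof. by have := ip_linear c x 0 z; rewrite addr0 ip0l addr0. Qed.

Lemma ipBl x y z : ip (x - y) z = ip x z - ip y z.
Proof. by rewrite ipDl -scaleN1r ipZl mulN1r. Qed.

Lemma ipDr x y z : ip z (x + y) = ip z x + ip z y.
Proof. by rewrite ip_conj ipDl rmorphD /= -!ip_conj. Qed.

Lemma ipZr c x z : ip z (c *: x) = c^* * ip z x.
Proof. by rewrite ip_conj ipZl rmorphM /= -ip_conj. Qed.

Lemma ip0r z : ip z (0 : H) = 0.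
Proof. by rewrite ip_conj ip0l rmorph0. Qed.

Lemma ipBr x y z : ip z (x - y) = ip z x - ip z y.
Proof. by rewrite ipDr -scaleN1r ipZr rmorphN1 mulN1r. Qed.

Lemma ip_suml n (f : 'I_n -> H) z : ip (\sum_(i < n) f i) z = \sum_(i < n) ip (f i) z.
Proof. by elim/big_rec2: _ => [|i a b _ <-]; [exact: ip0l|exact: ipDl]. Qed.

Lemma ip_rnorm x : ip x x = (rnorm x ^+ 2)%:C.
Proof. by rewrite ip_norm rnormE rmorphXn. Qed.

Lemma cauchy_schwarz x y : cabs (ip x y) <= rnorm x * rnorm y.
Proof.
have [->|y0] := eqVneq y 0; first by rewrite ip0r cabs0 rnorm0 mulr0.
have ny := rnorm_gt0 y0.
set a := ip x y; set r := (rnorm y ^+ 2)^-1.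
have r0 : 0 < r by rewrite invr_gt0 exprn_gt0.
have : ip (x - (a * r%:C) *: y) (x - (a * r%:C) *: y) =
    (rnorm x ^+ 2 - cabs a ^+ 2 * r)%:C.
  rewrite ipBl !ipBr !ipZl !ipZr !ip_rnorm (ip_conj x y) -/a.
  have -> : (a * r%:C)^* = a^* * r%:C.
    by rewrite rmorphM /=; congr (_ * _); exact: conjc_real.
  have rr : r%:C * (rnorm y ^+ 2)%:C = 1 :> R[i].
    by rewrite -rmorphM /= /r mulVf// expf_eq0 /= gt_eqF.
  have aa : a * a^* = (cabs a ^+ 2)%:C by rewrite rmorphXn /= -cabsE normCK.
  have -> : (rnorm x ^+ 2 - cabs a ^+ 2 * r)%:C =
      (rnorm x ^+ 2)%:C - a * a^* * r%:C by rewrite aa -rmorphM -rmorphB.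
  have -> : a * r%:C * (a^* * r%:C * (rnorm y ^+ 2)%:C) = a * a^* * r%:C.
    by rewrite -[a^* * _ * _]mulrA rr mulr1 mulrAC.
  by rewrite [a * r%:C * _]mulrAC subrr subr0 [_ * a]mulrAC [a^* * a]mulrC.
rewrite ip_rnorm => /complexI h.
have : 0 <= rnorm x ^+ 2 - cabs a ^+ 2 * r by rewrite -h sqr_ge0.
rewrite subr_ge0 ler_pdivrMr ?exprn_gt0// -exprMn ler_sqr//.
all: by rewrite ?nnegrE ?mulr_ge0 ?rnorm_ge0 ?cabs_ge0.
Qed.

Lemma cabs_ip_lipl y x x' : cabs (ip x y - ip x' y) <= rnorm y * rnorm (x - x').
Proof. by rewrite -ipBl mulrC cauchy_schwarz. Qed.

Lemma ip_lext x x' : (forall y, ip x y = ip x' y) -> x = x'.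
Proof.
move=> h; apply/eqP; rewrite -subr_eq0; apply/eqP/rnorm_eq0.
have : (rnorm (x - x') ^+ 2)%:C = 0 :> R[i] by rewrite -ip_rnorm ipBl h subrr.
by move=> /(@complexI R _ 0)/eqP; rewrite sqrf_eq0 => /eqP.
Qed.

Lemma ip_rext x x' : (forall y, ip y x = ip y x') -> x = x'.
Proof. by move=> h; apply: ip_lext => y; rewrite ip_conj h -ip_conj. Qed.

End InnerProduct.

Section OrthonormalSequence.
Variables (R : realType) (H : hilbert R) (e : nat -> H).
Hypothesis e_on : forall m n, ip (e m) (e n) = (m == n)%:R.
Implicit Types (x y : H) (c : nat -> R[i]).

Definition psum c n : H := \sum_(i < n) c i *: e i.

Lemma psumS c n : psum c n.+1 = psum c n + c n *: e n.
Proof. by rewrite /psum big_ord_recr. Qed.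

Lemma ip_psum c n m : ip (psum c n) (e m) = if (m < n)%N then c m else 0.
Proof.
elim: n => [|n IH]; first by rewrite /psum big_ord0 ip0l.
rewrite psumS ipDl IH ipZl e_on ltnS [(m <= n)%N]leq_eqVlt [n == m]eq_sym.
by case: eqVneq => [->|_] /=; rewrite ?ltnn ?add0r ?mulr1// mulr0 addr0.
Qed.

Definition sqsum c n : R := \sum_(i < n) cabs (c i) ^+ 2.

Lemma sqsumS c n : sqsum c n.+1 = sqsum c n + cabs (c n) ^+ 2.
Proof. by rewrite /sqsum big_ord_recr. Qed.

Lemma rnorm_psum c n k : (n <= k)%N ->
  rnorm (psum c k - psum c n) ^+ 2 = sqsum c k - sqsum c n.
Proof.
move=> /subnKC <-; elim: (k - n)%N => [|j IH].
  by rewrite addn0 !subrr rnorm0 expr0n.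
apply: (@complexI R); rewrite -ip_rnorm addnS psumS sqsumS.
rewrite [psum c (n + j) + _ - _]addrAC.
have : ip (psum c (n + j) - psum c n) (e (n + j)) = 0.
  by rewrite ipBl !ip_psum ltnn ltnNge leq_addr subrr.
move: (psum c (n + j) - psum c n) IH => a IH ae.
have ea : ip (e (n + j)) a = 0 by rewrite ip_conj ae rmorph0.
rewrite ipDl !ipDr !ipZr !ipZl ae ea.
rewrite e_on eqxx mulr1 !mulr0 addr0 add0r mulrC -normCK ip_rnorm IH.
by rewrite cabsE -rmorphXn -rmorphD /= [in RHS]addrAC.
Qed.

Lemma rnorm_psum0 c n : rnorm (psum c n) ^+ 2 = sqsum c n.
Proof.
by have := @rnorm_psum c 0 n (leq0n _); rewrite /psum /sqsum !big_ord0 !subr0.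
Qed.

(** Riesz-Fischer: [sqsum c] is monotone and bounded, hence Cauchy, and its
    increments are the squared distances of the partial sums. *)
Lemma fourier_series c (M : R) : (forall n, sqsum c n <= M) ->
  exists x, [/\ rcvg (psum c) x, forall m, ip x (e m) = c m & rnorm x ^+ 2 <= M].
Proof.
move=> cM.
have M0 : 0 <= M by rewrite (le_trans _ (cM 0%N))// /sqsum big_ord0.
have [x xE] : exists x, rcvg (psum c) x.
  apply: rcauchy_cvg => d d0.
  have hs : has_sup (range (sqsum c)).
    by split; [exists (sqsum c 0), 0%N|exists M => _ [n _ <-]].
  have [_ [N _ <-] sN] := @sup_adherent _ _ (d ^+ 2) (exprn_gt0 2 d0) hs.
  exists N => n Nn; rewrite -ler_sqr ?nnegrE ?rnorm_ge0 ?ltW// rnorm_psum//.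
  have : sqsum c n <= sup (range (sqsum c)) by apply: ub_le_sup; [case: hs|exists n].
  by move: sN; lra.
exists x; split=> // [m|].
  apply: (@rcvg_unique _ R[i]^o (fun n => ip (psum c n) (e m))).
    apply: (@rcvg_lip _ _ _ (fun z => ip z (e m) : R[i]^o) (rnorm (e m))) xE.
    by move=> y z; exact: cabs_ip_lipl.
  move=> d d0; exists m.+1 => n mn; rewrite ip_psum mn subrr.
  by rewrite rnorm0 ltW.
rewrite -(@sqr_sqrtr _ M)// ler_sqr ?nnegrE ?rnorm_ge0 ?sqrtr_ge0//.
apply: rcvg_bounded xE _ => n.
by rewrite -ler_sqr ?nnegrE ?rnorm_ge0 ?sqrtr_ge0// sqr_sqrtr// rnorm_psum0.
Qed.

Lemma bessel x n : sqsum (fun i => ip x (e i)) n <= rnorm x ^+ 2.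
Proof.
set c := fun i => ip x (e i).
have cE : ip (psum c n) x = (sqsum c n)%:C.
  rewrite /psum ip_suml /sqsum rmorph_sum /=; apply: eq_bigr => i _.
  by rewrite ipZl rmorphXn /= -cabsE normCK -ip_conj.
have s0 := rnorm_psum0 c n.
have q0 : 0 <= sqsum c n by rewrite -s0 sqr_ge0.
have := cauchy_schwarz (psum c n) x.
rewrite cE cabs_real ger0_norm// -{1}s0 expr2 => h.
rewrite -s0 ler_sqr ?nnegrE ?rnorm_ge0//; apply: le_of_sq_le; rewrite ?rnorm_ge0//.
by rewrite expr2 (le_trans h)// mulrC.
Qed.

End OrthonormalSequence.

Section OrthonormalBasis.
Variables (R : realType) (H : hilbert R) (e : nat -> H).
Hypothesis e_on : forall m n, ip (e m) (e n) = (m == n)%:R.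
Hypothesis e_total : forall x, (forall m, ip x (e m) = 0) -> x = 0.

Implicit Types (x y : H) (c : nat -> R[i]).
Local Notation psum := (psum e).

Lemma coord_ext x y : (forall m, ip x (e m) = ip y (e m)) -> x = y.
Proof.
by move=> h; apply/eqP; rewrite -subr_eq0; apply/eqP/e_total => m; rewrite ipBl h subrr.
Qed.

Lemma fourier_expansion x : rcvg (psum (fun i => ip x (e i))) x.
Proof.
have [y [yE yc _]] := fourier_series e_on (bessel e_on x).
have yx : y = x by exact: coord_ext.
by move: yE; rewrite yx.
Qed.

(** The representing vector has coordinates [(f (e i))^*]. Evaluating [f] on
    their partial sums bounds the sums of squares by [k ^ 2]. *)
Lemma riesz (f : H -> R[i]) (k : R) :
  (forall (a : R[i]) x y, f (a *: x + y) = a * f x + f y) ->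
  (forall x, cabs (f x) <= k * rnorm x) -> exists w, forall x, f x = ip x w.
Proof.
move=> fl fk; pose c i := (f (e i))^*.
have f0 : f 0 = 0 by have := fl (-1) 0 0; rewrite scaler0 addr0 mulN1r addNr.
have fS n : f (psum c n) = (sqsum c n)%:C.
  elim: n => [|n IH]; first by rewrite /psum /sqsum !big_ord0.
  by rewrite psumS addrC fl IH sqsumS rmorphD addrC rmorphXn /= -cabsE normCK
     /c conjCK mulrC.
have cM n : sqsum c n <= k ^+ 2.
  have s0 := rnorm_psum0 e_on c n.
  have := fk (psum c n); rewrite fS cabs_real -s0 ger0_norm ?sqr_ge0// => h.
  have [->|nz] := eqVneq (rnorm (psum c n)) 0; first by rewrite expr0n sqr_ge0.
  have nn : 0 < rnorm (psum c n) by rewrite lt_def nz rnorm_ge0.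
  move: h; rewrite expr2 ler_pM2r// => h.
  by rewrite -expr2 ler_sqr ?nnegrE ?rnorm_ge0// (le_trans (rnorm_ge0 _) h).
have [w [_ wc _]] := fourier_series e_on cM; exists w => x.
apply: (@rcvg_unique _ R[i]^o (fun n => f (psum (fun i => ip x (e i)) n))).
  apply: (@rcvg_lip _ _ _ (f : H -> R[i]^o) k) (fourier_expansion x).
  by apply: linear_lip.
rewrite (_ : (fun n => _) = fun n => ip (psum (fun i => ip x (e i)) n) w).
  apply: (@rcvg_lip _ _ _ (fun z => ip z w : R[i]^o) (rnorm w)) (fourier_expansion x).
  by move=> y z; exact: cabs_ip_lipl.
apply/funext => n; elim: n => [|n IH]; first by rewrite /psum big_ord0 f0 ip0l.
by rewrite psumS addrC fl IH ipDl ipZl (ip_conj w (e n)) wc /c conjCK.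
Qed.

Lemma adjoint_linear (k l : H -> H) : adjoint_op k l -> linear l.
Proof.
move=> kl c x y; apply: ip_rext => z.
by rewrite -kl !ipDr !ipZr !kl.
Qed.

Lemma adjoint_op_sym (k l : H -> H) : adjoint_op k l -> adjoint_op l k.
Proof. by move=> kl x y; rewrite ip_conj -kl -ip_conj. Qed.

Lemma adjoint_bnd (k l : H -> H) (c : R) : 0 <= c -> adjoint_op k l ->
  (forall x, rnorm (k x) <= c * rnorm x) -> forall x, rnorm (l x) <= c * rnorm x.
Proof.
move=> c0 kl kc x; apply: le_of_sq_le; rewrite ?mulr_ge0 ?rnorm_ge0//.
have := cauchy_schwarz (k (l x)) x; rewrite kl ip_rnorm cabs_real ger0_norm ?sqr_ge0//.
move=> /le_trans; apply; rewrite [leRHS]mulrAC.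
by apply: ler_wpM2r; rewrite ?rnorm_ge0.
Qed.

Lemma adjoint_exists (k : H -> H) (c : R) : linear k ->
  (forall x, rnorm (k x) <= c * rnorm x) -> exists l, adjoint_op k l.
Proof.
move=> lk kc.
have /choice[l lE] : forall y, exists w, forall x, ip (k x) y = ip x w.
  move=> y; apply: (@riesz _ (c * rnorm y)) => [a x z|x].
    by rewrite lk ipDl ipZl.
  apply: le_trans (cauchy_schwarz _ _) _; rewrite mulrAC.
  by apply: ler_wpM2r; rewrite ?rnorm_ge0.
by exists l => x y.
Qed.

Definition contractive (k : H -> H) : Prop :=
  linear k /\ forall x, rnorm (k x) <= rnorm x.

(** Compression along an orthonormal subsequence: [w] reads the coordinates
    along [e (s n)], so its adjoint is the isometry sending [e n] to
    [e (s n)]. *)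
Lemma subsequence_isometry (s : nat -> nat) : injective s ->
  exists v w : H -> H, [/\ contractive v, contractive w, adjoint_op v w, cancel v w
    & forall y m, ip (w y) (e m) = ip y (e (s m))].
Proof.
move=> si.
have es_on m n : ip (e (s m)) (e (s n)) = (m == n)%:R by rewrite e_on (inj_eq si).
have /choice[w wE] : forall y, exists x,
    (forall m, ip x (e m) = ip y (e (s m))) /\ rnorm x ^+ 2 <= rnorm y ^+ 2.
  move=> y; have [x [_ xm xy]] := fourier_series e_on (bessel es_on y).
  by exists x.
have wl : linear w.
  move=> c x y; apply: coord_ext => m.
  by rewrite !ipDl !ipZl !(wE _).1 ipDl ipZl.
have wb x : rnorm (w x) <= 1 * rnorm x.
  by rewrite mul1r -ler_sqr ?nnegrE ?rnorm_ge0// (wE x).2.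
have [v wv] := adjoint_exists wl wb.
exists v, w; split=> //.
- split=> [|x]; first exact: adjoint_linear wv.
  by rewrite -[leRHS]mul1r; exact: adjoint_bnd wv wb x.
- by split=> // x; have := wb x; rewrite mul1r.
- exact: adjoint_op_sym.
- move=> x; apply: coord_ext => m.
  have ws : w (e (s m)) = e m.
    by apply: coord_ext => n; rewrite (wE _).1 es_on e_on.
  by rewrite (wE _).1 ip_conj -wv ws -ip_conj.
- by move=> y m; rewrite (wE y).1.
Qed.
(** The even and the odd subsequences of the basis split [H] into two copies
    of itself. *)
Lemma cuntz_isometries : exists v1 w1 v2 w2 : H -> H,
  [/\ contractive v1 /\ contractive w1, contractive v2 /\ contractive w2,
      adjoint_op v1 w1 /\ adjoint_op v2 w2, cancel v1 w1 /\ cancel v2 w2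
    & forall y, v1 (w1 y) + v2 (w2 y) = y].
Proof.
have i1 : injective (fun n => n.*2) by exact: double_inj.
have i2 : injective (fun n => n.*2.+1) by move=> m n [/double_inj].
have [v1 [w1 [cv1 cw1 a1 k1 c1]]] := subsequence_isometry i1.
have [v2 [w2 [cv2 cw2 a2 k2 c2]]] := subsequence_isometry i2.
exists v1, w1, v2, w2; split=> // y; apply: coord_ext => m.
rewrite ipDl a1 a2 -[m]odd_double_half; case: (odd m) => /=.
- have -> : w1 (e (1 + m./2.*2)) = 0.
    apply: coord_ext => n; rewrite c1 e_on ip0l.
    by case: eqP => // /(congr1 odd); rewrite /= !odd_double.
  have -> : w2 (e (1 + m./2.*2)) = e m./2.
    by apply: coord_ext => n; rewrite c2 !e_on eqSS (inj_eq double_inj).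
  by rewrite ip0r add0r c2.
- have -> : w2 (e (0 + m./2.*2)) = 0.
    apply: coord_ext => n; rewrite c2 e_on ip0l.
    by case: eqP => // /(congr1 odd); rewrite /= !odd_double.
  have -> : w1 (e (0 + m./2.*2)) = e m./2.
    by apply: coord_ext => n; rewrite c1 !e_on (inj_eq double_inj).
  by rewrite ip0r addr0 c1.
Qed.

End OrthonormalBasis.

Section GramSchmidt.
Variables (R : realType) (H : hilbert R) (d : nat -> H).

Definition gs_step (s : seq H) (x : H) : H :=
  let r := x - \sum_(e <- s) ip x e *: e in (rnorm r)^-1%:C *: r.

Fixpoint gs_prefix n : seq H :=
  if n is k.+1 then rcons (gs_prefix k) (gs_step (gs_prefix k) (d k)) else [::].

(** Vectors of [d] that depend linearly on earlier ones are turned into [0]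
    (recall that [0^-1 = 0]), so the result is only orthonormal up to zeros. *)
Definition gs n : H := gs_step (gs_prefix n) (d n).

Lemma gs_prefixE n : gs_prefix n = mkseq gs n.
Proof. by elim: n => [//|n IH]; rewrite mkseqS -IH. Qed.

Definition gs_rest n : H := d n - \sum_(i < n) ip (d n) (gs i) *: gs i.

Lemma gsE n : gs n = (rnorm (gs_rest n))^-1%:C *: gs_rest n.
Proof.
suff E : \sum_(e <- gs_prefix n) ip (d n) e *: e =
    \sum_(i < n) ip (d n) (gs i) *: gs i by rewrite {1}/gs /gs_step E.
by rewrite gs_prefixE big_map -(big_mkord xpredT (fun i => ip (d n) (gs i) *: gs i))
  /index_iota subn0.
Qed.

Lemma gs_normed n : gs n = 0 \/ ip (gs n) (gs n) = 1.
Proof.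
rewrite gsE; have [->|r0] := eqVneq (gs_rest n) 0; [left|right].
  by rewrite scaler0.
rewrite ip_rnorm rnormZR ger0_norm ?invr_ge0 ?rnorm_ge0// mulVf ?expr1n//.
by apply: contra_neq r0 => /rnorm_eq0.
Qed.

Lemma gs_orth n i : (i < n)%N -> ip (gs n) (gs i) = 0.
Proof.
elim/ltn_ind: n i => n IH i ni; rewrite gsE ipZl ipBl ip_suml.
rewrite (bigD1 (Ordinal ni))//= big1 => [|j ji]; last first.
  rewrite ipZl; have [jlt|ijlt|jE] := ltngtP j i.
  - by rewrite (ip_conj (gs i) (gs j)) IH// rmorph0 mulr0.
  - by rewrite IH// mulr0.
  - by move: ji; rewrite -(inj_eq val_inj) /= jE eqxx.
rewrite addr0 ipZl; case: (gs_normed i) => [->|->].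
  by rewrite !ip0r mul0r subrr mulr0.
by rewrite mulr1 subrr mulr0.
Qed.

Lemma gs_total x : rdense (range d) -> (forall n, ip x (gs n) = 0) -> x = 0.
Proof.
move=> dd xg; have xd n : ip x (d n) = 0.
  have rE : gs_rest n = (rnorm (gs_rest n))%:C *: gs n.
    rewrite gsE scalerA -rmorphM /=; have [->|r0] := eqVneq (gs_rest n) 0.
      by rewrite scaler0.
    rewrite divff ?scale1r//; by apply: contra_neq r0 => /rnorm_eq0.
  have -> : d n = gs_rest n + \sum_(i < n) ip (d n) (gs i) *: gs i by rewrite subrK.
  rewrite rE ipDr ipZr xg mulr0 add0r ip_conj ip_suml big1 ?rmorph0// => i _.
  by rewrite ipZl (ip_conj x) xg rmorph0 mulr0.
apply: rnorm_small => e e0; have [_ [n _ <-] xn] := dd x e e0.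
apply: le_trans xn; apply: le_of_sq_le; rewrite ?rnorm_ge0//.
have := cauchy_schwarz (x - d n) x; rewrite ipBl [ip (d n) x]ip_conj xd rmorph0 subr0.
by rewrite ip_rnorm cabs_real ger0_norm ?sqr_ge0.
Qed.

(** Otherwise finitely many of the vectors [gs i] would span [H], and one more
    vector than that could not be linearly independent. *)
Lemma gs_infinite : rdense (range d) -> infinite_dim H ->
  forall N, exists2 n, (N <= n)%N & gs n != 0.
Proof.
move=> dd Hinf N; apply: contrapT => noN.
have g0 n : (N <= n)%N -> gs n = 0.
  by move=> Nn; apply: contrapT => /eqP gn; apply: noN; exists n.
have xE x : x = \sum_(i < N) ip x (gs i) *: gs i.
  apply/eqP; rewrite -subr_eq0; apply/eqP/gs_total => // n.
  rewrite ipBl ip_suml; have [nN|/g0->] := ltnP n N; last first.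
    by rewrite ip0r sub0r big1 ?oppr0// => i _; rewrite ip0r.
  rewrite (bigD1 (Ordinal nN))//= big1 => [|j jn]; last first.
    rewrite ipZl; have [jlt|njlt|jE] := ltngtP j n.
    - by rewrite (ip_conj (gs n) (gs j)) gs_orth// rmorph0 mulr0.
    - by rewrite gs_orth// mulr0.
    - by move: jn; rewrite -(inj_eq val_inj) /= jE eqxx.
  rewrite addr0 ipZl; case: (gs_normed n) => [->|->].
    by rewrite !ip0r mul0r subrr.
  by rewrite mulr1 subrr.
have [v v_indep] := Hinf N.+1.
pose A := \matrix_(j < N.+1, i < N) ip (v j) (gs i).
have : kermx A != 0.
  rewrite kermx_eq0 /row_free; apply/negP => /eqP rA.
  by have := rank_leq_col A; rewrite rA ltnn.
move=> /rowV0Pn[a /sub_kermxP aA a0].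
suff : \sum_(j < N.+1) a 0 j *: v j = 0.
  move=> /v_indep av; case/eqP: a0; apply/rowP => j; by rewrite mxE av.
under eq_bigr do rewrite [v _]xE scaler_sumr.
rewrite exchange_big /= big1 // => i _.
under eq_bigr do rewrite scalerA.
rewrite -scaler_suml (_ : \sum_j _ = (a *m A) 0 i); last first.
  by rewrite mxE; apply: eq_bigr => j _; rewrite mxE.
by rewrite aA mxE scale0r.
Qed.

End GramSchmidt.

(** The nonzero Gram-Schmidt vectors have an infinite set of indices, which is
    re-enumerated by all natural numbers. *)
Lemma orthonormal_basis (R : realType) (H : hilbert R) :
  separable H -> infinite_dim H -> exists e : nat -> H,
    (forall m n, ip (e m) (e n) = (m == n)%:R) /\
    (forall x, (forall m, ip x (e m) = 0) -> x = 0).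
Proof.
move=> [D [/countable_injP[f fi] /dense_rdense dD]] Hinf.
have /choice[d dE] : forall n, exists x : H,
    forall y, D y -> f y = n -> x = y.
  move=> n; have [[y [Dy fy]]|noy] := pselect (exists y, D y /\ f y = n).
    by exists y => z Dz fz; apply: fi; rewrite ?inE// fy fz.
  by exists 0 => y Dy fy; case: noy; exists y.
have dd : rdense (range d).
  move=> x e e0; have [y Dy xy] := dD x e e0.
  by exists y => //; exists (f y) => //; exact: dE.
pose N := [set n | gs d n != 0].
have : (N #= [set: nat])%card.
  apply: eq_card_nat; first exact: countableP.
  move=> /finite_seqP[s sE]; have [n] := gs_infinite dd Hinf (\max_(i <- s) i).+1.
  move=> nlt n0; have : N n by []; rewrite sE /= => ns.
  have : (n <= \max_(i <- s) i)%N by rewrite (big_rem n)//= leq_maxl.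
  by rewrite leqNgt nlt.
rewrite card_eq_sym => /card_set_bijP[g [gN gi gs_surj]].
exists (fun n => gs d (g n)); split=> [m n|x xg].
  have [<-|mn] := eqVneq m n.
    have := gN m I; rewrite /N /= => /eqP gm.
    by case: (gs_normed d (g m)).
  have gmn : g m != g n by apply: contra_neq mn => /gi; apply; rewrite inE.
  have [lt|lt|] := ltngtP (g m) (g n); last by move/eqP; rewrite (negbTE gmn).
    by rewrite ip_conj gs_orth// rmorph0.
  by rewrite gs_orth.
apply: (gs_total dd) => n; have [->|n0] := eqVneq (gs d n) 0; first by rewrite ip0r.
by have [m _ <-] := gs_surj n n0.
Qed.

(** * Compact operators *)

Section CompactOperators.
Variables (R : realType) (H : hilbert R).
Implicit Types (x y : H) (k l s : H -> H).

Lemma contractive_continuous s : contractive s -> continuous s.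
Proof.
move=> [ls bs] x; apply/cvgrPdist_le => e e0; near=> y.
have : `|s x - s y| <= `|x - y|.
  by rewrite -(linB ls) !rnormE lecR.
by move=> /le_trans; apply; near: y; apply: cvgr_dist_le => //; exact: cvg_id.
Unshelve. all: by end_near. Qed.

Lemma compact_op_contractive_comp s k :
  contractive s -> compact_op k -> compact_op (s \o k).
Proof.
move=> cs [lk [K kK [Kc Kcl]]]; split; first by move=> c x y /=; rewrite lk cs.1.
have sK : compact (s @` K).
  apply: continuous_compact => //; apply: continuous_subspaceT.
  exact: contractive_continuous.
exists (s @` K); last by split=> //; apply: compact_closed => //; exact: norm_hausdorff.
by move=> _ [x x1 <-]; exists (k x) => //; apply: kK; exists x.
Qed.

Lemma norm_le1 x : (`|x| <= 1) = (rnorm x <= 1).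
Proof. by rewrite rnormE -(@rmorph1 _ _ (real_complex R)) lecR. Qed.

Lemma compact_op_bounded k : compact_op k ->
  exists2 c : R, 0 <= c & forall x, rnorm (k x) <= c * rnorm x.
Proof.
move=> [lk [K kK [Kc _]]].
have [M MK] : exists M : nat, forall y, K y -> rnorm y <= M%:R.
  have /compact_near_coveringP/(_ _ \oo (fun n y => rnorm y <= n%:R)) := Kc.
  case=> [y Ky|n _ hn]; last by exists n => y Ky; exact: (hn n (leqnn n)).
  have [n ny] : exists n : nat, rnorm y + 1 <= n%:R.
    by exists (Num.truncn (rnorm y + 1)).+1; apply/ltW; exact: truncnS_gt.
  near=> z i; have zy : rnorm (z - y) <= 1.
    rewrite -lecR -rnormE; near: z; apply: cvgr_distC_le => //; exact: cvg_id.
  have ni : (n <= i)%N by near: i; exists n.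
  rewrite -[z](subrK y); apply: le_trans (rnormD _ _) _; rewrite addrC.
  by apply: le_trans (lerD (lexx _) zy) _; apply: (le_trans ny); rewrite ler_nat.
exists M%:R => // x; have [->|x0] := eqVneq x 0.
  by rewrite (lin0 lk) !rnorm0 mulr0.
have nx := rnorm_gt0 x0.
have : rnorm (k ((rnorm x)^-1%:C *: x)) <= M%:R.
  apply/MK/kK; exists ((rnorm x)^-1%:C *: x) => //=.
  rewrite norm_le1 rnormZR ger0_norm ?invr_ge0 ?rnorm_ge0//.
  by rewrite mulVf ?gt_eqF.
by rewrite (linZ lk) rnormZR ger0_norm ?invr_ge0 ?rnorm_ge0// ler_pdivrMl// mulrC.
Unshelve. all: by end_near. Qed.

(** Schauder's theorem. The image of the unit ball under the adjoint [l] lies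
    in the closed set [A] of all [z] with [|<z, y>| <= |k y|] for every [y]. On
    [A] one has [|z - z'| ^ 2 <= 2 * |k z - k z'|], so a filter on [A] is Cauchy
    as soon as its image under [k] is. *)
Lemma compact_op_adjoint k l : compact_op k -> adjoint_op k l -> compact_op l.
Proof.
move=> kc kl; have [c c0 kb] := compact_op_bounded kc.
have kz_small z z' : (forall y, cabs (ip z y) <= rnorm (k y)) ->
    (forall y, cabs (ip z' y) <= rnorm (k y)) ->
    rnorm (z - z') ^+ 2 <= 2 * rnorm (k z - k z').
  move=> Az Az'; rewrite -[rnorm _ ^+ 2]ger0_norm ?sqr_ge0// -cabs_real -ip_rnorm.
  rewrite ipBl -(linB kc.1) mulr_natl mulr2n.
  apply: le_trans (cabsD _ _) _; apply: lerD => //.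
  by rewrite -[- _]mulN1r cabsM; have := cabs_real (-1 : R);
    rewrite rmorphN rmorph1 normrN1 => ->; rewrite mul1r.
have [lk [K kK [Kc _]]] := kc.
pose A := [set z | forall y, cabs (ip z y) <= rnorm (k y)].
have Acl : closed A.
  move=> z zA y; apply/ler_addgt0Pl => e e0.
  have d0 : 0 < e / (rnorm y + 1) by rewrite divr_gt0// ltr_wpDl ?rnorm_ge0.
  have [z' [Az' zz']] : A `&` [set z' | rnorm (z' - z) <= e / (rnorm y + 1)] !=set0.
    apply: zA; have := @cvgr_distC_le _ _ _ (nbhs z) _ id z cvg_id (e / (rnorm y + 1))%:C.
    by rewrite ltcR => /(_ _ d0); apply: filterS => z' /=; rewrite rnormE lecR.
  rewrite -[z](subrK z') ipDl addrC; apply: le_trans (cabsD _ _) _; rewrite addrC.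
  apply: lerD => //; apply: le_trans (cauchy_schwarz _ _) _.
  rewrite rnormB; apply: le_trans (ler_wpM2r (rnorm_ge0 y) zz') _.
  rewrite mulrAC ler_pdivrMr ?ltr_wpDl ?rnorm_ge0//.
  by rewrite ler_wpM2l ?(ltW e0)// lerDl.
pose K2 := (fun y : H => (c + 1)%:C *: y) @` K.
have K2c : compact K2.
  apply: continuous_compact => //; apply: continuous_subspaceT => y.
  by apply: cvgZr; exact: cvg_id.
have kA : k @` A `<=` K2.
  move=> _ [z Az <-]; have c1 : 0 < c + 1 by rewrite ltr_wpDl.
  have zc : rnorm z <= c.
    apply: le_of_sq_le; rewrite ?rnorm_ge0//; apply: le_trans (kb z).
    by rewrite -[_ ^+ 2]ger0_norm ?sqr_ge0// -cabs_real -ip_rnorm.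
  exists (k ((c + 1)^-1%:C *: z)).
    apply: kK; exists ((c + 1)^-1%:C *: z) => //=.
    rewrite norm_le1 rnormZR ger0_norm ?invr_ge0 ?(ltW c1)//.
    by rewrite ler_pdivrMl// mulr1 (le_trans zc)// lerDl.
  by rewrite (linZ lk) scalerA -rmorphM /= divff ?gt_eqF// scale1r.
split; first exact: adjoint_linear kl.
exists A; last first.
  split=> //; rewrite compact_ultra => F FU FA.
  have [p [_ Fp]] : K2 `&` [set p | k @ F --> p] !=set0.
    have FK2 : F (k @^-1` K2).
      apply: (filterS _ FA) => z Az; apply: kA.
      by exists z.
    have [p [K2p pF]] := K2c (k @ F) _ FK2; exists p; split=> // B Bp.
    have [//|FB] := in_ultra_setVsetC (k @^-1` B) FU.
    by have [z []] := pF (~` B) B FB Bp.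
  have : cvg F.
    apply/cauchy_cvgP/cauchy_exP => e e0.
    have [r r0 rE] : exists2 r : R, 0 < r & r%:C = e.
      move: e0; rewrite ltcE /= => /andP[/eqP e0 er].
      by exists (complex.Re e) => //; case: e e0 {er} => a b /= ->.
    (* With this radius, [|z0 - z| ^ 2 <= 2 * |k z0 - k z| <= r ^ 2 / 2 < r ^ 2]. *)
    have d0 : 0 < r ^+ 2 / 8 by rewrite divr_gt0// exprn_gt0.
    have FB : F (A `&` [set z | rnorm (k z - p) <= r ^+ 2 / 8]).
      apply: filterI => //.
      have := @cvgr_distC_le _ _ _ F _ k p Fp (r ^+ 2 / 8)%:C.
      by rewrite ltcR => /(_ _ d0); apply: filterS => z' /=; rewrite rnormE lecR.
    have [z0 [Az0 kz0]] := filter_ex FB.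
    exists z0; apply: filterS FB => z [Az kz]; rewrite -ball_normE /=.
    rewrite rnormE -rE ltcR -ltr_sqr ?nnegrE ?rnorm_ge0 ?ltW//.
    apply: le_lt_trans (kz_small _ _ Az0 Az) _.
    have := rnorm_dist (k z0) p (k z); rewrite [rnorm (p - k z)]rnormB.
    by move: kz0 kz d0 => /=; lra.
  move=> /cvg_ex[q Fq]; exists q; split=> //.
  by apply: closed_cvg Fq => //.
move=> _ [x /= x1 <-] y; rewrite (adjoint_op_sym kl).
apply: le_trans (cauchy_schwarz _ _) _; rewrite -[leRHS]mul1r.
by apply: ler_wpM2r; [exact: rnorm_ge0|move: x1; rewrite norm_le1].
Qed.

End CompactOperators.

(** * Operators on the Hilbert space as multipliers of the stabilisation *)

Section DenseMultipliers.
Variables (R : realType) (I : cstarAlgType R[i]) (D : I -> Prop).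
Hypothesis dD : rdense D.

(** Density is applied to the maps [x |-> rmult m a ** x], which are continuous
    for every multiplier [m]. *)
Lemma mult_dense_ext (m n : mult I) :
  (forall x, D x -> lmult m x = lmult n x) -> m = n.
Proof.
move=> mn; apply: mult_rext => a; apply: nondeg_r => x.
have [u Du ux] := rdense_seq x dD.
apply: rcvg_unique (rcvg_smulr _ ux) _.
under eq_fun do rewrite -multP mn// multP.
exact: rcvg_smulr.
Qed.

Lemma dense_adjoint (f f' : I -> I) (k : R) :
  (forall x y, rnorm (f x - f y) <= k * rnorm (x - y)) ->
  (forall x y, rnorm (f' x - f' y) <= k * rnorm (x - y)) ->
  (forall x y, D x -> D y -> adj (f x) ** y = adj x ** f' y) ->
  forall x y, adj (f x) ** y = adj x ** f' y.
Proof.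
move=> fk fk' ff' x y.
have step z : D z -> adj (f x) ** z = adj x ** f' z.
  move=> Dz; have [u Du ux] := rdense_seq x dD.
  apply: rcvg_unique (rcvg_smull z (rcvg_adj (rcvg_lip fk ux))) _.
  by under eq_fun do rewrite /= ff'//; exact: rcvg_smull (rcvg_adj ux).
have [u Du uy] := rdense_seq y dD.
apply: rcvg_unique (rcvg_smulr _ uy) _.
by under eq_fun do rewrite step//; exact: rcvg_smulr (rcvg_lip fk' uy).
Qed.

End DenseMultipliers.

Section TensorOperators.
Variables (R : realType) (G : topGroupType) (I T : gcstar R G) (H : hilbert R).
Variables (t : I -> (H -> H) -> T) (ct : compact_tensor t).
Hypothesis adj_ex : forall k : H -> H, compact_op k ->
  exists2 l : H -> H, compact_op l & adjoint_op k l.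
Implicit Types (x y z : T) (a b : I) (k l s : H -> H).

(** The graph of [1 (x) s] on the algebraic tensor product, as a relation: its
    being a function is a consequence of adjointability. *)
Inductive tgraph s : T -> T -> Prop :=
| tgraph0 : tgraph s 0 0
| tgraphS a k x y : compact_op k -> tgraph s x y ->
    tgraph s (t a k + x) (t a (s \o k) + y).

(** The algebraic tensor product, as the domain of the identity. *)
Definition tspan x : Prop := tgraph id x x.

Lemma tgraph_id x y : tgraph id x y -> x = y.
Proof. by elim=> // a k {}x {}y ck _ ->. Qed.

Lemma tspanS a k x : compact_op k -> tspan x -> tspan (t a k + x).
Proof. by move=> ck sx; exact: (@tgraphS id a k). Qed.

Lemma tgraph_dom s x y : tgraph s x y -> tspan x.
Proof. elim=> [|a k {}x {}y ck _ sx]; [exact: tgraph0|exact: tspanS]. Qed.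

Lemma tgraph_total s x : tspan x -> exists y, tgraph s x y.
Proof.
elim=> [|a k {}x y ck _ [z xz]]; first by exists 0; exact: tgraph0.
by exists (t a (s \o k) + z); exact: tgraphS.
Qed.

Lemma tgraphD s x y x' y' :
  tgraph s x y -> tgraph s x' y' -> tgraph s (x + x') (y + y').
Proof.
elim=> [|a k {}x {}y ck _ IH] xy'; first by rewrite !add0r.
by rewrite -!addrA; apply: tgraphS => //; exact: IH.
Qed.

Lemma tgraphZ s (c : R[i]) x y : (forall k, compact_op k -> compact_op (s \o k)) ->
  tgraph s x y -> tgraph s (c *: x) (c *: y).
Proof.
move=> sc; elim=> [|a k {}x {}y ck _ IH]; first by rewrite scaler0; exact: tgraph0.
have tZ l : compact_op l -> c *: t a l = t (c *: a) l.
  by move=> cl; rewrite (linZ (ct_linl ct cl)).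
by rewrite !scalerDr !tZ//; [exact: tgraphS|exact: sc].
Qed.

Lemma tgraph_comp s r x y : (forall k, compact_op k -> compact_op (s \o k)) ->
  tgraph s x y -> exists2 z, tgraph r y z & tgraph (r \o s) x z.
Proof.
move=> sc; elim=> [|a k {}x {}y ck _ [z yz xz]]; first by exists 0; exact: tgraph0.
by exists (t a (r \o s \o k) + z); apply: tgraphS => //; exact: sc.
Qed.

Lemma tgraph_act s g x y : tgraph s x y ->
  (forall k, compact_op k -> compact_op (s \o k)) ->
  tgraph s (gact g x) (gact g y).
Proof.
move=> xy sc; have gh := gact_hom T g.
elim: xy => [|a k {}x {}y ck _ IH]; first by rewrite star_hom0//; exact: tgraph0.
rewrite !star_homD// !(ct_act ct)//; last exact: sc.
exact: tgraphS.
Qed.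

Lemma tspan_dense : rdense tspan.
Proof.
move=> x e e0; have [_ [n [a [k [ck ->]]]] xy] := dense_rdense (ct_dense ct) x e0.
exists (\sum_(i < n) t (a i) (k i)) => //.
elim: n a k ck {xy} => [|n IH] a k ck; first by rewrite big_ord0; exact: tgraph0.
by rewrite big_ord_recl; apply: tspanS => //; exact: IH.
Qed.

Definition adjointable s s' : Prop :=
  [/\ contractive s, contractive s' & adjoint_op s s'].

Lemma adjointableC s s' : adjointable s s' -> adjointable s' s.
Proof. by case=> cs cs' ss'; split=> //; exact: adjoint_op_sym. Qed.

Lemma adjointable_compact s s' : adjointable s s' ->
  forall k, compact_op k -> compact_op (s \o k).
Proof. by case=> cs _ _ k; exact: compact_op_contractive_comp. Qed.

(** For elementary tensors [t a k] and [t b l] both sides are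
    [t (adj a ** b) (k' s' l)], where [k'] is the adjoint of [k]. *)
Lemma tgraph_adjoint s s' x y z w : adjointable s s' ->
  tgraph s x y -> tgraph s' z w -> adj y ** z = adj x ** w.
Proof.
move=> ss' xy; have [cs cs' as'] := ss'.
have sc := adjointable_compact ss'.
have sc' := adjointable_compact (adjointableC ss').
elim: xy z w => [|a k {}x {}y ck _ IH] z w zw; first by rewrite adj0 !smul0r.
rewrite !adjD !smulDl (IH z w zw); congr (_ + _).
have [k' ck' kk'] := adj_ex ck.
have skk' : adjoint_op (s \o k) (k' \o s').
  by move=> u v /=; rewrite as' kk'.
rewrite (ct_adj ct a (sc _ ck) (compact_op_adjoint (sc _ ck) skk') skk').
rewrite (ct_adj ct a ck ck' kk').
elim: zw => [|b l {}z {}w cl _ IH2]; first by rewrite !smulr0.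
rewrite !smulDr IH2; congr (_ + _).
rewrite !(ct_mul ct)//; first exact: sc'.
exact: compact_op_adjoint (sc _ ck) skk'.
Qed.

(** The difference [y - y'] of two values lies in the span and is orthogonal to
    it, hence to itself. *)
Lemma tgraph_fun s s' x y y' : adjointable s s' ->
  tgraph s x y -> tgraph s x y' -> y = y'.
Proof.
move=> ss' xy xy'; apply/eqP; rewrite -subr_eq0; apply/eqP/rnorm_eq0/eqP.
rewrite -sqrf_eq0 -rnorm_adjM.
have sc := adjointable_compact ss'.
have d0 : tgraph s 0 (y - y').
  have := tgraphD xy (tgraphZ (-1) sc xy'); rewrite !scaleN1r subrr //.
have sd : tspan (y - y').
  by have [z yz _] := tgraph_comp id sc d0; exact: tgraph_dom yz.
have [w dw] := tgraph_total s' sd.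
by rewrite (tgraph_adjoint ss' d0 dw) adj0 smul0r rnorm0.
Qed.

(** For an isometry [v] with adjoint [w], the operator [1 (x) v] preserves the
    inner product, and then [1 (x) w] is contractive as its adjoint. *)
Lemma tgraph_isometry v w x y : adjointable v w -> cancel v w ->
  tgraph v x y -> rnorm y = rnorm x.
Proof.
move=> vw vK xy; have sc := adjointable_compact vw.
have [z yz] := tgraph_comp w sc xy.
rewrite (_ : w \o v = id); last by apply/funext.
move=> /tgraph_id xz; rewrite -xz in yz.
apply/eqP; rewrite -(@eqrXn2 _ 2) ?rnorm_ge0//.
by rewrite -!rnorm_adjM (tgraph_adjoint vw xy yz).
Qed.

Lemma tgraph_coisometry v w x y : adjointable v w -> cancel v w ->
  tgraph w x y -> rnorm y <= rnorm x.
Proof.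
move=> vw vK xy; have wv := adjointableC vw.
have [z yz _] := tgraph_comp v (adjointable_compact wv) xy.
have zy := tgraph_isometry vw vK yz.
apply: le_of_sq_le; rewrite ?rnorm_ge0// -rnorm_adjM (tgraph_adjoint wv xy yz).
by apply: le_trans (rnorm_smul _ _) _; rewrite rnorm_adj zy.
Qed.

Lemma tgraph_extension s s' : adjointable s s' ->
  (forall x y, tgraph s x y -> rnorm y <= rnorm x) ->
  exists f : T -> T, [/\ linear f, forall x, rnorm (f x) <= 1 * rnorm x
    & forall x y, tgraph s x y -> f x = y].
Proof.
move=> ss' sb; have sc := adjointable_compact ss'.
have /choice[f0 f0E] x : exists y, tspan x -> tgraph s x y.
  by have [/(tgraph_total s)[y xy]|nx] := pselect (tspan x); [exists y|exists 0].
have idc k : compact_op k -> compact_op (id \o k) by [].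
have tlin (c : R[i]) x y : tspan x -> tspan y -> tspan (c *: x + y).
  by move=> sx sy; apply: tgraphD sy; apply: tgraphZ.
have flin (c : R[i]) x y : tspan x -> tspan y -> f0 (c *: x + y) = c *: f0 x + f0 y.
  move=> sx sy; apply: (tgraph_fun ss' (f0E _ (tlin _ _ _ sx sy))).
  by apply: tgraphD (f0E _ sy); apply: tgraphZ (f0E _ sx).
have fb x : tspan x -> rnorm (f0 x) <= 1 * rnorm x.
  by move=> sx; rewrite mul1r; apply/sb/f0E.
have [f [fl fc fE]] := bounded_extension tlin tspan_dense flin fb ler01.
exists f; split=> // x y xy; have sx := tgraph_dom xy.
by rewrite fE//; exact: tgraph_fun ss' (f0E _ sx) xy.
Qed.

Lemma isometry_multiplier v w : adjointable v w -> cancel v w ->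
  exists m : mult T, [/\ forall x y, tgraph v x y -> lmult m x = y,
    forall x y, tgraph w x y -> lmult (adj m) x = y & forall g, gmult g m = m].
Proof.
move=> vw vK; have wv := adjointableC vw; have sc := adjointable_compact vw.
have [x y xy|f [fl fb fE]] := tgraph_extension vw.
  by rewrite (tgraph_isometry vw vK xy).
have [x y xy|f' [fl' fb' fE']] := tgraph_extension wv.
  exact: tgraph_coisometry vw vK xy.
have ff' := dense_adjoint tspan_dense (linear_lip fl fb) (linear_lip fl' fb').
have [|m [mf mf']] := @adjointable_mult _ T f f'.
  apply: ff' => x y sx sy.
  have [u xu] := tgraph_total v sx; have [z yz] := tgraph_total w sy.
  by rewrite (fE _ _ xu) (fE' _ _ yz) (tgraph_adjoint vw xu yz).
exists m; split=> [x y xy|x y xy|g];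
  [by rewrite mf (fE _ _ xy)|by rewrite mf' (fE' _ _ xy)|].
apply: (mult_dense_ext tspan_dense) => x sx /=.
have idc k : compact_op k -> compact_op (id \o k) by [].
have [y xy] := tgraph_total v (tgraph_act g^-1%g sx idc).
have := tgraph_act g xy sc; rewrite -gactM mulgV gact1 => xy'.
by rewrite !mf (fE _ _ xy) (fE _ _ xy').
Qed.

End TensorOperators.

(** * Invariant isometries with complementary ranges *)

Section InvariantIsometries.
Variables (R : realType) (G : topGroupType).

Definition cuntz_pair (I : gcstar R G) (V1 V2 : mult I) : Prop :=
  [/\ adj V1 ** V1 = mone I /\ adj V2 ** V2 = mone I,
      forall g, gmult g V1 = V1 /\ gmult g V2 = V2
    & V1 ** adj V1 + V2 ** adj V2 = mone I].

Lemma compact_tensor_cuntz_pair (I T : gcstar R G) (H : hilbert R)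
    (t : I -> (H -> H) -> T) : separable H -> infinite_dim H -> compact_tensor t ->
  exists V1 V2 : mult T, cuntz_pair V1 V2.
Proof.
move=> sH iH ct; have [e [e_on e_tot]] := orthonormal_basis sH iH.
have adj_ex (k : H -> H) : compact_op k ->
    exists2 l : H -> H, compact_op l & adjoint_op k l.
  move=> ck; have [c _ kb] := compact_op_bounded ck.
  have [l kl] := adjoint_exists e_on e_tot ck.1 kb.
  by exists l => //; exact: compact_op_adjoint kl.
have [v1 [w1 [v2 [w2 [[cv1 cw1] [cv2 cw2] [a1 a2] [k1 k2] vw]]]]] :=
  cuntz_isometries e_on e_tot.
have vw1 : adjointable v1 w1 by [].
have vw2 : adjointable v2 w2 by [].
have [V1 [V1E V1E' gV1]] := isometry_multiplier ct adj_ex vw1 k1.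
have [V2 [V2E V2E' gV2]] := isometry_multiplier ct adj_ex vw2 k2.
have dT := tspan_dense ct.
have iso v w (V : mult T) : adjointable v w -> cancel v w ->
    (forall x y, tgraph t v x y -> lmult V x = y) ->
    (forall x y, tgraph t w x y -> lmult (adj V) x = y) -> adj V ** V = mone T.
  move=> vw' vK VE VE'; apply: (mult_dense_ext dT) => x sx; rewrite lmultME lmult1E.
  have [y xy] := tgraph_total v sx.
  have [z yz] := tgraph_comp w (adjointable_compact vw') xy.
  rewrite (_ : w \o v = id); last by apply/funext.
  by move=> /tgraph_id xz; rewrite (VE _ _ xy) (VE' _ _ yz).
exists V1, V2; split=> [|g|]; [split|split=> //|].
- exact: iso vw1 k1 V1E V1E'.
- exact: iso vw2 k2 V2E V2E'.
apply: (mult_dense_ext dT) => x sx; rewrite !lmultE.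
have [y1 [y2 [z1 [z2 [xy1 yz1 xy2 yz2 zx]]]]] : exists y1 y2 z1 z2,
    [/\ tgraph t w1 x y1, tgraph t v1 y1 z1, tgraph t w2 x y2, tgraph t v2 y2 z2
      & z1 + z2 = x].
  elim: sx => [|a k {}x y ck _ [y1 [y2 [z1 [z2 [h1 h2 h3 h4 h5]]]]]].
    by exists 0, 0, 0, 0; rewrite addr0; split=> //; exact: tgraph0.
  have c1 := compact_op_contractive_comp cw1 ck.
  have c2 := compact_op_contractive_comp cw2 ck.
  exists (t a (w1 \o k) + y1), (t a (w2 \o k) + y2),
    (t a (v1 \o (w1 \o k)) + z1), (t a (v2 \o (w2 \o k)) + z2).
  split; [exact: tgraphS|exact: tgraphS|exact: tgraphS|exact: tgraphS|].
  rewrite addrACA h5; congr (_ + _).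
  have := ct_linr ct a 1 (compact_op_contractive_comp cv1 c1)
    (compact_op_contractive_comp cv2 c2).
  rewrite !scale1r => <-; congr t; apply/funext => u /=; exact: vw.
by rewrite (V1E' _ _ xy1) (V1E _ _ yz1) (V2E' _ _ xy2) (V2E _ _ yz2).
Qed.

(** Multipliers are transported along star-isomorphisms. *)
Lemma iso_cuntz_pair (T I : gcstar R G) : gcstar_iso T I ->
  (exists V1 V2 : mult T, cuntz_pair V1 V2) -> exists V1 V2 : mult I, cuntz_pair V1 V2.
Proof.
move=> [f [g [[fh fe _] [gh ge _] fK gK]]] [V1 [V2 [[i1 i2] inv sum]]].
have [_ fM fA] := fh; have [_ gM gA] := gh.
have tauP (m : mult T) a b : a ** f (lmult m (g b)) = f (rmult m (g a)) ** b.
  by rewrite -{1}(gK a) -fM multP fM gK.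
pose tau (m : mult T) : mult I := Mult (tauP m).
have tauM m n : tau (m ** n) = tau m ** tau n.
  by apply: mult_lext => x /=; rewrite fK.
have tauA m : tau (adj m) = adj (tau m).
  by apply: mult_lext => x /=; rewrite gA fA.
have tauD m n : tau (m + n) = tau m + tau n.
  by apply: mult_lext => x; exact: star_homD.
have tau1 : tau (mone T) = mone I by apply: mult_lext => x /=; exact: gK.
have tauG h m : gmult h (tau m) = tau (gmult h m).
  by apply: mult_lext => x /=; rewrite ge fe.
exists (tau V1), (tau V2); split=> [|h|].
- by rewrite -!tauA -!tauM i1 i2 tau1.
- by have [h1 h2] := inv h; rewrite !tauG h1 h2.
- by rewrite -!tauA -!tauM -tauD sum tau1.
Qed.

Lemma stable_cuntz_pair (I : gcstar R G) : stable I ->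
  exists V1 V2 : mult I, cuntz_pair V1 V2.
Proof.
move=> [H [T [t [sH iH ct TI]]]]; apply: iso_cuntz_pair TI _.
exact: compact_tensor_cuntz_pair sH iH ct.
Qed.

Lemma inv_isometries_exist (J : csi R G) : exists V1 V2 : mult J, inv_isometries V1 V2.
Proof.
have [V1 [V2 [[i1 i2] inv sum]]] := stable_cuntz_pair (csi_stable J).
by exists V1, V2; split=> // g; have [] := inv g.
Qed.

End InvariantIsometries.

(** * Star-homomorphisms and quotients *)

Section StarSums.
Variables (C : numClosedFieldType) (B : starAlgType C).
Implicit Types x y : B.

Lemma smul_suml n (f : 'I_n -> B) y : (\sum_(i < n) f i) ** y = \sum_(i < n) f i ** y.
Proof. by elim/big_rec2: _ => [|i a b _ <-]; [exact: smul0r|exact: smulDl]. Qed.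

Lemma smul_sumr n (f : 'I_n -> B) y : y ** (\sum_(i < n) f i) = \sum_(i < n) y ** f i.
Proof. by elim/big_rec2: _ => [|i a b _ <-]; [exact: smulr0|exact: smulDr]. Qed.

Lemma adj_sum n (f : 'I_n -> B) : adj (\sum_(i < n) f i) = \sum_(i < n) adj (f i).
Proof. by elim/big_rec2: _ => [|i a b _ <-]; [exact: adj0|exact: adjD]. Qed.

Lemma star_hom_sum (D : starAlgType C) (f : B -> D) n (x : 'I_n -> B) :
  f 0 = 0 -> {morph f : x y / x + y} ->
  f (\sum_(i < n) x i) = \sum_(i < n) f (x i).
Proof. by move=> f0 fD; apply: (big_morph f fD f0). Qed.

End StarSums.

Section QuotientHom.
Variables (C : numClosedFieldType) (B : starAlgType C) (S : star_ideal B).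

Lemma piqM x y : piq S x ** piq S y = piq S (x ** y). Proof. exact: quot_mulE. Qed.
Lemma piq_adj x : adj (piq S x) = piq S (adj x). Proof. exact: quot_adjE. Qed.

Lemma piq_surj (X : quot S) : exists x, X = piq S x.
Proof. by exists (repq X); rewrite repqK. Qed.

Lemma piq_hom : star_hom (piq S).
Proof. by split=> [c x y|x y|x]; rewrite ?piqZ ?piqD ?piqM ?piq_adj. Qed.

End QuotientHom.

Section QuotientMaps.
Variables (C : numClosedFieldType) (B B' : starAlgType C).
Variables (S : star_ideal B) (S' : star_ideal B').

Lemma qmapE (f : B -> B') : {morph f : x y / x - y} -> (forall x, S x -> S' (f x)) ->
  forall x, qmap (S' := S') f (piq S x) = piq S' (f x).
Proof. by move=> fB fS x; apply/piqP; rewrite -fB; apply/fS/repq_piq. Qed.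

Lemma qmap_hom (f : B -> B') : star_hom f -> (forall x, S x -> S' (f x)) ->
  star_hom (qmap f : quot S -> quot S').
Proof.
move=> fh fS; have fE := qmapE (star_homB fh) fS; have [fl fM fA] := fh.
split=> [c X Y|X Y|X]; have [x ->] := piq_surj X; last by rewrite piq_adj !fE piq_adj fA.
  by have [y ->] := piq_surj Y; rewrite piqZ piqD !fE fl -piqD -piqZ.
by have [y ->] := piq_surj Y; rewrite piqM !fE piqM fM.
Qed.

End QuotientMaps.

Section EquivariantQuotient.
Variables (R : realType) (G : topGroupType).

Lemma gmult_hom (I : gcstar R G) g : star_hom (@gmult R G I g).
Proof.
have [_ _ gA] := gact_hom I g; have gh := gact_hom I g.
split=> [c m n|m n|m]; apply: mult_lext => x /=.
- by rewrite star_homD// star_homZ.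
- by rewrite -gactM mulVg gact1.
- by have [_ _ ->] := gact_hom I g^-1%g; rewrite gA.
Qed.

Lemma gmult_membed (I : gcstar R G) g (i : I) : gmult g (membed i) = membed (gact g i).
Proof.
have [_ gM _] := gact_hom I g; apply: mult_lext => x /=.
by rewrite gM -gactM mulgV gact1.
Qed.

Lemma gmult1 (I : gcstar R G) g : gmult g (mone I) = mone I.
Proof. by apply: mult_lext => x /=; rewrite -gactM mulgV gact1. Qed.

Variable J : csi R G.
Implicit Types (m : mult J) (x y : calg J).

Lemma qJ_hom : star_hom (@qJ _ _ J). Proof. exact: piq_hom. Qed.

Lemma qJ_surj x : exists m, x = qJ m.
Proof. exact: piq_surj. Qed.

Definition cone : calg J := qJ (mone J).

Lemma smul1c x : cone ** x = x.
Proof. by have [m ->] := qJ_surj x; rewrite piqM smul1. Qed.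
Lemma smulc1 x : x ** cone = x.
Proof. by have [m ->] := qJ_surj x; rewrite piqM smone. Qed.

Lemma gcalgebraE g m : gcalgebra g (qJ m) = qJ (gmult g m).
Proof.
apply: qmapE => [|_ [j Jj <-]]; first exact/star_homB/gmult_hom.
by rewrite gmult_membed; exists (gact g j) => //; exact: cga_invariant.
Qed.

Lemma gcalgebra_hom g : star_hom (@gcalgebra _ _ J g).
Proof.
apply: qmap_hom => [|_ [j Jj <-]]; first exact: gmult_hom.
by rewrite gmult_membed; exists (gact g j) => //; exact: cga_invariant.
Qed.

Lemma to_coronaE m : to_corona (qJ m) = piq _ m :> corona J.
Proof. by apply: qmapE => // _ [j Jj <-]; exists j. Qed.

Lemma to_corona_hom : star_hom (@to_corona _ _ J).
Proof. by apply: qmap_hom => // _ [j Jj <-]; exists j. Qed.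

End EquivariantQuotient.

Section ExtensionMaps.
Variables (R : realType) (G : topGroupType) (J J' : csi R G) (psi : csi_mor J J').

Lemma csi_ext_ideal m : mideal (@csi_ideal _ _ J) m ->
  mideal (@csi_ideal _ _ J') (csi_ext psi m).
Proof.
move=> [j Jj <-]; exists (subalg_val (csi_fun psi (exist _ j Jj))).
  exact: svalP.
by rewrite -csi_extE.
Qed.

Lemma q_morE m : q_mor psi (qJ m) = qJ (csi_ext psi m).
Proof. by apply: qmapE csi_ext_ideal _; exact/star_homB/csi_ext_hom. Qed.

Lemma q_mor_hom : star_hom (q_mor psi).
Proof. exact: qmap_hom (csi_ext_hom psi) csi_ext_ideal. Qed.

Lemma q_mor_equiv g x : q_mor psi (gcalgebra g x) = gcalgebra g (q_mor psi x).
Proof.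
by have [m ->] := qJ_surj x; rewrite gcalgebraE !q_morE gcalgebraE csi_ext_equiv.
Qed.

Lemma mult_bnd_membed (I : cstarAlgType R[i]) (i : I) : mult_bnd (membed i) (rnorm i).
Proof. by move=> x /=; exact: rnorm_smul. Qed.

(** The extension of [psi] maps the ideal [J] into [J'] by definition; that it
    maps the closure of [J] into that of [J'] is a consequence of its automatic
    continuity. *)
Lemma csi_ext_full m : mideal (@full_ideal _ J) m ->
  mideal (@full_ideal _ J') (csi_ext psi m).
Proof.
move=> [i _ <-]; have eh := csi_ext_hom psi.
have [u0 Ju0 ui] := rdense_seq i (dense_rdense (@cga_dense _ _ J)).
pose u n : carrier J := exist _ (u0 n) (Ju0 n).
have [c psic] := cga_fun_bounded psi.
have [psil _ _] := cga_fun_hom psi.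
have [i' u'i] : exists i', rcvg (fun n => subalg_val (csi_fun psi (u n))) i'.
  apply/rcauchy_cvg/(rcauchy_dominated (k := c) _ (rcvg_rcauchy ui)) => n1 n2.
  rewrite (_ : subalg_val _ - subalg_val _ = subalg_val (csi_fun psi (u n2 - u n1))).
    exact: psic.
  by rewrite (star_homB (cga_fun_hom psi)).
exists i' => //; apply: mult_lext => x.
apply: rcvg_unique (rcvg_smull x u'i) _.
have eE n : subalg_val (csi_fun psi (u n)) ** x =
  lmult (csi_ext psi (membed (u0 n))) x by rewrite (csi_extE psi (u n)).
under eq_fun do rewrite eE.
apply: (@rcvg_dominated _ _ _ u0 i _ _ (2 * rnorm x)) ui => n.
rewrite -lmultNE -lmultDE -star_homB//.
rewrite -(star_homB (@membed_hom _ J)) mulrAC.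
apply: star_hom_mult_bnd => //; first exact: rnorm_ge0.
exact: mult_bnd_membed.
Qed.

End ExtensionMaps.

(** * Boundedness of maps into multiplier and corona algebras *)

Section CstarBounded.
Variables (R : realType) (G : topGroupType) (A : cga R G).

Lemma cstar_bounded_pos (V : lmodType R[i]) (N : V -> \bar R) (f : carrier A -> V) :
  cstar_bounded N f -> exists (T : A -> V) (c : R),
    [/\ linear T, 0 <= c, forall a, (N (T a) <= (c * rnorm a)%:E)%E
      & forall a, f a = T (subalg_val a)].
Proof.
move=> [T [Tl [c Tc] Tf]]; exists T, `|c|; split=> // a.
apply: le_trans (Tc a) _; rewrite lee_fin.
by apply: ler_wpM2r; [exact: rnorm_ge0|exact: ler_norm].
Qed.

Lemma cstar_bounded_map (V W : lmodType R[i]) (N : V -> \bar R) (N' : W -> \bar R)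
    (f : carrier A -> V) (F : V -> W) (k : R) : linear F ->
  (forall x (c : R), 0 <= c -> (N x <= c%:E)%E -> (N' (F x) <= (k * c)%:E)%E) ->
  cstar_bounded N f -> cstar_bounded N' (F \o f).
Proof.
move=> Fl Fk /cstar_bounded_pos[T [c [Tl c0 Tc Tf]]]; exists (F \o T); split.
- by move=> a x y /=; rewrite Tl Fl.
- exists (k * c) => a; rewrite -mulrA /=; apply: Fk => //.
  by rewrite mulr_ge0// rnorm_ge0.
- by move=> a /=; rewrite Tf.
Qed.

Lemma cstar_boundedD (V : lmodType R[i]) (N : V -> \bar R) (f g : carrier A -> V) :
  (forall x y (c d : R), 0 <= c -> 0 <= d -> (N x <= c%:E)%E -> (N y <= d%:E)%E ->
    (N (x + y)%R <= (c + d)%:E)%E) ->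
  cstar_bounded N f -> cstar_bounded N g -> cstar_bounded N (fun a => f a + g a).
Proof.
move=> ND /cstar_bounded_pos[T [c [Tl c0 Tc Tf]]] /cstar_bounded_pos[S [d [Sl d0 Sd Sg]]].
exists (fun a => T a + S a); split.
- by move=> a x y; rewrite Tl Sl scalerDr addrACA.
- exists (c + d) => a; rewrite mulrDl.
  by apply: ND => //; rewrite mulr_ge0// rnorm_ge0.
- by move=> a; rewrite Tf Sg.
Qed.

Lemma cstar_bounded0 (V : lmodType R[i]) (N : V -> \bar R) :
  (N 0%R <= 0)%E -> cstar_bounded N (fun _ : carrier A => 0 : V).
Proof.
move=> N0; exists (fun=> 0); split=> //.
- by move=> a x y; rewrite scaler0 addr0.
- by exists 0 => a; rewrite mul0r.
Qed.

Lemma mult_normD (I : cstarAlgType R[i]) (m n : mult I) (c d : R) :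
  0 <= c -> 0 <= d -> (mult_norm m <= c%:E)%E -> (mult_norm n <= d%:E)%E ->
  (mult_norm (m + n)%R <= (c + d)%:E)%E.
Proof.
move=> c0 d0 /mult_normP mc /mult_normP nd.
by apply/mult_normP; [exact: addr_ge0|apply: mult_bndD; [exact: mc|exact: nd]].
Qed.

End CstarBounded.

Section Precomposition.
Variables (R : realType) (G : topGroupType) (A A' : cga R G) (phi : cga_mor A A').

Lemma cga_mor_extension : exists (T : A -> A') (c : R),
  [/\ linear T, 0 <= c, forall a, rnorm (T a) <= c * rnorm a
    & forall a : carrier A, subalg_val (phi a) = T (subalg_val a)].
Proof.
have [c phic] := cga_fun_bounded phi.
have ph := cga_fun_hom phi.
(* Off the dense subalgebra [f] takes the default value [0]. *)
have /choice[f fE] x : exists y, forall Sx : cga_sub A x,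
    y = subalg_val (phi (exist _ x Sx)).
  have [Sx|nSx] := pselect (cga_sub A x); last by exists 0 => Sx; case: nSx.
  exists (subalg_val (phi (exist _ x Sx))) => Sx'.
  by rewrite (Prop_irrelevance Sx Sx').
have [||||T [Tl Tb TE]] :=
    @bounded_extension _ _ _ (cga_sub A) f `|c| _ (dense_rdense (@cga_dense _ _ A)).
- by move=> a x y Sx Sy; apply: subalgD => //; exact: subalgZ.
- move=> a x y Sx Sy; have Sxy := subalgD (subalgZ a Sx) Sy.
  rewrite (fE _ Sx) (fE _ Sy) (fE _ Sxy).
  rewrite (_ : exist _ _ Sxy = a *: (exist _ x Sx : carrier A) + exist _ y Sy).
    by have [pl _ _] := ph; rewrite pl.
  exact: subalg_val_inj.
- move=> x Sx; rewrite (fE _ Sx); apply: le_trans (phic _) _.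
  by apply: ler_wpM2r; [exact: rnorm_ge0|exact: ler_norm].
- exact: normr_ge0.
exists T, `|c|; split=> // -[x Sx]; by rewrite (TE x Sx) (fE x Sx).
Qed.

Lemma cstar_bounded_precomp (V : lmodType R[i]) (N : V -> \bar R) (f : carrier A' -> V) :
  cstar_bounded N f -> cstar_bounded N (f \o phi).
Proof.
move=> /cstar_bounded_pos[T [c [Tl c0 Tc Tf]]].
have [P [d [Pl d0 Pd PE]]] := cga_mor_extension.
exists (T \o P); split=> [a x y|| a] /=; first by rewrite Pl Tl.
  exists (c * d) => a; apply: le_trans (Tc _) _; rewrite lee_fin -mulrA.
  exact: ler_wpM2l.
by rewrite Tf PE.
Qed.

End Precomposition.

(** * Families of isometries with complementary ranges *)

Section OrthonormalFamilies.
Variables (C : numClosedFieldType) (B : starAlgType C) (one : B).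
Hypotheses (one_l : forall x, one ** x = x) (one_r : forall x, x ** one = x).

Definition fam_orth n (X : 'I_n -> B) : Prop :=
  forall i j, adj (X i) ** X j = if i == j then one else 0.

(** All conjugation formulas for sums reduce to this cancellation of the
    isometries in the middle. *)
Lemma fam_mul n (Y : 'I_n -> B) (x z : 'I_n -> B) : fam_orth Y ->
  (\sum_(i < n) x i ** adj (Y i)) ** (\sum_(i < n) Y i ** z i) =
  \sum_(i < n) x i ** z i.
Proof.
move=> Yo; rewrite smul_suml; apply: eq_bigr => i _; rewrite smul_sumr.
rewrite (bigD1 i)//= big1 => [|j ji].
  by rewrite addr0 smulA -[_ ** _ ** Y i]smulA Yo eqxx one_r.
by rewrite smulA -[_ ** _ ** Y j]smulA Yo eq_sym (negbTE ji) smulr0 smul0r.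
Qed.

(** Conjugation of a block-diagonal family by the row [X]. *)
Lemma fam_diag_hom n (X : 'I_n -> B) (D : starAlgType C) (b : 'I_n -> D -> B) :
  fam_orth X -> (forall i, star_hom (b i)) ->
  star_hom (fun a => \sum_(i < n) X i ** b i a ** adj (X i)).
Proof.
move=> Xo bh; split=> [c x y|x y|x].
- rewrite scaler_sumr -big_split /=; apply: eq_bigr => i _.
  by have [-> _ _] := bh i; rewrite smulDr smulDl smulZr smulZl.
- under [X in _ = _ ** X]eq_bigr do rewrite -smulA.
  rewrite fam_mul//; apply: eq_bigr => i _.
  by rewrite (star_homM (bh i)) !smulA.
- rewrite adj_sum; apply: eq_bigr => i _.
  by rewrite !adjM adjK (star_hom_adj (bh i)) smulA.
Qed.

(** Compressing [V1 V1^* + V2 V2^* = 1] by [V1^*] and [V2] gives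
    [x + x = x] for [x = V1^* V2]. *)
Lemma cuntz_orth (V1 V2 : B) : adj V1 ** V1 = one -> adj V2 ** V2 = one ->
  V1 ** adj V1 + V2 ** adj V2 = one -> adj V1 ** V2 = 0.
Proof.
move=> h1 h2 h; apply: (addIr (adj V1 ** V2)); rewrite add0r.
have : adj V1 ** (V1 ** adj V1 + V2 ** adj V2) ** V2 = adj V1 ** V2.
  by rewrite h one_r.
by rewrite smulDr smulDl !smulA h1 one_l -[adj V1 ** V2 ** _ ** _]smulA h2 one_r.
Qed.

(** Row operators [w1 z1* + w2 z2*] also intertwine sums when [z1], [z2] are
    only partial isometries, with a common initial projection [p] that acts as
    a unit on the summands. *)
Lemma partial_row_conj (w1 w2 z1 z2 x1 x2 p v : B) :
  adj z1 ** z1 = p -> adj z2 ** z2 = p -> adj z1 ** z2 = 0 ->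
  p ** x1 = x1 -> x1 ** p = x1 -> p ** x2 = x2 -> x2 ** p = x2 ->
  v = w1 ** adj z1 + w2 ** adj z2 ->
  v ** (z1 ** x1 ** adj z1 + z2 ** x2 ** adj z2) ** adj v =
  w1 ** x1 ** adj w1 + w2 ** x2 ** adj w2.
Proof.
move=> z11 z22 z12 px1 x1p px2 x2p vE.
have z21 : adj z2 ** z1 = 0 by rewrite -[adj z2 ** z1]adjK adjM adjK z12 adj0.
have pa : adj p = p by rewrite -z11 adjM adjK.
have vz1 : v ** z1 = w1 ** p by rewrite vE smulDl -!smulA z11 z21 smulr0 addr0.
have vz2 : v ** z2 = w2 ** p by rewrite vE smulDl -!smulA z22 z12 smulr0 add0r.
rewrite smulDr smulDl !smulA vz1 vz2; congr (_ + _).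
  by rewrite -[_ ** adj z1 ** _]smulA -adjM vz1 adjM pa -(smulA w1) px1 smulA
    -(smulA w1) x1p.
by rewrite -[_ ** adj z2 ** _]smulA -adjM vz2 adjM pa -(smulA w2) px2 smulA
  -(smulA w2) x2p.
Qed.

End OrthonormalFamilies.

Definition pairf (T : Type) (x y : T) (i : 'I_2) : T := if i == ord0 then x else y.
Definition triplef (T : Type) (x y z : T) (i : 'I_3) : T := nth x [:: x; y; z] i.

Lemma sum_pairf (V : nmodType) (f : 'I_2 -> V) : \sum_(i < 2) f i = f ord0 + f ord_max.
Proof. by rewrite big_ord_recl big_ord1; congr (_ + f _); apply: val_inj. Qed.

Lemma sum_triplef (V : nmodType) (f : 'I_3 -> V) :
  \sum_(i < 3) f i = f ord0 + f (inord 1) + f ord_max.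
Proof.
rewrite !big_ord_recl big_ord0 addr0 addrA; congr (_ + f _ + f _); apply: val_inj => //=.
by rewrite inordK.
Qed.

(** * Strong equivalence of sums of Busby mappings *)

Section StrongEquivalence.
Variables (R : realType) (G : topGroupType) (A : cga R G) (J : csi R G).
Implicit Types (b : carrier A -> calg J) (u v V W : mult J).
Local Notation o := (mone J).

Lemma qJM m n : qJ (m ** n) = qJ m ** qJ n :> calg J.
Proof. by rewrite (star_homM (qJ_hom J)). Qed.
Lemma qJD m n : qJ (m + n) = qJ m + qJ n :> calg J.
Proof. by rewrite (star_homD (qJ_hom J)). Qed.
Lemma qJA m : qJ (adj m) = adj (qJ m) :> calg J.
Proof. by rewrite (star_hom_adj (qJ_hom J)). Qed.
Lemma qJ_sum n (x : 'I_n -> mult J) :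
  qJ (\sum_(i < n) x i) = \sum_(i < n) qJ (x i) :> calg J.
Proof. exact: star_hom_sum (star_hom0 (qJ_hom J)) (star_homD (qJ_hom J)). Qed.

Definition almost_inv u : Prop := forall g, gcalgebra g (qJ u) = qJ u.

Lemma almost_invM u v : almost_inv u -> almost_inv v -> almost_inv (u ** v).
Proof.
by move=> hu hv g; rewrite qJM (star_homM (gcalgebra_hom J g)) hu hv.
Qed.
Lemma almost_invD u v : almost_inv u -> almost_inv v -> almost_inv (u + v).
Proof.
by move=> hu hv g; rewrite qJD (star_homD (gcalgebra_hom J g)) hu hv.
Qed.
Lemma almost_inv_adj u : almost_inv u -> almost_inv (adj u).
Proof. by move=> hu g; rewrite qJA (star_hom_adj (gcalgebra_hom J g)) hu. Qed.
Lemma almost_inv_invariant u : (forall g, gmult g u = u) -> almost_inv u.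
Proof. by move=> hu g; rewrite gcalgebraE hu. Qed.
Lemma almost_inv1 : almost_inv o.
Proof. by apply: almost_inv_invariant => g; exact: gmult1. Qed.
Lemma almost_invN u : almost_inv u -> almost_inv (- u).
Proof.
by move=> hu g; rewrite (star_homN (qJ_hom J)) (star_homN (gcalgebra_hom J g)) hu.
Qed.
Lemma almost_inv_sum n (x : 'I_n -> mult J) :
  (forall i, almost_inv (x i)) -> almost_inv (\sum_(i < n) x i).
Proof.
move=> hx; elim/big_ind: _ => //; last exact: almost_invD.
by move=> g; rewrite (star_hom0 (qJ_hom J)) (star_hom0 (gcalgebra_hom J g)).
Qed.

(** Invariance is required modulo the ideal only, as for the unitaries of strong
    equivalence: the family built in [partial_isometry_stably_equiv] below is
    not strictly invariant. *)
Record iso_family n (X : 'I_n -> mult J) : Prop := IsoFamily {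
  isofam_orth : fam_orth o X;
  isofam_sum : \sum_(i < n) X i ** adj (X i) = o;
  isofam_inv : forall i, almost_inv (X i)
}.

Lemma isofam_qorth n (X : 'I_n -> mult J) : iso_family X ->
  fam_orth (cone J) (fun i => qJ (X i)).
Proof.
move=> Xf i j; rewrite -qJA -qJM (isofam_orth Xf).
by case: eqP => // _; exact: star_hom0 (qJ_hom J).
Qed.

Definition fam_sum n (X : 'I_n -> mult J) (b : 'I_n -> carrier A -> calg J) :=
  fun a => \sum_(i < n) qJ (X i) ** b i a ** adj (qJ (X i)).

Let one_l : forall x : mult J, o ** x = x := @smul1 _ J.
Let one_r : forall x : mult J, x ** o = x := @smone _ J.

(** If the unitaries [u i] implement the given equivalences, then
    [w = sum_i Y i u i (X i)^*] implements the equivalence of the sums. *)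
Lemma fam_sum_equiv n (X Y : 'I_n -> mult J) (b b' : 'I_n -> carrier A -> calg J) :
  iso_family X -> iso_family Y -> (forall i, strongly_equiv (b i) (b' i)) ->
  strongly_equiv (fam_sum X b) (fam_sum Y b').
Proof.
move=> Xf Yf bb'.
have /choice[u uE] i : exists u, almost_inv_unitary u /\
    forall a, b' i a = qJ u ** b i a ** adj (qJ u) by have [u hu uE] := bb' i; exists u.
pose w := \sum_(i < n) (Y i ** u i) ** adj (X i).
have wa : adj w = \sum_(i < n) (X i ** adj (u i)) ** adj (Y i).
  by rewrite /w adj_sum; apply: eq_bigr => i _; rewrite !adjM adjK smulA.
have w1 : adj w ** w = o.
  rewrite wa /w; under [X in _ ** X]eq_bigr do rewrite -smulA.
  rewrite (fam_mul one_r _ _ (isofam_orth Yf)) -(isofam_sum Xf).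
  apply: eq_bigr => i _; have [[[ui _] _] _] := uE i.
  by rewrite smulA -[_ ** _ ** u i]smulA ui one_r.
have w2 : w ** adj w = o.
  rewrite wa /w; under [X in _ ** X]eq_bigr do rewrite -smulA.
  rewrite (fam_mul one_r _ _ (isofam_orth Xf)) -(isofam_sum Yf).
  apply: eq_bigr => i _; have [[[_ ui] _] _] := uE i.
  by rewrite smulA -[_ ** _ ** adj (u i)]smulA ui one_r.
exists w => [|a].
  split=> //; apply: almost_inv_sum => i; have [[_ ui] _] := uE i.
  apply: almost_invM; last exact/almost_inv_adj/(isofam_inv Xf).
  by apply: almost_invM => //; exact: (isofam_inv Yf).
have qw : qJ w = \sum_(i < n) (qJ (Y i) ** qJ (u i)) ** adj (qJ (X i)).
  by rewrite qJ_sum; apply: eq_bigr => i _; rewrite !qJM qJA.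
have qwa : adj (qJ w) = \sum_(i < n) qJ (X i) ** (adj (qJ (u i)) ** adj (qJ (Y i))).
  by rewrite qw adj_sum; apply: eq_bigr => i _; rewrite !adjM adjK.
have Xo := isofam_qorth Xf; have c1 := @smulc1 _ _ J.
rewrite qwa qw /fam_sum; under [X in _ ** X ** _]eq_bigr do rewrite -smulA.
rewrite (fam_mul c1 _ _ Xo); under [X in X ** _]eq_bigr do rewrite smulA.
rewrite (fam_mul c1 _ _ Xo); apply: eq_bigr => i _.
by have [_ ->] := uE i; rewrite !smulA.
Qed.

Lemma almost_inv_unitary1 : almost_inv_unitary o.
Proof. by split; [rewrite /unitary adj_mone smone|exact: almost_inv1]. Qed.

Lemma strongly_equiv_refl b : strongly_equiv b b.
Proof.
exists o => [|a]; first exact: almost_inv_unitary1.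
by rewrite -qJA adj_mone [_ ** _]smulc1 [_ ** _]smul1c.
Qed.

Lemma strongly_equiv_sym b b' : strongly_equiv b b' -> strongly_equiv b' b.
Proof.
move=> [u [[u1 u2] ui] ub]; exists (adj u) => [|a].
  by split; [rewrite /unitary adjK|exact: almost_inv_adj].
have h : adj (qJ u) ** qJ u = cone J by rewrite -qJA -qJM u1.
by rewrite ub qJA adjK !smulA h smul1c -smulA h smulc1.
Qed.

Lemma strongly_equiv_trans b b' b'' :
  strongly_equiv b b' -> strongly_equiv b' b'' -> strongly_equiv b b''.
Proof.
move=> [u [[u1 u2] ui] ub] [v [[v1 v2] vi] vb]; exists (v ** u) => [|a].
  split; last exact: almost_invM.
  split; rewrite adjM !smulA.
    by rewrite -[adj u ** _ ** _]smulA v1 one_r.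
  by rewrite -[v ** _ ** _]smulA u2 one_r.
by rewrite vb ub qJM adjM !smulA.
Qed.

Lemma iso_pair V W : adj V ** V = o -> adj W ** W = o ->
  V ** adj V + W ** adj W = o -> almost_inv V -> almost_inv W ->
  iso_family (pairf V W).
Proof.
move=> v w s vi wi; have vw : adj V ** W = 0 by apply: (cuntz_orth one_l one_r).
have wv : adj W ** V = 0 by rewrite -[adj W ** V]adjK adjM adjK vw adj0.
split=> [i j||i]; last by rewrite /pairf; case: ifP.
  by case: i => [[|[|//]] ?]; case: j => [[|[|//]] ?].
by rewrite sum_pairf.
Qed.

Lemma iso_triple X Y Z : adj X ** X = o -> adj Y ** Y = o -> adj Z ** Z = o ->
  adj X ** Y = 0 -> adj X ** Z = 0 -> adj Y ** Z = 0 ->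
  X ** adj X + Y ** adj Y + Z ** adj Z = o ->
  almost_inv X -> almost_inv Y -> almost_inv Z -> iso_family (triplef X Y Z).
Proof.
move=> x y z xy xz yz s xi yi zi.
have yx : adj Y ** X = 0 by rewrite -[adj Y ** X]adjK adjM adjK xy adj0.
have zx : adj Z ** X = 0 by rewrite -[adj Z ** X]adjK adjM adjK xz adj0.
have zy : adj Z ** Y = 0 by rewrite -[adj Z ** Y]adjK adjM adjK yz adj0.
split=> [i j||i]; last by case: i => [[|[|[|//]]] ?].
  by case: i => [[|[|[|//]]] ?]; case: j => [[|[|[|//]]] ?].
by rewrite sum_triplef /triplef /= inordK.
Qed.

Lemma inv_isometries_family V1 V2 : inv_isometries V1 V2 -> iso_family (pairf V1 V2).
Proof. by case=> ? ? ? ? ?; apply: iso_pair => //; exact: almost_inv_invariant. Qed.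

Lemma busby_sumE V1 V2 b1 b2 :
  busby_sum V1 V2 b1 b2 = fam_sum (pairf V1 V2) (pairf b1 b2).
Proof. by apply/funext => a; rewrite /fam_sum sum_pairf. Qed.

Lemma busby_sum_equiv V1 V2 W1 W2 b1 b2 b1' b2' :
  iso_family (pairf V1 V2) -> iso_family (pairf W1 W2) ->
  strongly_equiv b1 b1' -> strongly_equiv b2 b2' ->
  strongly_equiv (busby_sum V1 V2 b1 b2) (busby_sum W1 W2 b1' b2').
Proof.
move=> Vf Wf h1 h2; rewrite !busby_sumE; apply: fam_sum_equiv => // i.
by rewrite /pairf; case: ifP.
Qed.

Lemma iso_pairC V W : iso_family (pairf V W) -> iso_family (pairf W V).
Proof.
move=> Vf; have vo := isofam_orth Vf.
apply: iso_pair.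
- exact: (vo ord_max ord_max).
- exact: (vo ord0 ord0).
- by have := isofam_sum Vf; rewrite sum_pairf /= addrC.
- exact: (isofam_inv Vf ord_max).
- exact: (isofam_inv Vf ord0).
Qed.

Lemma busby_sumC V1 V2 b1 b2 : iso_family (pairf V1 V2) ->
  strongly_equiv (busby_sum V1 V2 b1 b2) (busby_sum V1 V2 b2 b1).
Proof.
move=> Vf; rewrite (_ : busby_sum V1 V2 b1 b2 = busby_sum V2 V1 b2 b1).
  by apply: busby_sum_equiv (iso_pairC Vf) Vf _ _; exact: strongly_equiv_refl.
by apply/funext => a; rewrite /busby_sum addrC.
Qed.

(** Both sides are sums along families of three isometries, [V1], [V2 V1],
    [V2 V2] and [V1 V1], [V1 V2], [V2]. *)
Lemma busby_sumA V1 V2 b1 b2 b3 : iso_family (pairf V1 V2) ->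
  strongly_equiv (busby_sum V1 V2 b1 (busby_sum V1 V2 b2 b3))
                 (busby_sum V1 V2 (busby_sum V1 V2 b1 b2) b3).
Proof.
move=> Vf; have vo := isofam_orth Vf.
have v11 : adj V1 ** V1 = o := vo ord0 ord0.
have v22 : adj V2 ** V2 = o := vo ord_max ord_max.
have v12 : adj V1 ** V2 = 0 := vo ord0 ord_max.
have v21 : adj V2 ** V1 = 0 := vo ord_max ord0.
have sV : V1 ** adj V1 + V2 ** adj V2 = o by have := isofam_sum Vf; rewrite sum_pairf.
have vi1 : almost_inv V1 := isofam_inv Vf ord0.
have vi2 : almost_inv V2 := isofam_inv Vf ord_max.
have m11 x : x ** adj V1 ** V1 = x by rewrite -smulA v11 one_r.
have m22 x : x ** adj V2 ** V2 = x by rewrite -smulA v22 one_r.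
have m12 x : x ** adj V1 ** V2 = 0 by rewrite -smulA v12 smulr0.
have m21 x : x ** adj V2 ** V1 = 0 by rewrite -smulA v21 smulr0.
have mV x y : x ** V1 ** adj V1 ** y + x ** V2 ** adj V2 ** y = x ** y.
  by rewrite -smulDl -!(smulA x) -smulDr sV one_r.
have f1 : iso_family (triplef V1 (V2 ** V1) (V2 ** V2)).
  apply: iso_triple; rewrite ?adjM ?smulA ?v12 ?m22 ?m12 ?smul0r//.
  - by rewrite -addrA mV.
  - exact: almost_invM.
  - exact: almost_invM.
have f2 : iso_family (triplef (V1 ** V1) (V1 ** V2) V2).
  apply: iso_triple; rewrite ?adjM ?smulA ?m11 ?m12 ?v12 ?smul0r//.
  - by rewrite mV.
  - exact: almost_invM.
  - exact: almost_invM.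
have e := fam_sum_equiv f1 f2 (fun i => strongly_equiv_refl (triplef b1 b2 b3 i)).
have E1 : busby_sum V1 V2 b1 (busby_sum V1 V2 b2 b3) =
    fam_sum (triplef V1 (V2 ** V1) (V2 ** V2)) (triplef b1 b2 b3).
  apply/funext => a; rewrite /fam_sum sum_triplef /triplef /= inordK//=.
  by rewrite /busby_sum !qJM !adjM smulDr smulDl !smulA addrA.
have E2 : busby_sum V1 V2 (busby_sum V1 V2 b1 b2) b3 =
    fam_sum (triplef (V1 ** V1) (V1 ** V2) V2) (triplef b1 b2 b3).
  apply/funext => a; rewrite /fam_sum sum_triplef /triplef /= inordK//=.
  by rewrite /busby_sum !qJM !adjM smulDr smulDl !smulA.
by rewrite E1 E2.
Qed.

End StrongEquivalence.

(** * Sums and images of bounded and of trivial Busby mappings *)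

Section CoronaProjection.
Variables (R : realType) (I : cstarAlgType R[i]).

(** The projection [M(I) -> M(I)/I], at the type carrying the corona norm. *)
Definition qcor (m : mult I) : corona I := piq _ m.

Lemma qcor_hom : star_hom qcor. Proof. exact: piq_hom. Qed.

End CoronaProjection.

Section BusbyClosure.
Variables (R : realType) (G : topGroupType) (A : cga R G) (J : csi R G).
Implicit Types (b t : carrier A -> calg J) (V W : mult J).

Lemma isometry_bnd V : adj V ** V = mone J -> mult_bnd V 1.
Proof. by apply: mult_bnd_pisom; rewrite adj_mone smone. Qed.

Lemma conj_linear (C : numClosedFieldType) (B : starAlgType C) (x y : B) :
  linear (fun z => x ** z ** y).
Proof. by move=> c z z'; rewrite smulDr smulDl smulZr smulZl. Qed.

Lemma conj_mult_bnd V m (c : R) :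
  mult_bnd V 1 -> 0 <= c -> mult_bnd m c -> mult_bnd (V ** m ** adj V) (1 * c).
Proof.
move=> V1 c0 mc; rewrite -[1 * c]mulr1.
apply: mult_bndM; [by rewrite mulr_ge0|exact: mult_bndM|exact: mult_bnd_adj].
Qed.

Lemma mult_norm_conj V m (c : R) : mult_bnd V 1 -> 0 <= c ->
  (mult_norm m <= c%:E)%E -> (mult_norm (V ** m ** adj V) <= (1 * c)%:E)%E.
Proof.
move=> V1 c0 /mult_normP mc; apply/mult_normP; first by rewrite mul1r.
by apply: conj_mult_bnd => //; exact: mc.
Qed.

Lemma corona_norm_conj V (X : corona J) (c : R) : mult_bnd V 1 -> 0 <= c ->
  (corona_norm X <= c%:E)%E ->
  (corona_norm (qcor V ** X ** adj (qcor V))%R <= (1 * c)%:E)%E.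
Proof.
move=> V1; apply: (@corona_norm_map _ _ _ (fun m => V ** m ** adj V)
  (fun Y : corona J => qcor V ** Y ** adj (qcor V))) => // [m|m d d0 md].
  have qh := qcor_hom J; rewrite -![piq _ _]/(qcor _).
  by rewrite !(star_homM qh) (star_hom_adj qh).
exact: conj_mult_bnd.
Qed.

Lemma trivial_busby0 : trivial_busby (fun _ : carrier A => 0 : calg J).
Proof.
exists (fun=> 0); split.
- by split=> [c x y|x y|x]; rewrite ?scaler0 ?addr0 ?smul0r ?adj0.
- by move=> g a; rewrite (star_hom0 (gmult_hom J g)).
- by apply: cstar_bounded0; apply/mult_normP => //; exact: mult_bnd0.
- by move=> a; rewrite (star_hom0 (qJ_hom J)).
Qed.

Lemma trivial_bounded t : trivial_busby t -> bounded_busby t.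
Proof.
move=> [p [ph pg pb pt]]; have tE : t = @qJ _ _ J \o p by apply/funext.
split; first split.
- by rewrite tE; apply: star_hom_comp ph; exact: qJ_hom.
- by move=> g a; rewrite !pt pg gcalgebraE.
rewrite tE (_ : _ \o (_ \o _) = @qcor _ J \o p); last first.
  by apply/funext => a; exact: to_coronaE.
apply: (cstar_bounded_map (k := 1)) pb; first by have [] := qcor_hom J.
move=> m c c0 /mult_normP mc; rewrite mul1r; apply: corona_norm_le => //; exact: mc.
Qed.

Lemma trivial_busby_sum V1 V2 t1 t2 : inv_isometries V1 V2 ->
  trivial_busby t1 -> trivial_busby t2 -> trivial_busby (busby_sum V1 V2 t1 t2).
Proof.
move=> Vi [p1 [h1 g1 b1 e1]] [p2 [h2 g2 b2 e2]].
have [i1 i2 v1 v2 _] := Vi; have Vo := isofam_orth (inv_isometries_family Vi).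
exists (fun a => V1 ** p1 a ** adj V1 + V2 ** p2 a ** adj V2); split.
- have ph i : star_hom (pairf p1 p2 i) by rewrite /pairf; case: ifP.
  have := fam_diag_hom (@smone _ J) Vo ph; congr star_hom.
  by apply/funext => a; rewrite sum_pairf.
- move=> g a; have gh := gmult_hom J g.
  by rewrite (star_homD gh) !(star_homM gh) !(star_hom_adj gh) v1 v2 g1 g2.
- apply: cstar_boundedD; first exact: mult_normD.
    apply: (cstar_bounded_map (F := fun m => V1 ** m ** adj V1)) b1.
      exact: conj_linear.
    by move=> m c; apply: mult_norm_conj; exact: isometry_bnd.
  apply: (cstar_bounded_map (F := fun m => V2 ** m ** adj V2)) b2.
    exact: conj_linear.
  by move=> m c; apply: mult_norm_conj; exact: isometry_bnd.
- by move=> a; rewrite /busby_sum e1 e2 qJD !qJM !qJA.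
Qed.

Lemma bounded_busby_sum V1 V2 b1 b2 : inv_isometries V1 V2 ->
  bounded_busby b1 -> bounded_busby b2 -> bounded_busby (busby_sum V1 V2 b1 b2).
Proof.
move=> Vi [[h1 g1] c1] [[h2 g2] c2].
have [i1 i2 _ _ _] := Vi; have Vf := inv_isometries_family Vi.
have v1 : almost_inv V1 := isofam_inv Vf ord0.
have v2 : almost_inv V2 := isofam_inv Vf ord_max.
split; first split.
- have bh i : star_hom (pairf b1 b2 i) by rewrite /pairf; case: ifP.
  rewrite busby_sumE; exact: (fam_diag_hom (@smulc1 _ _ J) (isofam_qorth Vf) bh).
- move=> g a; have gh := gcalgebra_hom J g.
  by rewrite /busby_sum (star_homD gh) !(star_homM gh) !(star_hom_adj gh) v1 v2 g1 g2.
pose F V (X : corona J) : corona J :=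
  qcor V ** X ** adj (qcor V).
rewrite (_ : _ \o _ = fun a => (F V1 \o (@to_corona _ _ J \o b1)) a +
    (F V2 \o (@to_corona _ _ J \o b2)) a); last first.
  apply/funext => a /=; have ch := to_corona_hom J.
  by rewrite /busby_sum (star_homD ch) !(star_homM ch) !(star_hom_adj ch) !to_coronaE.
apply: cstar_boundedD; first exact: corona_normD.
  apply: (cstar_bounded_map (k := 1)) c1; first exact: conj_linear.
  by move=> X c; apply: corona_norm_conj; exact: isometry_bnd.
apply: (cstar_bounded_map (k := 1)) c2; first exact: conj_linear.
by move=> X c; apply: corona_norm_conj; exact: isometry_bnd.
Qed.

End BusbyClosure.

Section BusbyPullback.
Variables (R : realType) (G : topGroupType) (A A' : cga R G) (J : csi R G).
Variable phi : cga_mor A A'.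
Implicit Types b t : carrier A' -> calg J.

Lemma bounded_busby_precomp b : bounded_busby b -> bounded_busby (b \o phi).
Proof.
move=> [[bh bg] bb]; split; first split.
- exact: star_hom_comp bh (cga_fun_hom phi).
- by move=> g a /=; rewrite cga_fun_equiv bg.
- exact: cstar_bounded_precomp bb.
Qed.

Lemma trivial_busby_precomp t : trivial_busby t -> trivial_busby (t \o phi).
Proof.
move=> [p [ph pg pb pt]]; exists (p \o phi); split.
- exact: star_hom_comp ph (cga_fun_hom phi).
- by move=> g a /=; rewrite cga_fun_equiv pg.
- exact: cstar_bounded_precomp pb.
- by move=> a; exact: pt.
Qed.

Lemma stably_equiv_precomp b b' :
  stably_equiv b b' -> stably_equiv (b \o phi) (b' \o phi).
Proof.
move=> [t [t' [V1 [V2 [ht ht' Vi [u hu uE]]]]]].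
exists (t \o phi), (t' \o phi), V1, V2; split=> //; try exact: trivial_busby_precomp.
by exists u => // a; exact: uE.
Qed.

End BusbyPullback.

Section BusbyPushforward.
Variables (R : realType) (G : topGroupType) (A : cga R G) (J J' : csi R G).
Variable psi : csi_mor J J'.
Implicit Types b t : carrier A -> calg J.

Lemma trivial_busby_postcomp t : trivial_busby t -> trivial_busby (q_mor psi \o t).
Proof.
move=> [p [ph pg pb pt]]; have eh := csi_ext_hom psi.
exists (csi_ext psi \o p); split.
- exact: star_hom_comp eh ph.
- by move=> g a /=; rewrite pg csi_ext_equiv.
- apply: (cstar_bounded_map (k := 2)) pb; first by have [] := eh.
  move=> m c c0 /mult_normP mc; apply/mult_normP; first by rewrite mulr_ge0.
  by apply: star_hom_mult_bnd => //; exact: mc.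
- by move=> a /=; rewrite pt q_morE.
Qed.

Lemma bounded_busby_postcomp b : bounded_busby b -> bounded_busby (q_mor psi \o b).
Proof.
move=> [[bh bg] bb]; have eh := csi_ext_hom psi; split; first split.
- exact: star_hom_comp (q_mor_hom psi) bh.
- by move=> g a /=; rewrite bg q_mor_equiv.
pose F : corona J -> corona J' := qmap (csi_ext psi).
have FE m : F (piq _ m) = piq _ (csi_ext psi m).
  by apply: qmapE; [exact: star_homB|exact: csi_ext_full].
rewrite (_ : _ \o _ = F \o (@to_corona _ _ J \o b)); last first.
  apply/funext => a /=; have [m ->] := qJ_surj (b a).
  by rewrite q_morE !to_coronaE FE.
apply: (cstar_bounded_map (k := 2)) bb.
  by have [] := qmap_hom eh (@csi_ext_full _ _ _ _ psi).
apply: corona_norm_map FE _ => // m c; exact: star_hom_mult_bnd.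
Qed.

End BusbyPushforward.

(** * Stable equivalence *)

Section StableEquivalence.
Variables (R : realType) (G : topGroupType) (A : cga R G) (J : csi R G).
Variables (V1 V2 : mult J) (Vi : inv_isometries V1 V2).
Implicit Types (b c d t : carrier A -> calg J) (u v : mult J).
Local Notation "b [+] c" := (busby_sum V1 V2 b c) (at level 50, left associativity).
Local Notation "b ~ c" := (strongly_equiv b c) (at level 70).
Local Notation o := (mone J).

Let Vf : iso_family (pairf V1 V2) := inv_isometries_family Vi.

Let sumE b b' c c' : b ~ b' -> c ~ c' -> b [+] c ~ b' [+] c'.
Proof. exact: busby_sum_equiv. Qed.

Lemma busby_sumACA a b c d : (a [+] b) [+] (c [+] d) ~ (a [+] c) [+] (b [+] d).
Proof.
have r := @strongly_equiv_refl _ _ A J.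
have A1 x y z := @busby_sumA _ _ A J V1 V2 x y z Vf.
have A2 x y z := strongly_equiv_sym (A1 x y z).
apply: strongly_equiv_trans (A2 _ _ _) _.
apply: strongly_equiv_trans (A1 _ _ _); apply: sumE; first exact: r.
apply: strongly_equiv_trans (A1 _ _ _) _.
apply: strongly_equiv_trans (A2 _ _ _); apply: sumE; last exact: r.
exact: busby_sumC.
Qed.

Lemma stably_equivP b b' : stably_equiv b b' <->
  exists t t', [/\ trivial_busby t, trivial_busby t' & b [+] t ~ b' [+] t'].
Proof.
have r := @strongly_equiv_refl _ _ A J.
split=> [[t [t' [W1 [W2 [ht ht' Wi h]]]]]|[t [t' [ht ht' h]]]]; exists t, t'.
  have Wf := inv_isometries_family Wi; split; [exact: ht|exact: ht'|].
  apply: strongly_equiv_trans (busby_sum_equiv Vf Wf (r _) (r _)) _.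
  exact: strongly_equiv_trans h (busby_sum_equiv Wf Vf (r _) (r _)).
exists V1, V2; split; [exact: ht|exact: ht'|exact: Vi|exact: h].
Qed.

Lemma stably_equiv_refl b : stably_equiv b b.
Proof.
apply/stably_equivP; exists (fun=> 0), (fun=> 0).
by split; [exact: trivial_busby0|exact: trivial_busby0|exact: strongly_equiv_refl].
Qed.

Lemma stably_equiv_sym b b' : stably_equiv b b' -> stably_equiv b' b.
Proof.
move=> /stably_equivP[t [t' [ht ht' h]]]; apply/stably_equivP; exists t', t.
by split; [exact: ht'|exact: ht|exact: strongly_equiv_sym h].
Qed.

Lemma stably_equiv_sum b b' c c' :
  stably_equiv b b' -> stably_equiv c c' -> stably_equiv (b [+] c) (b' [+] c').
Proof.
move=> /stably_equivP[t [t' [ht ht' h]]] /stably_equivP[s [s' [hs hs' k]]].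
apply/stably_equivP; exists (t [+] s), (t' [+] s').
split; [exact: trivial_busby_sum|exact: trivial_busby_sum|].
apply: strongly_equiv_trans (busby_sumACA _ _ _ _) _.
by apply: strongly_equiv_trans (busby_sumACA _ _ _ _); exact: sumE.
Qed.

(** Adding the trivial mappings of both hypotheses to all terms makes the two
    strong equivalences composable. *)
Lemma stably_equiv_trans b b' b'' :
  stably_equiv b b' -> stably_equiv b' b'' -> stably_equiv b b''.
Proof.
move=> /stably_equivP[t [t' [ht ht' h]]] /stably_equivP[s [s' [hs hs' k]]].
have r := @strongly_equiv_refl _ _ A J.
have A1 x y z := @busby_sumA _ _ A J V1 V2 x y z Vf.
apply/stably_equivP; exists (t [+] s), (s' [+] t').
split; [exact: trivial_busby_sum|exact: trivial_busby_sum|].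
apply: strongly_equiv_trans (A1 _ _ _) _.
apply: strongly_equiv_trans (sumE h (r s)) _.
apply: strongly_equiv_trans (strongly_equiv_sym (A1 _ _ _)) _.
apply: strongly_equiv_trans (sumE (r b') (busby_sumC t' s Vf)) _.
apply: strongly_equiv_trans (A1 _ _ _) _.
apply: strongly_equiv_trans (sumE k (r t')) _.
exact: strongly_equiv_sym (A1 _ _ _).
Qed.

Lemma strong_stably_equiv b b' : b ~ b' -> stably_equiv b b'.
Proof.
move=> h; apply/stably_equivP; exists (fun=> 0), (fun=> 0).
split; [exact: trivial_busby0|exact: trivial_busby0|].
by apply: sumE => //; exact: strongly_equiv_refl.
Qed.

Lemma stably_equiv_add_trivial b t : trivial_busby t -> stably_equiv (b [+] t) b.
Proof.
move=> ht; apply/stably_equivP; exists (fun=> 0), (t [+] (fun=> 0)).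
have h0 := trivial_busby0 A J; split; [exact: h0|exact: trivial_busby_sum|].
exact: strongly_equiv_sym (busby_sumA _ _ _ Vf).
Qed.

Lemma trivial_stably_equiv t t' :
  trivial_busby t -> trivial_busby t' -> stably_equiv t t'.
Proof.
by move=> ht ht'; apply/stably_equivP; exists t', t;
  split; [exact: ht'|exact: ht|exact: busby_sumC].
Qed.

(** A partial isometry [v] becomes a unitary after adding a zero summand. With
    [e = 1 - adj v ** v] and [f = 1 - v ** adj v], the elements
    [P = V1 v + V2 e] and [Q = V1 f + V2 (adj v)] are again isometries with
    complementary ranges. The sum of [b] and [0] along [(P, Q)] is the sum of
    [v b (adj v)] and [0] along [(V1, V2)], because [e b = b e = 0]. *)
Lemma partial_isometry_stably_equiv v b b' : v ** adj v ** v = v -> almost_inv v ->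
  (forall a, b a ** (adj (qJ v) ** qJ v) = b a) ->
  (forall a, (adj (qJ v) ** qJ v) ** b a = b a) ->
  (forall a, b' a = qJ v ** b a ** adj (qJ v)) -> stably_equiv b b'.
Proof.
move=> vv vi bv vb b'E.
have avv : adj v ** v ** adj v = adj v.
  by have := congr1 (@adj _ _) vv; rewrite !adjM adjK smulA.
have [v11 v22 _ _ sV] := Vi; have v12 : adj V1 ** V2 = 0 := isofam_orth Vf ord0 ord_max.
have v21 : adj V2 ** V1 = 0 := isofam_orth Vf ord_max ord0.
have vi1 : almost_inv V1 := isofam_inv Vf ord0.
have vi2 : almost_inv V2 := isofam_inv Vf ord_max.
have [e eE] : exists e, e = o - adj v ** v by exists (o - adj v ** v).
have [f fE] : exists f, f = o - v ** adj v by exists (o - v ** adj v).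
have ae : adj e = e by rewrite eE adjB adjM adjK adj_mone.
have af : adj f = f by rewrite fE adjB adjM adjK adj_mone.
have ve : v ** e = 0 by rewrite eE smulBr smone smulA vv subrr.
have eva : e ** adj v = 0 by rewrite eE smulBl smul1 avv subrr.
have fv : f ** v = 0 by rewrite fE smulBl smul1 vv subrr.
have vaf : adj v ** f = 0 by rewrite fE smulBr smone smulA avv subrr.
have ee : e ** e = e by rewrite {1}eE smulBl smul1 -smulA ve smulr0 subr0.
have ff : f ** f = f by rewrite {1}fE smulBl smul1 -smulA vaf smulr0 subr0.
have ei : almost_inv e.
  rewrite eE; apply: almost_invD; first exact: almost_inv1.
  by apply/almost_invN/almost_invM => //; exact: almost_inv_adj.
have fi : almost_inv f.
  rewrite fE; apply: almost_invD; first exact: almost_inv1.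
  by apply/almost_invN/almost_invM => //; exact: almost_inv_adj.
pose P := V1 ** v + V2 ** e; pose Q := V1 ** f + V2 ** adj v.
have aP : adj P = adj v ** adj V1 + e ** adj V2 by rewrite adjD !adjM ae.
have aQ : adj Q = f ** adj V1 + v ** adj V2 by rewrite adjD !adjM adjK af.
have m11 x : x ** adj V1 ** V1 = x by rewrite -smulA v11 smone.
have m22 x : x ** adj V2 ** V2 = x by rewrite -smulA v22 smone.
have m12 x : x ** adj V1 ** V2 = 0 by rewrite -smulA v12 smulr0.
have m21 x : x ** adj V2 ** V1 = 0 by rewrite -smulA v21 smulr0.
have PP : adj P ** P = o.
  rewrite aP /P smulDl !smulDr !smulA m11 m12 m21 m22 !smul0r addr0 add0r ee.
  by rewrite eE addrC subrK.
have QQ : adj Q ** Q = o.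
  rewrite aQ /Q smulDl !smulDr !smulA m11 m12 m21 m22 !smul0r addr0 add0r ff.
  by rewrite fE subrK.
have PQ : P ** adj P + Q ** adj Q = o.
  rewrite aP aQ /P /Q !smulDl !smulDr !smulA.
  rewrite -[V1 ** v ** e]smulA ve smulr0 smul0r addr0.
  rewrite -[V2 ** e ** adj v]smulA eva smulr0 smul0r add0r.
  rewrite -[V1 ** f ** v]smulA fv smulr0 smul0r addr0.
  rewrite -[V2 ** adj v ** f]smulA vaf smulr0 smul0r add0r.
  rewrite -[V2 ** e ** e]smulA ee -[V1 ** f ** f]smulA ff.
  rewrite addrACA -!smulDl -!(smulA V1) -!(smulA V2) -!smulDr.
  by rewrite eE fE [v ** _ + _]addrC !subrK !smone sV.
have PQf : iso_family (pairf P Q).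
  apply: iso_pair => //.
  - by apply: almost_invD; apply: almost_invM.
  - by apply: almost_invD; apply: almost_invM => //; exact: almost_inv_adj.
apply/stably_equivP; exists (fun=> 0), (fun=> 0).
split; [exact: trivial_busby0|exact: trivial_busby0|].
have r := @strongly_equiv_refl _ _ A J.
apply: strongly_equiv_trans (busby_sum_equiv Vf PQf (r _) (r _)) _.
rewrite (_ : busby_sum P Q b _ = b' [+] (fun=> 0)); first exact: r.
apply/funext => a; rewrite /busby_sum !smulr0 !smul0r !addr0.
have eb : qJ e ** b a = 0.
  rewrite eE (star_homB (qJ_hom J)) smulBl [qJ o ** _]smul1c qJM qJA vb subrr //.
have be : b a ** qJ e = 0.
  rewrite eE (star_homB (qJ_hom J)) smulBr [_ ** qJ o]smulc1 qJM qJA bv subrr //.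
rewrite -qJA aP /P !qJD !qJM !qJA b'E smulDl -[qJ V2 ** _ ** _]smulA eb smulr0 addr0.
rewrite smulDr -!smulA [b a ** (qJ e ** _)]smulA be smul0r !smulr0 addr0.
by [].
Qed.

End StableEquivalence.

(** * Functoriality of stable equivalence *)

Section PushforwardStable.
Variables (R : realType) (G : topGroupType) (A : cga R G) (J J' : csi R G).
Variable psi : csi_mor J J'.
Variables (V1 V2 : mult J) (Vi : inv_isometries V1 V2).
Variables (W1 W2 : mult J') (Wi : inv_isometries W1 W2).
Implicit Types b t : carrier A -> calg J.
Local Notation e := (csi_ext psi).
Local Notation q := (q_mor psi).

Let eh : star_hom e := csi_ext_hom psi.
Let qh : star_hom q := q_mor_hom psi.

(** The extension of [psi] need not be unital, so unitaries and isometries are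
    only mapped to partial isometries with initial projection [p = e 1]; but
    [p] acts as a unit on the image of [q]. *)
Lemma ext_one_l x : qJ (e (mone J)) ** q x = q x.
Proof. by rewrite -q_morE -(star_homM qh) [_ ** x]smul1c. Qed.

Lemma ext_one_r x : q x ** qJ (e (mone J)) = q x.
Proof. by rewrite -q_morE -(star_homM qh) [x ** _]smulc1. Qed.

Lemma almost_inv_ext u : almost_inv u -> almost_inv (e u).
Proof. by move=> ui g; rewrite -q_morE -q_mor_equiv ui. Qed.

Lemma strongly_equiv_postcomp b b' :
  strongly_equiv b b' -> stably_equiv (q \o b) (q \o b').
Proof.
move=> [u [[u1 u2] ui] ub].
have pE : adj (qJ (e u)) ** qJ (e u) = qJ (e (mone J)).
  by rewrite -qJA -qJM -(star_hom_adj eh) -(star_homM eh) u1.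
apply: (partial_isometry_stably_equiv Wi (v := e u)).
- by rewrite -(star_hom_adj eh) -!(star_homM eh) u2 smul1.
- exact: almost_inv_ext.
- by move=> a /=; rewrite pE ext_one_r.
- by move=> a /=; rewrite pE ext_one_l.
- by move=> a /=; rewrite ub !(star_homM qh) (star_hom_adj qh) q_morE.
Qed.

(** The partial isometry [v = W1 (e V1)^* + W2 (e V2)^*] has initial projection
    [e 1] and carries the image of the first sum to the second sum. *)
Lemma q_mor_busby_sum b1 b2 :
  stably_equiv (q \o busby_sum V1 V2 b1 b2) (busby_sum W1 W2 (q \o b1) (q \o b2)).
Proof.
have [v11 v22 _ _ sV] := Vi; have Vf := inv_isometries_family Vi.
have [w11 w22 _ _ _] := Wi; have Wf := inv_isometries_family Wi.
have v12 : adj V1 ** V2 = 0 := isofam_orth Vf ord0 ord_max.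
have w12 : adj W1 ** W2 = 0 := isofam_orth Wf ord0 ord_max.
have w21 : adj W2 ** W1 = 0 := isofam_orth Wf ord_max ord0.
have vi1 : almost_inv V1 := isofam_inv Vf ord0.
have vi2 : almost_inv V2 := isofam_inv Vf ord_max.
have wi1 : almost_inv W1 := isofam_inv Wf ord0.
have wi2 : almost_inv W2 := isofam_inv Wf ord_max.
pose v := W1 ** e (adj V1) + W2 ** e (adj V2).
have av : adj v = e V1 ** adj W1 + e V2 ** adj W2.
  by rewrite adjD !adjM -!(star_hom_adj eh) !adjK.
have m11 x : x ** adj W1 ** W1 = x by rewrite -smulA w11 smone.
have m22 x : x ** adj W2 ** W2 = x by rewrite -smulA w22 smone.
have m12 x : x ** adj W1 ** W2 = 0 by rewrite -smulA w12 smulr0.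
have m21 x : x ** adj W2 ** W1 = 0 by rewrite -smulA w21 smulr0.
have avv : adj v ** v = e (mone J).
  rewrite av /v smulDl !smulDr !smulA m11 m12 m21 m22 !smul0r addr0 add0r.
  by rewrite -!(star_homM eh) -(star_homD eh) sV.
have pE : adj (qJ v) ** qJ v = qJ (e (mone J)) by rewrite -qJA -qJM avv.
apply: (partial_isometry_stably_equiv Wi (v := v)).
- by rewrite -smulA avv /v smulDl -!smulA -!(star_homM eh) !smone.
- by apply: almost_invD; apply: almost_invM => //; apply/almost_inv_ext/almost_inv_adj.
- by move=> a /=; rewrite pE ext_one_r.
- by move=> a /=; rewrite pE ext_one_l.
have qz z z' : adj (q (qJ z)) ** q (qJ z') = q (qJ (adj z ** z')).
  by rewrite -(star_hom_adj qh) -(star_homM qh) -qJA -qJM.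
move=> a /=; apply/esym.
rewrite (star_homD qh) !(star_homM qh) !(star_hom_adj qh).
apply: (@partial_row_conj _ _ _ _ _ _ _ _ (qJ (e (mone J)))).
- by rewrite qz v11 q_morE.
- by rewrite qz v22 q_morE.
- by rewrite qz v12 (star_hom0 (qJ_hom J)) (star_hom0 qh).
- exact: ext_one_l.
- exact: ext_one_r.
- exact: ext_one_l.
- exact: ext_one_r.
- by rewrite /v qJD !qJM -!q_morE !qJA !(star_hom_adj qh).
Qed.

Lemma stably_equiv_postcomp b b' :
  stably_equiv b b' -> stably_equiv (q \o b) (q \o b').
Proof.
move=> /(stably_equivP Vi)[t [t' [ht ht' h]]].
have add_t (c s : carrier A -> calg J) : trivial_busby s ->
    stably_equiv (q \o busby_sum V1 V2 c s) (q \o c).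
  move=> hs; apply: (stably_equiv_trans Wi (q_mor_busby_sum c s)).
  exact/(stably_equiv_add_trivial Wi)/trivial_busby_postcomp.
apply: (stably_equiv_trans Wi _ (add_t b' t' ht')).
apply: (stably_equiv_trans Wi _ (strongly_equiv_postcomp h)).
exact: (stably_equiv_sym Wi (add_t b t ht)).
Qed.

End PushforwardStable.

(** * The monoid of stable equivalence classes *)

Section ExtMonoidStructure.
Variables (R : realType) (G : topGroupType) (A : cga R G) (J : csi R G).
Implicit Types (b : carrier A -> calg J) (X Y : Ext A J).

Lemma ext_class_eq b b' (hb : bounded_busby b) (hb' : bounded_busby b') :
  ext_class hb = ext_class hb' <-> stably_equiv b b'.
Proof.
have [V1 [V2 Vi]] := inv_isometries_exist J.
split=> [/(congr1 sval) /= bb'|bb'].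
  have : stable_class b' b' by split; [exact: hb'|exact: stably_equiv_refl Vi b'].
  by rewrite -bb' => -[].
apply: eq_exist; apply/seteqP; split=> c [hc cb].
  split; first exact: hc.
  exact: (stably_equiv_trans Vi (stably_equiv_sym Vi bb') cb).
split; first exact: hc.
exact: (stably_equiv_trans Vi bb' cb).
Qed.

Lemma ext_repr_ex X : exists b, exists hb : bounded_busby b, X = ext_class hb.
Proof. by case: X => S [b hb SE]; exists b, hb; exact: eq_exist. Qed.

Definition ext_repr X := sval (cid (ext_repr_ex X)).

Lemma ext_repr_bounded X : bounded_busby (ext_repr X).
Proof. by rewrite /ext_repr; case: cid => b []. Qed.

Lemma ext_reprK X : ext_class (ext_repr_bounded X) = X.
Proof.
have [hb XE] := svalP (cid (ext_repr_ex X)); rewrite [RHS]XE.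
have [V1 [V2 Vi]] := inv_isometries_exist J.
by apply/ext_class_eq; exact: stably_equiv_refl Vi _.
Qed.

Lemma ext_repr_class b (hb : bounded_busby b) :
  stably_equiv (ext_repr (ext_class hb)) b.
Proof. exact: (ext_class_eq (ext_repr_bounded _) hb).1 (ext_reprK _). Qed.

Variables (V1 V2 : mult J) (Vi : inv_isometries V1 V2).

Definition class_add X Y : Ext A J :=
  ext_class (bounded_busby_sum Vi (ext_repr_bounded X) (ext_repr_bounded Y)).

Definition class_zero : Ext A J := ext_class (trivial_bounded (trivial_busby0 A J)).

Lemma class_addE W1 W2 b b' (hb : bounded_busby b) (hb' : bounded_busby b')
    (h : bounded_busby (busby_sum W1 W2 b b')) : inv_isometries W1 W2 ->
  class_add (ext_class hb) (ext_class hb') = ext_class h.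
Proof.
move=> Wi; apply/ext_class_eq; apply: (stably_equiv_trans Vi).
  apply: stably_equiv_sum => //; exact: ext_repr_class.
apply: (strong_stably_equiv Vi); apply: busby_sum_equiv;
  [exact: inv_isometries_family|exact: inv_isometries_family| |];
  exact: strongly_equiv_refl.
Qed.

Lemma ext_classW (P : Ext A J -> Prop) :
  (forall b (hb : bounded_busby b), P (ext_class hb)) -> forall X, P X.
Proof. by move=> h X; rewrite -(ext_reprK X). Qed.

Let addE b b' (hb : bounded_busby b) (hb' : bounded_busby b') :
  class_add (ext_class hb) (ext_class hb') = ext_class (bounded_busby_sum Vi hb hb').
Proof. exact: class_addE. Qed.

Fact class_addA : associative class_add.
Proof.
elim/ext_classW=> b hb; elim/ext_classW=> c hc; elim/ext_classW=> d hd.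
apply: etrans (congr1 (class_add (ext_class hb)) (addE hc hd)) _.
apply: etrans (addE hb (bounded_busby_sum Vi hc hd)) _; apply/esym.
apply: etrans (congr1 (class_add^~ (ext_class hd)) (addE hb hc)) _.
apply: etrans (addE (bounded_busby_sum Vi hb hc) hd) _; apply/ext_class_eq.
apply/(stably_equiv_sym Vi)/(strong_stably_equiv Vi).
exact: (busby_sumA b c d (inv_isometries_family Vi)).
Qed.

Fact class_addC : commutative class_add.
Proof.
elim/ext_classW=> b hb; elim/ext_classW=> c hc.
apply: etrans (addE hb hc) _; apply/esym.
apply: etrans (addE hc hb) _; apply/ext_class_eq/(strong_stably_equiv Vi).
exact: (busby_sumC c b (inv_isometries_family Vi)).
Qed.

Fact class_add0 : left_id class_zero class_add.
Proof.
elim/ext_classW=> b hb; rewrite class_addC; apply: etrans (addE hb _) _.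
apply/ext_class_eq.
exact: (stably_equiv_add_trivial Vi b (trivial_busby0 A J)).
Qed.

Definition ext_structure : monoid_on_Ext A J :=
  GRing.isNmodule.Build (Ext A J) class_addA class_addC class_add0.

Lemma ext_structureP : Ext_monoid ext_structure.
Proof.
split.
- exact: ext_class_eq.
- by exists V1, V2.
- move=> W1 W2 b1 b2 h1 h2 Wi; exists (bounded_busby_sum Wi h1 h2).
  exact: class_addE.
- move=> t ht; exists (trivial_bounded ht); apply/ext_class_eq.
  exact: (trivial_stably_equiv Vi (trivial_busby0 A J) ht).
Qed.

End ExtMonoidStructure.

(** * The functor Ext *)

Lemma q_mor_id (R : realType) (G : topGroupType) (J : csi R G) x :
  q_mor (csi_id J) x = x.
Proof. by have [m ->] := qJ_surj x; rewrite q_morE. Qed.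

Lemma q_mor_comp (R : realType) (G : topGroupType) (J J' J'' : csi R G)
    (g : csi_mor J' J'') (f : csi_mor J J') x :
  q_mor (csi_comp g f) x = q_mor g (q_mor f x).
Proof. by have [m ->] := qJ_surj x; rewrite !q_morE. Qed.

Section ExtFunctor.
Variables (R : realType) (G : topGroupType).

Definition isom_pair (J : csi R G) : {V : mult J * mult J | inv_isometries V.1 V.2}.
Proof.
apply: cid; have [V1 [V2 Vi]] := inv_isometries_exist J.
by exists (V1, V2).
Qed.

Definition ext_nmod_structure (A : cga R G) (J : csi R G) : monoid_on_Ext A J :=
  ext_structure A (svalP (isom_pair J)).

Section Maps.
Variables (A A' : cga R G) (J J' : csi R G).
Variables (phi : cga_mor A A') (psi : csi_mor J J').

Definition ext_map_busby (b : carrier A' -> calg J) : carrier A -> calg J' :=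
  q_mor psi \o (b \o phi).

Lemma ext_map_bounded b : bounded_busby b -> bounded_busby (ext_map_busby b).
Proof. by move=> hb; apply/bounded_busby_postcomp/bounded_busby_precomp. Qed.

Definition ext_map (X : Ext A' J) : Ext A J' :=
  ext_class (ext_map_bounded (ext_repr_bounded X)).

Lemma ext_mapE b (hb : bounded_busby b) :
  ext_map (ext_class hb) = ext_class (ext_map_bounded hb).
Proof.
have [V1 [V2 Vi]] := inv_isometries_exist J.
have [W1 [W2 Wi]] := inv_isometries_exist J'.
apply/ext_class_eq/(stably_equiv_postcomp psi Vi Wi)/stably_equiv_precomp.
exact: ext_repr_class.
Qed.

Variables (V1 V2 : mult J) (Vi : inv_isometries V1 V2).
Variables (W1 W2 : mult J') (Wi : inv_isometries W1 W2).

Lemma ext_map_zero : ext_map (class_zero A' J) = class_zero A J'.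
Proof.
rewrite ext_mapE; apply/ext_class_eq.
apply: (trivial_stably_equiv Wi _ (trivial_busby0 A J')).
exact/trivial_busby_postcomp/trivial_busby_precomp/trivial_busby0.
Qed.

Lemma ext_map_add X Y :
  ext_map (class_add Vi X Y) = class_add Wi (ext_map X) (ext_map Y).
Proof.
elim/ext_classW: X => b hb; elim/ext_classW: Y => c hc.
rewrite (class_addE Vi hb hc (bounded_busby_sum Vi hb hc) Vi).
apply: etrans (ext_mapE _) _; apply/esym.
apply: etrans (congr2 (class_add Wi) (ext_mapE hb) (ext_mapE hc)) _.
apply: etrans (class_addE Wi _ _ (bounded_busby_sum Wi (ext_map_bounded hb)
  (ext_map_bounded hc)) Wi) _.
apply/esym/ext_class_eq.
exact: (q_mor_busby_sum psi Vi Wi (b \o phi) (c \o phi)).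
Qed.

End Maps.

Local Notation ExtM A J := (Ext_nmod (ext_nmod_structure A J)).

Definition ext_map_morphism (A A' : cga R G) (J J' : csi R G)
    (phi : cga_mor A A') (psi : csi_mor J J') : {additive ExtM A' J -> ExtM A J'} :=
  HB.pack (ext_map phi psi : ExtM A' J -> ExtM A J')
    (GRing.isNmodMorphism.Build (ExtM A' J) (ExtM A J') (ext_map phi psi)
      (conj (ext_map_zero phi psi (svalP (isom_pair J')))
         (ext_map_add phi psi (svalP (isom_pair J)) (svalP (isom_pair J'))))).

End ExtFunctor.

Theorem proposition2p1 (R : realType) (G : topGroupType)
    (scG : @second_countable G) (lcG : locally_compact [set: G]) :
  exists (S : forall (A : cga R G) (J : csi R G), monoid_on_Ext A J)
         (F : forall X Y, Mor X Y -> Mor (Ext_obj S X) (Ext_obj S Y)),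
  [/\ forall (A : cga R G) (J : csi R G), Ext_monoid (S A J),
      forall (A : cga R G) (J J' : csi R G) (psi : csi_mor J J')
          (b : carrier A -> calg J) (hb : bounded_busby b),
        exists h : bounded_busby (q_mor psi \o b),
          F (A, J) (A, J') (cga_id A, psi) (ext_class hb) = ext_class h,
      forall (A A' : cga R G) (J : csi R G) (phi : cga_mor A A')
          (b : carrier A' -> calg J) (hb : bounded_busby b),
        exists h : bounded_busby (b \o phi),
          F (A', J) (A, J) (phi, csi_id J) (ext_class hb) = ext_class h
    & is_functor F].
Proof.
exists (@ext_nmod_structure R G).
exists (fun X Y f => @ext_map_morphism R G Y.1 X.1 X.2 Y.2 f.1 f.2).
have ext_cong (A : cga R G) (J : csi R G) (b b' : carrier A -> calg J)
    (hb : bounded_busby b) (hb' : bounded_busby b') :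
    b = b' -> ext_class hb = ext_class hb'.
  by move=> bb'; subst b'; rewrite (Prop_irrelevance hb hb').
split.
- by move=> A J; exact: ext_structureP.
- move=> A J J' psi b hb; exists (bounded_busby_postcomp psi hb).
  rewrite /= ext_mapE; exact: ext_cong.
- move=> A A' J phi b hb; exists (bounded_busby_precomp phi hb).
  rewrite /= ext_mapE; apply: ext_cong; apply/funext => a; exact: q_mor_id.
split=> [X|X Y Z g f]; apply: additive_ext => x.
  elim/ext_classW: x => b hb; rewrite /= ext_mapE; apply: ext_cong.
  by apply/funext => a; exact: q_mor_id.
elim/ext_classW: x => b hb; rewrite /= !ext_mapE; apply: ext_cong.
apply/funext => a /=; rewrite /ext_map_busby /=.
exact: q_mor_comp.
Qed.
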